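(* Let $\mathcal K$ be a virtual double category that has all horizontal units and suppose that, for each object $A$ in $\mathcal K$, a cocartesian cell $\eta_A\colon(A)\Rightarrow I_A$ that defines its unit $I_A$ has been chosen. Consider to each unary cell $\phi\colon\underline J\Rightarrow K$ of $\mathcal K$ a new unary cell $\bar\phi\colon\underline J\Rightarrow K$ of the same form, and to each unary cell $\psi\colon\underline J\Rightarrow I_C$ of $\mathcal K$, with vertical source $f$ and vertical target $g$, a new nullary cell $\bar\psi\colon\underline J\Rightarrow C$ with vertical source $f$ and vertical target $g$. The objects and morphisms of $\mathcal K$, together with the unary cells $\bar\phi$ and the nullary cells $\bar\psi$, form an augmented virtual double category $N(\mathcal K)$ that has all horizontal units. Composition of cells in $N(\mathcal K)$ is given by $$\bar\psi\circ(\bar\phi_1,\dotsc,\bar\phi_n):=\overline{\psi'\circ(\phi_1,\dotsc,\phi_n)}$$ where $\psi'$ is the unique factorisation of $\psi$ through the cocartesian path of cells $(\eta_{\bar\phi_1},\dotsc,\eta_{\bar\phi_n})$, that is $\psi=\psi'\circ(\eta_{\bar\phi_1},\dotsc,\eta_{\bar\phi_n})$, where $\eta_{\bar\phi_i}:=\eta_{C_{i-1}}$ if $\bar\phi_i$ is nullary with horizontal target $(C_{i-1})$ and $\eta_{\bar\phi_i}:=\mathrm{id}_{K_i}$ if $\bar\phi_i$ is unary with horizontal target $K_i\colon C_{i-1}\nrightarrow C_i$. The identity cells, for morphisms $J\colon A\nrightarrow B$ and $f\colon A\to C$, are given by $\mathrm{id}_J:=\overline{\mathrm{id}_J}$ and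 $\mathrm{id}_f:=\overline{\eta_C\circ f}$. The strict $2$-functor $U\colon\mathsf{AugVirtDblCat}_{\mathrm u}\to\mathsf{VirtDblCat}_{\mathrm u}$ and the assignment $\mathcal K\mapsto N(\mathcal K)$ extend to form a strict $2$-equivalence $\mathsf{AugVirtDblCat}_{\mathrm u}\simeq\mathsf{VirtDblCat}_{\mathrm u}$.
   Context: **Augmented virtual double category (avdc)** $\mathcal K$: it consists of objects; a category of vertical morphisms $f\colon A\to C$ between these objects; horizontal morphisms $J\colon A\nrightarrow B$ between objects; and cells. A cell $\phi\colon\underline J\Rightarrow\underline K$ has a horizontal source $\underline J=(J_1,\dotsc,J_n)$, a path $J_i\colon A_{i-1}\nrightarrow A_i$ of length $n\ge0$ (the empty path at $A_0$ is written $(A_0)$); a horizontal target $\underline K$, a path from $C$ to $D$ of length at most $1$ (so $\underline K=K\colon C\nrightarrow D$, or $\underline K=(C)$ with $C=D$, also written $\phi\colon\underline J\Rightarrow C$); a vertical source $f\colon A_0\to C$ and a vertical target $g\colon A_n\to D$. It is unary if $\underline K$ has length $1$, nullary if $\underline K$ has length $0$, vertical if $\underline J$ and $\underline K$ are both empty, horizontal if $f$ and $g$ are identities. Given $n\ge1$ cells $\phi_i\colon\underline J_i\Rightarrow\underline K_i$, the vertical target of each being the vertical source of the next, and a cell $\psi\colon\underline K_1\frown\dotsb\frown\underline K_n\Rightarrow\underline L$ ($\frown$ denotes concatenation), there is a composite $\psi\circ(\phi_1,\dotsc,\phi_n)\colon\underline J_1\frown\dotsb\frown\underline J_n\Rightarrow\underline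 L$ whose vertical source (target) is that of $\psi$ composed with that of $\phi_1$ ($\phi_n$). There are identity cells $\mathrm{id}_J\colon J\Rightarrow J$ (horizontal) and $\mathrm{id}_f\colon f\Rightarrow f$ (vertical, $(A)\Rightarrow C$ with vertical source and target $f\colon A\to C$), with $\mathrm{id}_h\circ(\mathrm{id}_f)=\mathrm{id}_{h\circ f}$; $\mathrm{id}_A:=\mathrm{id}_{\mathrm{id}_A}$. Axioms: $\chi\circ(\psi_1\circ(\phi_{11},\dotsc,\phi_{1m_1}),\dotsc,\psi_n\circ(\phi_{n1},\dotsc,\phi_{nm_n}))=(\chi\circ(\psi_1,\dotsc,\psi_n))\circ(\phi_{11},\dotsc,\phi_{nm_n})$ whenever the left-hand side makes sense; $\mathrm{id}_C\circ(\phi)=\phi$, $\mathrm{id}_K\circ(\phi)=\phi$, $\phi\circ(\mathrm{id}_A)=\phi$, $\phi\circ(\mathrm{id}_{J_1},\dotsc,\mathrm{id}_{J_n})=\phi$ and $\psi\circ(\phi_1,\dotsc,\phi_i,\mathrm{id}_{f_i},\phi_{i+1},\dotsc,\phi_n)=\psi\circ(\phi_1,\dotsc,\phi_n)$ whenever these make sense. **Virtual double category**: the structure obtained by keeping only unary cells (and hence removing the vertical identity cells) from this definition; cells $\psi\colon(C)\Rightarrow K$ with empty horizontal source can still be precomposed with vertical morphisms $f$, giving $\psi\circ f$. **Units.** In either structure, a horizontal unary cell $\eta\colon(A)\Rightarrow I$, $I\colon A\nrightarrow A$, is cocartesian, and defines $I$ as the horizontal unit $I_A$ of $A$, if for all paths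 $\underline J'$ ending at $A$ and $\underline J''$ starting at $A$ (possibly empty), any cell $\chi$ with horizontal source $\underline J'\frown\underline J''$ factors uniquely as $\chi=\chi'\circ(\underline{\mathrm{id}},\eta,\underline{\mathrm{id}})$ with $\chi'$ having horizontal source $\underline J'\frown(I)\frown\underline J''$, the same horizontal target and the same vertical source and target, where $\underline{\mathrm{id}}$ denotes paths of identity cells. **$2$-categories.** A functor of avdcs (resp. virtual double categories) maps objects, vertical and horizontal morphisms and cells, preserving sources, targets, composites and identities strictly. A transformation $\xi\colon F\Rightarrow G$ of functors $\mathcal K\to\mathcal L$ consists of a natural transformation $\xi_A\colon FA\to GA$ between the restrictions to vertical morphisms and cells $\xi_J\colon FJ\Rightarrow GJ$ with vertical source $\xi_A$ and target $\xi_B$, for $J\colon A\nrightarrow B$, such that $G\phi\circ\xi_{\underline J}=\xi_{\underline K}\circ F\phi$ for every cell $\phi\colon\underline J\Rightarrow\underline K$, where $\xi_{\underline J}=(\xi_{J_1},\dotsc,\xi_{J_n})$, or $\xi_{\underline J}=\xi_A$ if $\underline J=(A)$. $\mathsf{AugVirtDblCat}_{\mathrm u}$ is the $2$-category of avdcs that have all horizontal units, all functors between them (these automatically preserve horizontal units) and all transformations. $\mathsf{VirtDblCat}_{\mathrm u}$ is the $2$-category of virtual double categories that have all horizontal units, normal functors (those preserving the cocartesian cells defining horizontal units) and all transformations. $U$ sends an avdc to the virtual double category of its unary cells. *)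

(* Defs.v *)
From Stdlib Require Import List ProofIrrelevance FunctionalExtensionality
  ClassicalEpsilon.
From Corelib Require Import ssreflect ssrbool.
Import ListNotations.
Set Implicit Arguments.
Unset Strict Implicit.
Unset Printing Implicit Defensive.
Set Bullet Behavior "None".

(** All structures below are single-sorted: vertical morphisms, horizontal
    morphisms and cells each form one type, equipped with boundary maps, and
    composites take a proof of composability.  In this way equations between
    cells, functors and transformations are plain equalities, without
    transport along equations between their boundaries.  *)

(** [chain s t a p b]: the consecutive members of [p] form a path from [a] to
    [b].  It is used for paths of horizontal morphisms between objects as well
    as for paths of cells between vertical morphisms.  *)
Fixpoint chain {A X : Type} (s t : X -> A) (a : A) (p : list X) (b : A) : Prop :=
  match p with
  | [] => a = b
  | x :: p' => s x = a /\ chain s t (t x) p' b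
  end.

Record base : Type := Base {
  ob : Type;
  vmor : Type;
  hmor : Type;
  vdom : vmor -> ob;
  vcod : vmor -> ob;
  hdom : hmor -> ob;
  hcod : hmor -> ob;
  vid : ob -> vmor;
  vcomp : forall g f : vmor, vcod f = vdom g -> vmor;
  vdom_id : forall A, vdom (vid A) = A;
  vcod_id : forall A, vcod (vid A) = A;
  vdom_comp : forall g f e, vdom (@vcomp g f e) = vdom f;
  vcod_comp : forall g f e, vcod (@vcomp g f e) = vcod g;
  vcomp_idl : forall A f e, @vcomp (vid A) f e = f;
  vcomp_idr : forall A f e, @vcomp f (vid A) e = f;
  vcomp_assoc : forall h g f e1 e2 e3 e4,
    @vcomp h (@vcomp g f e1) e2 = @vcomp (@vcomp h g e3) f e4
}.

(** Cells with their boundary: horizontal source [hs], horizontal target [ht],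
    vertical source [vs] and vertical target [vt].  [T] is the type of
    horizontal targets.  A horizontal source is recorded as the list of its
    morphisms: its endpoints are [vdom (vs phi)] and [vdom (vt phi)], so that
    an empty list stands for the empty path at [vdom (vs phi)].  *)
Record graph (T : base -> Type) : Type := Graph {
  gbase :> base;
  cell : Type;
  hs : cell -> list (hmor gbase);
  ht : cell -> T gbase;
  vs : cell -> vmor gbase;
  vt : cell -> vmor gbase
}.

Definition olist {X : Type} (o : option X) : list X :=
  match o with Some x => [x] | None => [] end.

(** [ht phi = Some K]: [phi] is unary, with horizontal target [K];
    [ht phi = None]: [phi] is nullary, with target [vcod (vs phi)].  *)
Notation avd_graph := (graph (fun B => option (hmor B))).

Definition acomposable (K : avd_graph) (psi : cell K) (phis : list (cell K)) : Prop :=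
  phis <> [] /\
  exists f g : vmor K,
    [/\ chain (@vs _ K) (@vt _ K) f phis g,
        vcod f = vdom (vs psi),
        vcod g = vdom (vt psi) &
        hs psi = flat_map (fun phi => olist (ht phi)) phis].

Record avd_data : Type := AvdData {
  ad_graph :> avd_graph;
  acomp : forall (psi : cell ad_graph) (phis : list (cell ad_graph)),
    acomposable psi phis -> cell ad_graph;
  aidh : hmor ad_graph -> cell ad_graph;
  aidv : vmor ad_graph -> cell ad_graph
}.

(** [apcomp [psi_1; ..] [Phi_1; ..] [theta_1; ..]]: [theta_i] is the composite
    of [psi_i] with the path of cells [Phi_i].  *)
Inductive apcomp (K : avd_data) :
    list (cell K) -> list (list (cell K)) -> list (cell K) -> Prop :=
| apcomp_nil : apcomp [] [] []
| apcomp_cons psi phis (H : acomposable psi phis) psis phiss thetas :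
    apcomp psis phiss thetas ->
    apcomp (psi :: psis) (phis :: phiss) (acomp H :: thetas).

Record is_avdc (K : avd_data) : Prop := IsAvdc {
  a_hs_chain : forall phi : cell K,
    chain (@hdom K) (@hcod K) (vdom (vs phi)) (hs phi) (vdom (vt phi));
  a_ht_chain : forall phi : cell K,
    chain (@hdom K) (@hcod K) (vcod (vs phi)) (olist (ht phi)) (vcod (vt phi));
  a_hs_comp : forall (psi : cell K) phis (H : acomposable psi phis),
    hs (acomp H) = flat_map (@hs _ K) phis;
  a_ht_comp : forall (psi : cell K) phis (H : acomposable psi phis),
    ht (acomp H) = ht psi;
  a_vs_comp : forall (psi : cell K) phis (H : acomposable psi phis) f g,
    chain (@vs _ K) (@vt _ K) f phis g ->
    forall e : vcod f = vdom (vs psi), vs (acomp H) = vcomp e;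
  a_vt_comp : forall (psi : cell K) phis (H : acomposable psi phis) f g,
    chain (@vs _ K) (@vt _ K) f phis g ->
    forall e : vcod g = vdom (vt psi), vt (acomp H) = vcomp e;
  a_hs_idh : forall J : hmor K, hs (aidh J) = [J];
  a_ht_idh : forall J : hmor K, ht (aidh J) = Some J;
  a_vs_idh : forall J : hmor K, vs (aidh J) = vid (hdom J);
  a_vt_idh : forall J : hmor K, vt (aidh J) = vid (hcod J);
  a_hs_idv : forall f : vmor K, hs (aidv f) = [];
  a_ht_idv : forall f : vmor K, ht (aidv f) = None;
  a_vs_idv : forall f : vmor K, vs (aidv f) = f;
  a_vt_idv : forall f : vmor K, vt (aidv f) = f;
  a_idv_comp : forall (h f : vmor K) (e : vcod f = vdom h)
    (H : acomposable (aidv h) [aidv f]), acomp H = aidv (vcomp e);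
  a_assoc : forall (chi : cell K) psis phiss thetas,
    apcomp psis phiss thetas ->
    forall (H1 : acomposable chi thetas) (H2 : acomposable chi psis)
           (H3 : acomposable (acomp H2) (concat phiss)),
    acomp H1 = acomp H3;
  a_idv_l : forall (C : ob K) (phi : cell K)
    (H : acomposable (aidv (vid C)) [phi]), acomp H = phi;
  a_idh_l : forall (J : hmor K) (phi : cell K)
    (H : acomposable (aidh J) [phi]), acomp H = phi;
  a_idv_r : forall (A : ob K) (phi : cell K)
    (H : acomposable phi [aidv (vid A)]), acomp H = phi;
  a_idh_r : forall (phi : cell K) (Js : list (hmor K))
    (H : acomposable phi (map (@aidh K) Js)), acomp H = phi;
  a_idv_del : forall (psi : cell K) phis1 (f : vmor K) phis2
    (H1 : acomposable psi (phis1 ++ aidv f :: phis2))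
    (H2 : acomposable psi (phis1 ++ phis2)),
    acomp H1 = acomp H2
}.

(** The horizontal unary cell [eta : (A) => I] is cocartesian.  *)
Definition a_unit (K : avd_data) (A : ob K) (I : hmor K) (eta : cell K) : Prop :=
  [/\ hs eta = [], ht eta = Some I, vs eta = vid A, vt eta = vid A &
   forall (J' J'' : list (hmor K)) (chi : cell K),
     hs chi = J' ++ J'' ->
     chain (@hdom K) (@hcod K) (vdom (vs chi)) J' A ->
     chain (@hdom K) (@hcod K) A J'' (vdom (vt chi)) ->
     exists! chi' : cell K,
       [/\ hs chi' = J' ++ I :: J'', ht chi' = ht chi,
           vs chi' = vs chi, vt chi' = vt chi &
           exists H : acomposable chi'
                        (map (@aidh K) J' ++ eta :: map (@aidh K) J''),
             chi = acomp H]].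

Definition a_has_units (K : avd_data) : Prop :=
  forall A : ob K, exists I eta, a_unit A I eta.

Record avdcu : Type := Avdcu {
  au_data :> avd_data;
  au_ax : is_avdc au_data;
  au_units : a_has_units au_data
}.

Notation vd_graph := (graph hmor).

(** A path of unary cells is given by its vertical source [f] and the list of
    its cells.  The path of length 0 is the vertical morphism [f], so that the
    composite of [psi] with [(f, [])] is [psi o f].  *)
Definition ucomposable (K : vd_graph) (psi : cell K) (f : vmor K)
    (phis : list (cell K)) : Prop :=
  exists g : vmor K,
    [/\ chain (@vs _ K) (@vt _ K) f phis g,
        vcod f = vdom (vs psi),
        vcod g = vdom (vt psi) &
        hs psi = map (@ht _ K) phis].

Record vd_data : Type := VdData {
  vd_gr :> vd_graph;
  ucomp : forall (psi : cell vd_gr) (f : vmor vd_gr) (phis : list (cell vd_gr)),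
    ucomposable psi f phis -> cell vd_gr;
  uidh : hmor vd_gr -> cell vd_gr
}.

(** [upcomp f [psi_1; ..] [Phi_1; ..] [theta_1; ..]]: [theta_i] is the composite
    of [psi_i] with the path [(f_i, Phi_i)], where [f_1 = f] and [f_(i+1)] is
    the vertical target of [(f_i, Phi_i)].  *)
Inductive upcomp (K : vd_data) : vmor K ->
    list (cell K) -> list (list (cell K)) -> list (cell K) -> Prop :=
| upcomp_nil f : upcomp f [] [] []
| upcomp_cons f psi phis (H : ucomposable psi f phis) psis phiss thetas :
    upcomp (last (map (@vt _ K) phis) f) psis phiss thetas ->
    upcomp f (psi :: psis) (phis :: phiss) (ucomp H :: thetas).

Record is_vdc (K : vd_data) : Prop := IsVdc {
  u_hs_chain : forall phi : cell K,
    chain (@hdom K) (@hcod K) (vdom (vs phi)) (hs phi) (vdom (vt phi));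
  u_ht_dom : forall phi : cell K, hdom (ht phi) = vcod (vs phi);
  u_ht_cod : forall phi : cell K, hcod (ht phi) = vcod (vt phi);
  u_hs_comp : forall (psi : cell K) f phis (H : ucomposable psi f phis),
    hs (ucomp H) = flat_map (@hs _ K) phis;
  u_ht_comp : forall (psi : cell K) f phis (H : ucomposable psi f phis),
    ht (ucomp H) = ht psi;
  u_vs_comp : forall (psi : cell K) f phis (H : ucomposable psi f phis)
    (e : vcod f = vdom (vs psi)), vs (ucomp H) = vcomp e;
  u_vt_comp : forall (psi : cell K) f phis (H : ucomposable psi f phis) g,
    chain (@vs _ K) (@vt _ K) f phis g ->
    forall e : vcod g = vdom (vt psi), vt (ucomp H) = vcomp e;
  u_hs_idh : forall J : hmor K, hs (uidh J) = [J];
  u_ht_idh : forall J : hmor K, ht (uidh J) = J;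
  u_vs_idh : forall J : hmor K, vs (uidh J) = vid (hdom J);
  u_vt_idh : forall J : hmor K, vt (uidh J) = vid (hcod J);
  u_assoc : forall (chi : cell K) p psis f phiss thetas,
    upcomp f psis phiss thetas ->
    forall (e : vcod f = vdom p) (H1 : ucomposable chi (vcomp e) thetas)
           (H2 : ucomposable chi p psis)
           (H3 : ucomposable (ucomp H2) f (concat phiss)),
    ucomp H1 = ucomp H3;
  u_idh_l : forall (J : hmor K) f (phi : cell K)
    (H : ucomposable (uidh J) f [phi]), ucomp H = phi;
  u_id_r : forall (phi : cell K) (A : ob K) (Js : list (hmor K))
    (H : ucomposable phi (vid A) (map (@uidh K) Js)), ucomp H = phi
}.

Definition u_unit (K : vd_data) (A : ob K) (eta : cell K) : Prop :=
  [/\ hs eta = [], vs eta = vid A, vt eta = vid A &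
   forall (J' J'' : list (hmor K)) (chi : cell K),
     hs chi = J' ++ J'' ->
     chain (@hdom K) (@hcod K) (vdom (vs chi)) J' A ->
     chain (@hdom K) (@hcod K) A J'' (vdom (vt chi)) ->
     exists! chi' : cell K,
       [/\ hs chi' = J' ++ ht eta :: J'', ht chi' = ht chi,
           vs chi' = vs chi, vt chi' = vt chi &
           exists H : ucomposable chi' (vid (vdom (vs chi)))
                        (map (@uidh K) J' ++ eta :: map (@uidh K) J''),
             chi = ucomp H]].

Definition u_has_units (K : vd_data) : Prop :=
  forall A : ob K, exists eta, u_unit A eta.

Record vdcu : Type := Vdcu {
  vu_data :> vd_data;
  vu_ax : is_vdc vu_data;
  vu_units : u_has_units vu_data
}.

Record gmap (T : base -> Type) (K L : graph T) : Type := Gmap {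
  mo : ob K -> ob L;
  mv : vmor K -> vmor L;
  mh : hmor K -> hmor L;
  mc : cell K -> cell L
}.

Record is_gmap (T : base -> Type) (K L : graph T) (F : gmap K L) : Prop := IsGmap {
  m_vdom : forall f, vdom (mv F f) = mo F (vdom f);
  m_vcod : forall f, vcod (mv F f) = mo F (vcod f);
  m_hdom : forall J, hdom (mh F J) = mo F (hdom J);
  m_hcod : forall J, hcod (mh F J) = mo F (hcod J);
  m_vid : forall A, mv F (vid A) = vid (mo F A);
  m_vcomp : forall g f (e : vcod f = vdom g) (e' : vcod (mv F f) = vdom (mv F g)),
    mv F (vcomp e) = vcomp e';
  m_hs : forall phi, hs (mc F phi) = map (mh F) (hs phi);
  m_vs : forall phi, vs (mc F phi) = mv F (vs phi);
  m_vt : forall phi, vt (mc F phi) = mv F (vt phi)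
}.

(** In the preservation and naturality laws below the composability of the
    other composites follows from the remaining laws; all proofs of it are
    equal.  *)
Record is_afunctor (K L : avd_data) (F : gmap K L) : Prop := IsAfunctor {
  af_g :> is_gmap F;
  af_ht : forall phi, ht (mc F phi) = option_map (mh F) (ht phi);
  af_comp : forall (psi : cell K) phis (H : acomposable psi phis)
    (H' : acomposable (mc F psi) (map (mc F) phis)),
    mc F (acomp H) = acomp H';
  af_idh : forall J, mc F (aidh J) = aidh (mh F J);
  af_idv : forall f, mc F (aidv f) = aidv (mv F f)
}.

Record is_ufunctor (K L : vd_data) (F : gmap K L) : Prop := IsUfunctor {
  uf_g :> is_gmap F;
  uf_ht : forall phi, ht (mc F phi) = mh F (ht phi);
  uf_comp : forall (psi : cell K) f phis (H : ucomposable psi f phis)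
    (H' : ucomposable (mc F psi) (mv F f) (map (mc F) phis)),
    mc F (ucomp H) = ucomp H';
  uf_idh : forall J, mc F (uidh J) = uidh (mh F J)
}.

Definition is_normal (K L : vd_data) (F : gmap K L) : Prop :=
  forall A eta, u_unit A eta -> u_unit (mo F A) (mc F eta).

Record afunctor (K L : avd_data) : Type := Afunctor {
  af_map :> gmap K L;
  af_ax : is_afunctor af_map
}.

Record nfunctor (K L : vd_data) : Type := Nfunctor {
  nf_map :> gmap K L;
  nf_ax : is_ufunctor nf_map;
  nf_normal : is_normal nf_map
}.

Record tmap (T : base -> Type) (K L : graph T) : Type := Tmap {
  xo : ob K -> vmor L;
  xh : hmor K -> cell L
}.

Record is_tmap (T : base -> Type) (K L : graph T) (F G : gmap K L)
    (x : tmap K L) : Prop := IsTmap {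
  x_vdom : forall A, vdom (xo x A) = mo F A;
  x_vcod : forall A, vcod (xo x A) = mo G A;
  x_nat : forall f (e : vcod (xo x (vdom f)) = vdom (mv G f))
    (e' : vcod (mv F f) = vdom (xo x (vcod f))), vcomp e = vcomp e';
  x_hs : forall J, hs (xh x J) = [mh F J];
  x_vs : forall J, vs (xh x J) = xo x (hdom J);
  x_vt : forall J, vt (xh x J) = xo x (hcod J)
}.

(** The components of [x] at the path [Js] starting at [A], and at the
    horizontal target of [phi], where a component [xo x A] is regarded as the
    vertical identity cell on it.  *)
Definition xpath (K : avd_graph) (L : avd_data) (x : tmap K L) (A : ob K)
    (Js : list (hmor K)) : list (cell L) :=
  match Js with
  | [] => [aidv (xo x A)]
  | _ => map (xh x) Js
  end.

Definition xtgt (K : avd_graph) (L : avd_data) (x : tmap K L) (phi : cell K) :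
    cell L :=
  match ht phi with
  | Some J => xh x J
  | None => aidv (xo x (vcod (vs phi)))
  end.

Record is_atransf (K L : avd_data) (F G : gmap K L) (x : tmap K L) : Prop :=
    IsAtransf {
  at_t :> is_tmap F G x;
  at_ht : forall J, ht (xh x J) = Some (mh G J);
  at_cell : forall phi
    (H : acomposable (mc G phi) (xpath x (vdom (vs phi)) (hs phi)))
    (H' : acomposable (xtgt x phi) [mc F phi]), acomp H = acomp H'
}.

Record is_utransf (K L : vd_data) (F G : gmap K L) (x : tmap K L) : Prop :=
    IsUtransf {
  ut_t :> is_tmap F G x;
  ut_ht : forall J, ht (xh x J) = mh G J;
  ut_cell : forall phi
    (H : ucomposable (mc G phi) (xo x (vdom (vs phi))) (map (xh x) (hs phi)))
    (H' : ucomposable (xh x (ht phi)) (vs (mc F phi)) [mc F phi]),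
    ucomp H = ucomp H'
}.

Record atransf (K L : avd_data) (F G : afunctor K L) : Type := Atransf {
  at_map :> tmap K L;
  at_ax : is_atransf F G at_map
}.

Record utransf (K L : vd_data) (F G : nfunctor K L) : Type := Utransf {
  ut_map :> tmap K L;
  ut_ax : is_utransf F G ut_map
}.

(** Equality of 2-cells whose boundaries are only provably equal is stated as
    equality in the total space [{(f, g) & two f g}].  *)
Definition tot (X : Type) (T : X -> X -> Type) (f g : X) (a : T f g) :
    {p : X * X & T (fst p) (snd p)} :=
  existT (fun p : X * X => T (fst p) (snd p)) (f, g) a.
Arguments tot {X T f g} a.

Record strict2cat : Type := Strict2cat {
  obj :> Type;
  hom : obj -> obj -> Type;
  two : forall x y : obj, hom x y -> hom x y -> Type;
  id1 : forall x, hom x x;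
  comp1 : forall x y z, hom y z -> hom x y -> hom x z;
  id2 : forall x y (f : hom x y), two f f;
  vcomp2 : forall x y (f g h : hom x y), two g h -> two f g -> two f h;
  hcomp2 : forall x y z (g g' : hom y z) (f f' : hom x y),
    two g g' -> two f f' -> two (comp1 g f) (comp1 g' f');
  comp1_assoc : forall w x y z (h : hom y z) (g : hom x y) (f : hom w x),
    comp1 h (comp1 g f) = comp1 (comp1 h g) f;
  comp1_idl : forall x y (f : hom x y), comp1 (id1 y) f = f;
  comp1_idr : forall x y (f : hom x y), comp1 f (id1 x) = f;
  vcomp2_assoc : forall x y (f g h k : hom x y)
    (c : two h k) (b : two g h) (a : two f g),
    vcomp2 c (vcomp2 b a) = vcomp2 (vcomp2 c b) a;
  vcomp2_idl : forall x y (f g : hom x y) (a : two f g), vcomp2 (id2 g) a = a;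
  vcomp2_idr : forall x y (f g : hom x y) (a : two f g), vcomp2 a (id2 f) = a;
  hcomp2_id : forall x y z (g : hom y z) (f : hom x y),
    hcomp2 (id2 g) (id2 f) = id2 (comp1 g f);
  interchange : forall x y z (g g' g'' : hom y z) (f f' f'' : hom x y)
    (d : two g' g'') (c : two g g') (b : two f' f'') (a : two f f'),
    hcomp2 (vcomp2 d c) (vcomp2 b a) = vcomp2 (hcomp2 d b) (hcomp2 c a);
  hcomp2_assoc : forall w x y z (h h' : hom y z) (g g' : hom x y)
    (f f' : hom w x) (c : two h h') (b : two g g') (a : two f f'),
    tot (hcomp2 c (hcomp2 b a)) = tot (hcomp2 (hcomp2 c b) a);
  hcomp2_idl : forall x y (f f' : hom x y) (a : two f f'),
    tot (hcomp2 (id2 (id1 y)) a) = tot a;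
  hcomp2_idr : forall x y (f f' : hom x y) (a : two f f'),
    tot (hcomp2 a (id2 (id1 x))) = tot a
}.

Record strict2functor (C D : strict2cat) : Type := Strict2functor {
  f0 :> C -> D;
  f1 : forall x y, hom x y -> hom (f0 x) (f0 y);
  f2 : forall x y (f g : hom x y), two f g -> two (f1 f) (f1 g);
  f1_id : forall x : C, f1 (id1 x) = id1 (f0 x);
  f1_comp : forall (x y z : C) (g : hom y z) (f : hom x y),
    f1 (comp1 g f) = comp1 (f1 g) (f1 f);
  f2_id : forall (x y : C) (f : hom x y), f2 (id2 f) = id2 (f1 f);
  f2_vcomp : forall (x y : C) (f g h : hom x y) (b : two g h) (a : two f g),
    f2 (vcomp2 b a) = vcomp2 (f2 b) (f2 a);
  f2_hcomp : forall (x y z : C) (g g' : hom y z) (f f' : hom x y)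
    (b : two g g') (a : two f f'),
    tot (f2 (hcomp2 b a)) = tot (hcomp2 (f2 b) (f2 a))
}.

Record two_nat_iso (C D : strict2cat) (F G : strict2functor C D) : Type :=
    TwoNatIso {
  ni : forall x : C, hom (F x) (G x);
  ni_inv : forall x : C, hom (G x) (F x);
  ni_invl : forall x, comp1 (ni_inv x) (ni x) = id1 (F x);
  ni_invr : forall x, comp1 (ni x) (ni_inv x) = id1 (G x);
  ni_nat1 : forall (x y : C) (f : hom x y),
    comp1 (f1 G f) (ni x) = comp1 (ni y) (f1 F f);
  ni_nat2 : forall (x y : C) (f g : hom x y) (a : two f g),
    tot (hcomp2 (f2 G a) (id2 (ni x))) = tot (hcomp2 (id2 (ni y)) (f2 F a))
}.

Definition id_2functor (C : strict2cat) : strict2functor C C.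
Proof. by exists (fun x => x) (fun x y f => f) (fun x y f g a => a). Defined.

Lemma tot_f2 (C D : strict2cat) (F : strict2functor C D) (x y : C)
    (f g f' g' : hom x y) (a : two f g) (b : two f' g') :
  tot a = tot b -> tot (f2 F a) = tot (f2 F b).
Proof.
exact: (f_equal (fun p : {p : hom x y * hom x y & two (fst p) (snd p)} =>
  tot (f2 F (projT2 p)))).
Qed.

Definition comp_2functor (C D E : strict2cat) (G : strict2functor D E)
  (F : strict2functor C D) : strict2functor C E.
Proof.
exists (fun x => G (F x)) (fun x y f => f1 G (f1 F f))
  (fun x y f g a => f2 G (f2 F a)).
- by move=> x; rewrite !f1_id.
- by move=> x y z g f; rewrite !f1_comp.
- by move=> x y f; rewrite !f2_id.
- by move=> x y f g h b a; rewrite !f2_vcomp.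
- move=> x y z g g' f f' b a.
  by rewrite (tot_f2 G (f2_hcomp F b a)) f2_hcomp.
Defined.

Definition strict_2equivalence (C D : strict2cat) (U : strict2functor C D)
    (N : strict2functor D C) : Prop :=
  inhabited (two_nat_iso (comp_2functor N U) (id_2functor C)) /\
  inhabited (two_nat_iso (comp_2functor U N) (id_2functor D)).

Lemma gmap_ext (T : base -> Type) (K L : graph T) (F G : gmap K L) :
  mo F = mo G -> mv F = mv G -> mh F = mh G -> mc F = mc G -> F = G.
Proof. by case: F; case: G => /= ? ? ? ? ? ? ? ? -> -> -> ->. Qed.

Lemma tmap_ext (T : base -> Type) (K L : graph T) (x y : tmap K L) :
  (forall A, xo x A = xo y A) -> (forall J, xh x J = xh y J) -> x = y.
Proof.
case: x; case: y => /= ? ? ? ? e1 e2.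
by rewrite (functional_extensionality _ _ e1) (functional_extensionality _ _ e2).
Qed.

Lemma chain_map (A B X Y : Type) (s t : X -> A) (s' t' : Y -> B) (h : X -> Y)
    (k : A -> B) :
  (forall x, s' (h x) = k (s x)) -> (forall x, t' (h x) = k (t x)) ->
  forall p a b, chain s t a p b -> chain s' t' (k a) (map h p) (k b).
Proof.
move=> hs ht; elim=> [|x p IH] a b /=; first by move=> ->.
by case=> <- /IH; rewrite hs ht.
Qed.

(** The composition operations, extended to arbitrary arguments by junk values;
    they are only used in proofs.  *)
Definition vT (B : base) (g f : vmor B) : vmor B :=
  match excluded_middle_informative (vcod f = vdom g) with
  | left e => vcomp e
  | right _ => g
  end.

Definition aT (K : avd_data) (psi : cell K) (phis : list (cell K)) : cell K :=
  match excluded_middle_informative (acomposable psi phis) with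
  | left H => acomp H
  | right _ => psi
  end.

Definition uT (K : vd_data) (psi : cell K) (f : vmor K) (phis : list (cell K)) :
    cell K :=
  match excluded_middle_informative (ucomposable psi f phis) with
  | left H => ucomp H
  | right _ => psi
  end.

Lemma vTE (B : base) (g f : vmor B) (e : vcod f = vdom g) : vcomp e = vT g f.
Proof.
rewrite /vT; case: excluded_middle_informative => [e'|//].
by rewrite (proof_irrelevance _ e e').
Qed.

Lemma aTE (K : avd_data) (psi : cell K) phis (H : acomposable psi phis) :
  acomp H = aT psi phis.
Proof.
rewrite /aT; case: excluded_middle_informative => [H'|//].
by rewrite (proof_irrelevance _ H H').
Qed.

Lemma uTE (K : vd_data) (psi : cell K) f phis (H : ucomposable psi f phis) :
  ucomp H = uT psi f phis.
Proof.
rewrite /uT; case: excluded_middle_informative => [H'|//].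
by rewrite (proof_irrelevance _ H H').
Qed.

Section Vertical.
Variable B : base.
Implicit Types f g h : vmor B.

Lemma vT_dom g f : vcod f = vdom g -> vdom (vT g f) = vdom f.
Proof. by move=> e; rewrite -(vTE e) vdom_comp. Qed.

Lemma vT_cod g f : vcod f = vdom g -> vcod (vT g f) = vcod g.
Proof. by move=> e; rewrite -(vTE e) vcod_comp. Qed.

Lemma vT_idl A f : vcod f = A -> vT (vid A) f = f.
Proof.
move=> e; have e' : vcod f = vdom (vid A) by rewrite vdom_id.
by rewrite -(vTE e') vcomp_idl.
Qed.

Lemma vT_idr A f : vdom f = A -> vT f (vid A) = f.
Proof.
move=> e; have e' : vcod (vid A) = vdom f by rewrite vcod_id.
by rewrite -(vTE e') vcomp_idr.
Qed.

Lemma vTA h g f : vcod f = vdom g -> vcod g = vdom h ->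
  vT h (vT g f) = vT (vT h g) f.
Proof.
move=> e1 e3.
have e2 : vcod (vcomp e1) = vdom h by rewrite vcod_comp.
have e4 : vcod f = vdom (vcomp e3) by rewrite vdom_comp.
by rewrite -(vTE e1) -(vTE e3) -(vTE e2) -(vTE e4); apply: vcomp_assoc.
Qed.
End Vertical.

Lemma m_vT (T : base -> Type) (K L : graph T) (F : gmap K L) (HF : is_gmap F)
    (g f : vmor K) :
  vcod f = vdom g -> mv F (vT g f) = vT (mv F g) (mv F f).
Proof.
move=> e; have e' : vcod (mv F f) = vdom (mv F g).
  by rewrite (m_vcod HF) (m_vdom HF) e.
by rewrite -(vTE e) -(vTE e') (m_vcomp HF e e').
Qed.

Lemma x_vT (T : base -> Type) (K L : graph T) (F G : gmap K L)
    (HF : is_gmap F) (HG : is_gmap G) (x : tmap K L) (Hx : is_tmap F G x)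
    (f : vmor K) :
  vT (mv G f) (xo x (vdom f)) = vT (xo x (vcod f)) (mv F f).
Proof.
have e : vcod (xo x (vdom f)) = vdom (mv G f).
  by rewrite (x_vcod Hx) (m_vdom HG).
have e' : vcod (mv F f) = vdom (xo x (vcod f)).
  by rewrite (x_vdom Hx) (m_vcod HF).
by rewrite -(vTE e) -(vTE e'); apply: (x_nat Hx).
Qed.

Section AvdcLaws.
Variables (K : avd_data) (HK : is_avdc K).
Implicit Types (phi psi chi : cell K) (phis psis : list (cell K)).

Lemma aT_hs psi phis : acomposable psi phis ->
  hs (aT psi phis) = flat_map (@hs _ K) phis.
Proof. by move=> H; rewrite -(aTE H) (a_hs_comp HK). Qed.

Lemma aT_ht psi phis : acomposable psi phis -> ht (aT psi phis) = ht psi.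
Proof. by move=> H; rewrite -(aTE H) (a_ht_comp HK). Qed.

Lemma chain_fun (A X : Type) (s t : X -> A) p a b b' :
  chain s t a p b -> chain s t a p b' -> b = b'.
Proof.
elim: p a => [|x p IH] a /=; first by move=> -> ->.
by case=> _ H [_ /(IH _ H)].
Qed.

Lemma chain_funl (A X : Type) (s t : X -> A) p a a' b b' : p <> [] ->
  chain s t a p b -> chain s t a' p b' -> a = a' /\ b = b'.
Proof.
case: p => [//|x p] _ /= [<- H] [<- H']; split=> //.
exact: chain_fun H H'.
Qed.

Lemma chain_cat (A X : Type) (s t : X -> A) p q a b c :
  chain s t a p b -> chain s t b q c -> chain s t a (p ++ q) c.
Proof.
elim: p a => [|x p IH] a /=; first by move=> ->.
by case=> -> H1 H2; split=> //; apply: IH.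
Qed.

Lemma chain_split (A X : Type) (s t : X -> A) p q a c :
  chain s t a (p ++ q) c -> exists b, chain s t a p b /\ chain s t b q c.
Proof.
elim: p a => [|x p IH] a /=; first by exists a.
by case=> -> /IH [b [H1 H2]]; exists b.
Qed.

Lemma acomp_ends psi phis f g : acomposable psi phis ->
  chain (@vs _ K) (@vt _ K) f phis g ->
  vcod f = vdom (vs psi) /\ vcod g = vdom (vt psi).
Proof.
case=> nz [f' [g' [c e1 e2 _]]] c'.
by case: (chain_funl nz c c') => <- <-.
Qed.

Lemma aT_vs psi phis f g : acomposable psi phis ->
  chain (@vs _ K) (@vt _ K) f phis g -> vs (aT psi phis) = vT (vs psi) f.
Proof.
move=> H c; case: (acomp_ends H c) => e _.
by rewrite -(aTE H) (a_vs_comp HK H c e) vTE.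
Qed.

Lemma aT_vt psi phis f g : acomposable psi phis ->
  chain (@vs _ K) (@vt _ K) f phis g -> vt (aT psi phis) = vT (vt psi) g.
Proof.
move=> H c; case: (acomp_ends H c) => _ e.
by rewrite -(aTE H) (a_vt_comp HK H c e) vTE.
Qed.

Lemma acomposable1 psi phi :
  vcod (vs phi) = vdom (vs psi) -> vcod (vt phi) = vdom (vt psi) ->
  hs psi = olist (ht phi) -> acomposable psi [phi].
Proof.
move=> e1 e2 e3; split=> //; exists (vs phi), (vt phi); split=> //.
by rewrite /= app_nil_r.
Qed.

Lemma acomposable1P psi phi : acomposable psi [phi] ->
  [/\ vcod (vs phi) = vdom (vs psi), vcod (vt phi) = vdom (vt psi) &
   hs psi = olist (ht phi)].
Proof.
case=> _ [f [g [/= [<- <-] e1 e2 e3]]]; split=> //.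
by rewrite e3 app_nil_r.
Qed.

Lemma aT1_vs psi phi : acomposable psi [phi] ->
  vs (aT psi [phi]) = vT (vs psi) (vs phi).
Proof. by move=> H; apply: aT_vs H _; split. Qed.

Lemma aT1_vt psi phi : acomposable psi [phi] ->
  vt (aT psi [phi]) = vT (vt psi) (vt phi).
Proof. by move=> H; apply: (aT_vt (f := vs phi)) H _; split. Qed.

Lemma aT1_hs psi phi : acomposable psi [phi] -> hs (aT psi [phi]) = hs phi.
Proof. by move=> H; rewrite aT_hs //= app_nil_r. Qed.

(** Associativity: composability of both sides is a consequence of that of
    the composites with [psis] and of the path [concat phiss].  *)
Lemma aTA chi psis phiss thetas f g :
  apcomp psis phiss thetas -> acomposable chi psis ->
  chain (@vs _ K) (@vt _ K) f (concat phiss) g ->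
  [/\ acomposable chi thetas, acomposable (aT chi psis) (concat phiss) &
      aT chi thetas = aT (aT chi psis) (concat phiss)].
Proof.
move=> P H2 c; case: (H2) => nz [p [q [cp e1 e2 e3]]].
have [nzt [nzc [ef [eg [ct [et eh]]]]]] :
  thetas <> [] /\ concat phiss <> [] /\ vcod f = vdom p /\ vcod g = vdom q /\
  chain (@vs _ K) (@vt _ K) (vT p f) thetas (vT q g) /\
  flat_map (fun phi => olist (ht phi)) thetas =
    flat_map (fun phi => olist (ht phi)) psis /\
  flat_map (@hs _ K) psis =
    flat_map (fun phi => olist (ht phi)) (concat phiss).
  move: (nz) c cp; clear -P HK; move: f p; elim: P => [//|psi phis H psis' phiss' thetas' P IH] f p _ /=.
  move=> c [<-] cp; case: (chain_split c) => m [c1 c2].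
  case: (acomp_ends H c1) => a1 a2.
  have eH : acomp H = aT psi phis by rewrite aTE.
  have nzp : phis <> [] by case: H {eH}.
  have hsH : hs psi = flat_map (fun phi => olist (ht phi)) phis.
    by case: H {eH} => _ [? [? []]].
  rewrite eH aT_ht // (aT_vs H c1) (aT_vt H c1) flat_map_app.
  case: psis' P IH cp => [|psi2 psis'] P IH cp.
    inversion P; subst; move: c2 cp => /= c2 cp; subst m q.
    split=> //; split; first by move=> /app_eq_nil [/nzp].
    by rewrite !app_nil_r.
  have nz2 : psi2 :: psis' <> [] by [].
  case: (IH _ _ nz2 c2 cp) => z1 [z2 [z3 [z4 [z5 [z6 z7]]]]].
  split=> //; split; first by move=> /app_eq_nil [/nzp].
  split=> //; split=> //; split; first by [].
  by rewrite z6 hsH -z7.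
have H1 : acomposable chi thetas.
  split=> //; exists (vT p f), (vT q g); split=> //.
  - by rewrite vT_cod.
  - by rewrite vT_cod.
  - by rewrite et.
have H3 : acomposable (aT chi psis) (concat phiss).
  split=> //; exists f, g; split=> //.
  - by rewrite (aT_vs H2 cp) vT_dom.
  - by rewrite (aT_vt H2 cp) vT_dom.
  - by rewrite aT_hs.
split=> //.
move: H3; rewrite -(aTE H2) => H3.
by rewrite -(aTE H1) -(aTE H3); apply: (a_assoc HK).
Qed.

Lemma aTA1 chi psi phis : acomposable chi [psi] -> acomposable psi phis ->
  [/\ acomposable chi [aT psi phis], acomposable (aT chi [psi]) phis &
      aT chi [aT psi phis] = aT (aT chi [psi]) phis].
Proof.
move=> H1 H2; case: (H2) => _ [f [g [c _ _ _]]].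
have P : apcomp [psi] [phis] [aT psi phis].
  by rewrite -(aTE H2); do 2 constructor.
have c' : chain (@vs _ K) (@vt _ K) f (concat [phis]) g by rewrite /= app_nil_r.
by case: (aTA P H1 c'); rewrite /= app_nil_r.
Qed.

Lemma aT_idl_tgt phi :
  match ht phi with
  | Some J => acomposable (aidh J) [phi] /\ aT (aidh J) [phi] = phi
  | None => acomposable (aidv (vid (vcod (vs phi)))) [phi] /\
            aT (aidv (vid (vcod (vs phi)))) [phi] = phi
  end.
Proof.
have := a_ht_chain HK phi; case E: (ht phi) => [J|] /=.
  case=> e1 e2; have H : acomposable (aidh J) [phi].
    apply: acomposable1; rewrite ?(a_vs_idh HK) ?(a_vt_idh HK) ?vdom_id //.
    by rewrite E (a_hs_idh HK).
  by split=> //; rewrite -(aTE H) (a_idh_l HK).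
move=> e; have H : acomposable (aidv (vid (vcod (vs phi)))) [phi].
  apply: acomposable1; rewrite ?(a_vs_idv HK) ?(a_vt_idv HK) ?vdom_id //.
  by rewrite E (a_hs_idv HK).
by split=> //; rewrite -(aTE H) (a_idv_l HK).
Qed.

Lemma aT_idv (g f : vmor K) : vcod f = vdom g ->
  acomposable (aidv g) [aidv f] /\ aT (aidv g) [aidv f] = aidv (vT g f).
Proof.
move=> e; have H : acomposable (aidv g) [aidv f].
  apply: acomposable1; rewrite ?(a_vs_idv HK) ?(a_vt_idv HK) //.
  by rewrite (a_hs_idv HK) (a_ht_idv HK).
by split=> //; rewrite -(aTE H) (a_idv_comp HK e) vTE.
Qed.

Lemma chain_idh (Js : list (hmor K)) A B : chain (@hdom K) (@hcod K) A Js B ->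
  chain (@vs _ K) (@vt _ K) (vid A) (map (@aidh K) Js) (vid B).
Proof.
apply: chain_map => J; first by rewrite (a_vs_idh HK).
by rewrite (a_vt_idh HK).
Qed.

Lemma flat_idh (Js : list (hmor K)) :
  flat_map (fun phi : cell K => olist (ht phi)) (map (@aidh K) Js) = Js.
Proof. by elim: Js => [//|J Js IH] /=; rewrite (a_ht_idh HK) /= IH. Qed.

Lemma flat_hs_idh (Js : list (hmor K)) : flat_map (@hs _ K) (map (@aidh K) Js) = Js.
Proof. by elim: Js => [//|J Js IH] /=; rewrite (a_hs_idh HK) /= IH. Qed.
End AvdcLaws.

Section AfunctorLaws.
Variables (K L : avd_data) (F : gmap K L) (HF : is_afunctor F).

Lemma af_chain f phis g : chain (@vs _ K) (@vt _ K) f phis g ->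
  chain (@vs _ L) (@vt _ L) (mv F f) (map (mc F) phis) (mv F g).
Proof. by apply: chain_map => x; [apply: (m_vs HF)|apply: (m_vt HF)]. Qed.

Lemma af_composable (psi : cell K) phis : acomposable psi phis ->
  acomposable (mc F psi) (map (mc F) phis).
Proof.
case=> nz [f [g [c e1 e2 e3]]]; split; first by case: (phis) nz.
exists (mv F f), (mv F g); split.
- exact: af_chain.
- by rewrite (m_vcod HF) (m_vs HF) (m_vdom HF) e1.
- by rewrite (m_vcod HF) (m_vt HF) (m_vdom HF) e2.
rewrite (m_hs HF) e3; elim: (phis) => [//|phi l IH] /=.
by rewrite map_app IH (af_ht HF); case: (ht phi).
Qed.

Lemma af_aT (psi : cell K) phis : acomposable psi phis ->
  mc F (aT psi phis) = aT (mc F psi) (map (mc F) phis).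
Proof.
move=> H; have H' := af_composable H.
by rewrite -(aTE H) -(aTE H') (af_comp HF H H').
Qed.
End AfunctorLaws.

Section AtransfLaws.
Variables (K L : avd_data) (HK : is_avdc K) (HL : is_avdc L).
Variables (F G : gmap K L) (HF : is_afunctor F) (HG : is_afunctor G).
Variables (x : tmap K L) (Hx : is_atransf F G x).

Lemma xpath_chain A Js B : chain (@hdom K) (@hcod K) A Js B ->
  chain (@vs _ L) (@vt _ L) (xo x A) (xpath x A Js) (xo x B).
Proof.
case: Js => [|J Js]; first by move=> /= ->; rewrite (a_vs_idv HL) (a_vt_idv HL).
by apply: chain_map => x0; [apply: (x_vs Hx)|apply: (x_vt Hx)].
Qed.

Lemma xpath_tgt A Js :
  flat_map (fun phi => olist (ht phi)) (xpath x A Js) = map (mh G) Js.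
Proof.
case: Js => [|J Js] /=; first by rewrite (a_ht_idv HL).
rewrite (at_ht Hx) /=; congr cons.
by elim: Js => [//|J' Js IH] /=; rewrite (at_ht Hx) /= IH.
Qed.

Lemma xl_composable phi :
  acomposable (mc G phi) (xpath x (vdom (vs phi)) (hs phi)).
Proof.
split; first by case: (hs phi).
exists (xo x (vdom (vs phi))), (xo x (vdom (vt phi))); split.
- exact: xpath_chain (a_hs_chain HK phi).
- by rewrite (x_vcod Hx) (m_vs HG) (m_vdom HG).
- by rewrite (x_vcod Hx) (m_vt HG) (m_vdom HG).
- by rewrite xpath_tgt (m_hs HG).
Qed.

Lemma xtgt_vs phi : vs (xtgt x phi) = xo x (vcod (vs phi)).
Proof.
rewrite /xtgt; have := a_ht_chain HK phi; case: (ht phi) => [J|] /= e.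
  by case: e => <- _; rewrite (x_vs Hx).
by rewrite (a_vs_idv HL).
Qed.

Lemma xtgt_vt phi : vt (xtgt x phi) = xo x (vcod (vt phi)).
Proof.
rewrite /xtgt; have := a_ht_chain HK phi; case: (ht phi) => [J|] /= e.
  by case: e => _ <-; rewrite (x_vt Hx).
by rewrite (a_vt_idv HL) e.
Qed.

Lemma xtgt_hs phi : hs (xtgt x phi) = olist (option_map (mh F) (ht phi)).
Proof.
rewrite /xtgt; case: (ht phi) => [J|] /=; first by rewrite (x_hs Hx).
by rewrite (a_hs_idv HL).
Qed.

Lemma xtgt_ht phi : ht (xtgt x phi) = option_map (mh G) (ht phi).
Proof.
rewrite /xtgt; case: (ht phi) => [J|] /=; first by rewrite (at_ht Hx).
by rewrite (a_ht_idv HL).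
Qed.

Lemma xr_composable phi : acomposable (xtgt x phi) [mc F phi].
Proof.
apply: acomposable1.
- by rewrite xtgt_vs (x_vdom Hx) (m_vs HF) (m_vcod HF).
- by rewrite xtgt_vt (x_vdom Hx) (m_vt HF) (m_vcod HF).
- by rewrite xtgt_hs (af_ht HF).
Qed.

Lemma at_aT phi :
  aT (mc G phi) (xpath x (vdom (vs phi)) (hs phi)) = aT (xtgt x phi) [mc F phi].
Proof.
rewrite -(aTE (xl_composable phi)) -(aTE (xr_composable phi)).
exact: (at_cell Hx).
Qed.
End AtransfLaws.

Section Avd2cat.

Definition aid_map (K : avd_data) : gmap K K :=
  Gmap (fun A => A) (fun f => f) (fun J => J) (fun phi => phi).

Lemma aid_ax (K : avd_data) : is_afunctor (aid_map K).
Proof.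
split=> //=; first split=> //=.
- by move=> g f e e'; rewrite (proof_irrelevance _ e e').
- by move=> phi; rewrite map_id.
- by move=> phi; case: (ht phi).
- by move=> psi phis H; rewrite map_id => H'; rewrite (proof_irrelevance _ H H').
Qed.

Definition aid (K : avd_data) : afunctor K K := Afunctor (aid_ax K).

Definition gcomp (T : base -> Type) (K L M : graph T) (G : gmap L M) (F : gmap K L) :
    gmap K M :=
  Gmap (fun A => mo G (mo F A)) (fun f => mv G (mv F f))
       (fun J => mh G (mh F J)) (fun phi => mc G (mc F phi)).

Lemma gcomp_ax (T : base -> Type) (K L M : graph T) (G : gmap L M) (F : gmap K L) :
  is_gmap G -> is_gmap F -> is_gmap (gcomp G F).
Proof.
move=> HG HF; split=> /=.
- by move=> f; rewrite (m_vdom HG) (m_vdom HF).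
- by move=> f; rewrite (m_vcod HG) (m_vcod HF).
- by move=> J; rewrite (m_hdom HG) (m_hdom HF).
- by move=> J; rewrite (m_hcod HG) (m_hcod HF).
- by move=> A; rewrite (m_vid HF) (m_vid HG).
- move=> g f e e'; rewrite !vTE (m_vT HF) // (m_vT HG) //.
  by rewrite (m_vcod HF) (m_vdom HF) e.
- by move=> phi; rewrite (m_hs HG) (m_hs HF) map_map.
- by move=> phi; rewrite (m_vs HG) (m_vs HF).
- by move=> phi; rewrite (m_vt HG) (m_vt HF).
Qed.

Lemma acomp_ax (K L M : avd_data) (G : gmap L M) (F : gmap K L) :
  is_afunctor G -> is_afunctor F -> is_afunctor (gcomp G F).
Proof.
move=> HG HF; split=> /=; first exact: (gcomp_ax HG HF).
- by move=> phi; rewrite (af_ht HG) (af_ht HF); case: (ht phi).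
- move=> psi phis H H'.
  by rewrite !aTE (af_aT HF H) (af_aT HG (af_composable HF H)) map_map.
- by move=> J; rewrite (af_idh HF) (af_idh HG).
- by move=> f; rewrite (af_idv HF) (af_idv HG).
Qed.

Definition afcomp (K L M : avd_data) (G : afunctor L M) (F : afunctor K L) :
    afunctor K M :=
  Afunctor (acomp_ax (af_ax G) (af_ax F)).

Lemma afunctor_ext (K L : avd_data) (F G : afunctor K L) :
  af_map F = af_map G -> F = G.
Proof.
case: F => F HF; case: G => G HG /= e; move: HF; rewrite e => HF.
by rewrite (proof_irrelevance _ HF HG).
Qed.

Lemma atransf_ext (K L : avd_data) (F G : afunctor K L) (x y : atransf F G) :
  at_map x = at_map y -> x = y.
Proof.
case: x => x Hx; case: y => y Hy /= e; move: Hx; rewrite e => Hx.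
by rewrite (proof_irrelevance _ Hx Hy).
Qed.

Lemma atransf_tot (K L : avd_data) (F G F' G' : afunctor K L)
    (x : atransf F G) (y : atransf F' G') :
  F = F' -> G = G' -> at_map x = at_map y ->
  @tot (afunctor K L) (@atransf K L) F G x = @tot (afunctor K L) (@atransf K L) F' G' y.
Proof.
by move=> eF eG; subst F' G' => /atransf_ext ->.
Qed.

Definition xid (K L : avd_data) (F : gmap K L) : tmap K L :=
  Tmap (fun A => vid (mo F A)) (fun J => aidh (mh F J)).

Lemma xid_ax (K L : avd_data) (HK : is_avdc K) (HL : is_avdc L) (F : gmap K L) :
  is_afunctor F -> is_atransf F F (xid F).
Proof.
move=> HF; split=> /=; first split=> /=.
- by move=> A; rewrite vdom_id.
- by move=> A; rewrite vcod_id.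
- move=> f e e'; rewrite !vTE vT_idl ?vT_idr //.
  + by rewrite (m_vcod HF).
  + by rewrite (m_vdom HF).
- by move=> J; rewrite (a_hs_idh HL).
- by move=> J; rewrite (a_vs_idh HL) (m_hdom HF).
- by move=> J; rewrite (a_vt_idh HL) (m_hcod HF).
- by move=> J; rewrite (a_ht_idh HL).
move=> phi H H'; transitivity (mc F phi).
- case E: (hs phi) (H) => [|J Js] {}H; first exact: (a_idv_r HL).
  have e : xpath (xid F) (vdom (vs phi)) (J :: Js)
         = map (@aidh L) (map (mh F) (J :: Js)) by rewrite map_map.
  by move: H; rewrite e => H; apply: (a_idh_r HL).
- have := a_ht_chain HK phi; move: H'; rewrite /xtgt.
  case: (ht phi) => [J|] H' _ /=; first by rewrite (a_idh_l HL).
  by rewrite (a_idv_l HL).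
Qed.

Section AVcomp.
Variables (K L : avd_data) (HK : is_avdc K) (HL : is_avdc L).
Variables (F G M : gmap K L).
Hypotheses (HF : is_afunctor F) (HG : is_afunctor G) (HM : is_afunctor M).
Variables (y x : tmap K L) (Hy : is_atransf G M y) (Hx : is_atransf F G x).

Lemma xv_o A : vcod (xo x A) = vdom (xo y A).
Proof. by rewrite (x_vcod Hx) (x_vdom Hy). Qed.

Lemma xv_h J : acomposable (xh y J) [xh x J].
Proof.
apply: acomposable1.
- by rewrite (x_vs Hx) (x_vs Hy) xv_o.
- by rewrite (x_vt Hx) (x_vt Hy) xv_o.
- by rewrite (x_hs Hy) (at_ht Hx).
Qed.

Definition xvcomp : tmap K L := Tmap (fun A => vcomp (xv_o A)) (fun J => acomp (xv_h J)).

Lemma xvcomp_o A : xo xvcomp A = vT (xo y A) (xo x A).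
Proof. by rewrite /= vTE. Qed.

Lemma xvcomp_h J : xh xvcomp J = aT (xh y J) [xh x J].
Proof. by rewrite /= aTE. Qed.

Lemma xvcomp_tmap : is_tmap F M xvcomp.
Proof.
split.
- by move=> A; rewrite xvcomp_o vT_dom ?xv_o // (x_vdom Hx).
- by move=> A; rewrite xvcomp_o vT_cod ?xv_o // (x_vcod Hy).
- move=> f e e'; rewrite !vTE !xvcomp_o.
  have a1 := xv_o (vdom f); have a2 := xv_o (vcod f).
  have b1 : vcod (xo y (vdom f)) = vdom (mv M f).
    by rewrite (x_vcod Hy) (m_vdom HM).
  have b2 : vcod (mv F f) = vdom (xo x (vcod f)).
    by rewrite (x_vdom Hx) (m_vcod HF).
  have b3 : vcod (xo x (vdom f)) = vdom (mv G f).
    by rewrite (x_vcod Hx) (m_vdom HG).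
  have b4 : vcod (mv G f) = vdom (xo y (vcod f)).
    by rewrite (x_vdom Hy) (m_vcod HG).
  rewrite vTA // (x_vT HG HM Hy) -vTA // (x_vT HF HG Hx).
  by rewrite vTA.
- by move=> J; rewrite xvcomp_h aT1_hs ?(x_hs Hx) //; apply: xv_h.
- move=> J; rewrite xvcomp_h aT1_vs ?xvcomp_o ?(x_vs Hx) ?(x_vs Hy) //.
  exact: xv_h.
- move=> J; rewrite xvcomp_h aT1_vt ?xvcomp_o ?(x_vt Hx) ?(x_vt Hy) //.
  exact: xv_h.
Qed.

Lemma xvcomp_path A Js :
  apcomp (xpath y A Js) (map (fun phi => [phi]) (xpath x A Js))
         (xpath xvcomp A Js).
Proof.
case: Js => [|J Js] /=.
  case: (aT_idv HL (xv_o A)) => H e.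
  by rewrite vTE -e -(aTE H); do 2 constructor.
constructor; elim: Js => [|J' Js IH] /=; first by constructor.
by constructor.
Qed.

Lemma xvcomp_tgt phi :
  acomposable (xtgt y phi) [xtgt x phi] /\
  xtgt xvcomp phi = aT (xtgt y phi) [xtgt x phi].
Proof.
rewrite /xtgt; case: (ht phi) => [J|].
  by rewrite xvcomp_h; split=> //; apply: xv_h.
by rewrite xvcomp_o; case: (aT_idv HL (xv_o (vcod (vs phi)))).
Qed.

Lemma concat_single (X : Type) (l : list X) : concat (map (fun a => [a]) l) = l.
Proof. by elim: l => [//|a l IH] /=; rewrite IH. Qed.

Lemma xvcomp_ax : is_atransf F M xvcomp.
Proof.
split; first exact: xvcomp_tmap.
- by move=> J; rewrite xvcomp_h aT_ht ?(at_ht Hy) //; apply: xv_h.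
move=> phi H H'; rewrite !aTE.
have cx := xpath_chain HL Hx (a_hs_chain HK phi).
rewrite -(concat_single (xpath x _ _)) in cx.
case: (aTA HL (xvcomp_path _ _) (xl_composable HK HL HM Hy phi) cx).
rewrite concat_single => _ h1 ->.
rewrite (at_aT HK HL HG HM Hy phi).
case: (aTA1 HL (xr_composable HK HL HG Hy phi) (xl_composable HK HL HG Hx phi)).
move=> _ _ <-; rewrite (at_aT HK HL HF HG Hx phi).
case: (xvcomp_tgt phi) => h2 ->.
by case: (aTA1 HL h2 (xr_composable HK HL HF Hx phi)).
Qed.
End AVcomp.

Definition xwr (T : base -> Type) (K L M : graph T) (z : tmap L M) (F : gmap K L) :
    tmap K M :=
  Tmap (fun A => xo z (mo F A)) (fun J => xh z (mh F J)).

Definition xwl (T : base -> Type) (K L M : graph T) (G : gmap L M) (x : tmap K L) :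
    tmap K M :=
  Tmap (fun A => mv G (xo x A)) (fun J => mc G (xh x J)).

Lemma xwr_tmap (T : base -> Type) (K L M : graph T) (G G' : gmap L M)
    (z : tmap L M) (F : gmap K L) :
  is_gmap F -> is_tmap G G' z -> is_tmap (gcomp G F) (gcomp G' F) (xwr z F).
Proof.
move=> HF Hz; split=> /=.
- by move=> A; rewrite (x_vdom Hz).
- by move=> A; rewrite (x_vcod Hz).
- move=> f; rewrite -(m_vdom HF) -(m_vcod HF) => e e'; exact: (x_nat Hz).
- by move=> J; rewrite (x_hs Hz).
- by move=> J; rewrite (x_vs Hz) (m_hdom HF).
- by move=> J; rewrite (x_vt Hz) (m_hcod HF).
Qed.

Lemma xwl_tmap (T : base -> Type) (K L M : graph T) (G : gmap L M)
    (F F' : gmap K L) (x : tmap K L) :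
  is_gmap G -> is_gmap F -> is_gmap F' -> is_tmap F F' x ->
  is_tmap (gcomp G F) (gcomp G F') (xwl G x).
Proof.
move=> HG HF HF' Hx; split=> /=.
- by move=> A; rewrite (m_vdom HG) (x_vdom Hx).
- by move=> A; rewrite (m_vcod HG) (x_vcod Hx).
- move=> f e e'; rewrite !vTE -!(m_vT HG) ?(x_vT HF HF' Hx) //.
  + by rewrite (x_vcod Hx) (m_vdom HF').
  + by rewrite (x_vdom Hx) (m_vcod HF).
- by move=> J; rewrite (m_hs HG) (x_hs Hx).
- by move=> J; rewrite (m_vs HG) (x_vs Hx).
- by move=> J; rewrite (m_vt HG) (x_vt Hx).
Qed.

Lemma xwr_ax (K L M : avd_data) (G G' : gmap L M) (z : tmap L M) (F : gmap K L) :
  is_afunctor F -> is_atransf G G' z ->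
  is_atransf (gcomp G F) (gcomp G' F) (xwr z F).
Proof.
move=> HF Hz; split; first exact: (xwr_tmap HF Hz).
  by move=> J /=; rewrite (at_ht Hz).
move=> phi.
have -> : xpath (xwr z F) (vdom (vs phi)) (hs phi)
        = xpath z (vdom (vs (mc F phi))) (hs (mc F phi)).
  rewrite (m_vs HF) (m_vdom HF) (m_hs HF).
  by case: (hs phi) => [//|J Js] /=; rewrite map_map.
have -> : xtgt (xwr z F) phi = xtgt z (mc F phi).
  by rewrite /xtgt (af_ht HF) (m_vs HF) (m_vcod HF); case: (ht phi).
exact: (at_cell Hz).
Qed.

Lemma xwl_ax (K L M : avd_data) (HK : is_avdc K) (HL : is_avdc L)
    (G : gmap L M) (F F' : gmap K L) (x : tmap K L) :
  is_afunctor G -> is_afunctor F -> is_afunctor F' -> is_atransf F F' x ->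
  is_atransf (gcomp G F) (gcomp G F') (xwl G x).
Proof.
move=> HG HF HF' Hx; split; first exact: (xwl_tmap HG HF HF' Hx).
  by move=> J /=; rewrite (af_ht HG) (at_ht Hx).
move=> phi H H'; rewrite !aTE.
have -> : xpath (xwl G x) (vdom (vs phi)) (hs phi)
        = map (mc G) (xpath x (vdom (vs phi)) (hs phi)).
  by case: (hs phi) => [|J Js] /=; rewrite ?(af_idv HG) ?map_map.
have -> : xtgt (xwl G x) phi = mc G (xtgt x phi).
  by rewrite /xtgt; case: (ht phi) => [//|] /=; rewrite (af_idv HG).
rewrite -(af_aT HG (xl_composable HK HL HF' Hx phi)) (at_aT HK HL HF HF' Hx).
by rewrite (af_aT HG (xr_composable HK HL HF Hx phi)).
Qed.
End Avd2cat.

Section Avd2catLaws.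
Implicit Types K L M : avdcu.

Definition atid K L (F : afunctor K L) : atransf F F :=
  Atransf (xid_ax (au_ax K) (au_ax L) (af_ax F)).

Definition atcomp K L (F G H : afunctor K L) (y : atransf G H) (x : atransf F G) :
    atransf F H :=
  Atransf (xvcomp_ax (au_ax K) (au_ax L) (af_ax F) (af_ax G) (af_ax H)
             (at_ax y) (at_ax x)).

Definition athcomp K L M (G G' : afunctor L M) (F F' : afunctor K L)
    (z : atransf G G') (x : atransf F F') :
    atransf (afcomp G F) (afcomp G' F') :=
  @atcomp K M (afcomp G F) (afcomp G' F) (afcomp G' F')
    (@Atransf _ _ (afcomp G' F) (afcomp G' F') _
       (xwl_ax (au_ax K) (au_ax L) (af_ax G') (af_ax F) (af_ax F') (at_ax x)))
    (@Atransf _ _ (afcomp G F) (afcomp G' F) _ (xwr_ax (af_ax F) (at_ax z))).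

Lemma atcomp_o K L (F G H : afunctor K L) (y : atransf G H) (x : atransf F G) A :
  xo (atcomp y x) A = vT (xo y A) (xo x A).
Proof. by rewrite /= vTE. Qed.

Lemma atcomp_h K L (F G H : afunctor K L) (y : atransf G H) (x : atransf F G) J :
  xh (atcomp y x) J = aT (xh y J) [xh x J].
Proof. by rewrite /= aTE. Qed.

Lemma atcomp_oc K L (F G H : afunctor K L) (y : atransf G H) (x : atransf F G) A :
  vcod (xo x A) = vdom (xo y A).
Proof. exact: (xv_o (at_ax y) (at_ax x)). Qed.

Lemma atcomp_hc K L (F G H : afunctor K L) (y : atransf G H) (x : atransf F G) J :
  acomposable (xh y J) [xh x J].
Proof. exact: (xv_h (at_ax y) (at_ax x)). Qed.

Section Hcomp.
Variables (K L M : avdcu) (G G' : afunctor L M) (F F' : afunctor K L).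
Variables (z : atransf G G') (x : atransf F F').

Lemma athcomp_o A :
  xo (athcomp z x) A = vT (mv G' (xo x A)) (xo z (mo F A)).
Proof. by rewrite /athcomp atcomp_o. Qed.

Lemma athcomp_h J :
  xh (athcomp z x) J = aT (mc G' (xh x J)) [xh z (mh F J)].
Proof. by rewrite /athcomp atcomp_h. Qed.

Lemma athcomp_oc A : vcod (xo z (mo F A)) = vdom (mv G' (xo x A)).
Proof.
by rewrite (x_vcod (at_ax z)) (m_vdom (af_ax G')) (x_vdom (at_ax x)).
Qed.

Lemma athcomp_hc J : acomposable (mc G' (xh x J)) [xh z (mh F J)].
Proof.
apply: acomposable1.
- rewrite (x_vs (at_ax z)) (m_vs (af_ax G')) (x_vs (at_ax x)).
  by rewrite (m_hdom (af_ax F)) athcomp_oc.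
- rewrite (x_vt (at_ax z)) (m_vt (af_ax G')) (x_vt (at_ax x)).
  by rewrite (m_hcod (af_ax F)) athcomp_oc.
- by rewrite (m_hs (af_ax G')) (x_hs (at_ax x)) (at_ht (at_ax z)).
Qed.

Lemma athcomp_nat_o A :
  vT (mv G' (xo x A)) (xo z (mo F A)) = vT (xo z (mo F' A)) (mv G (xo x A)).
Proof.
have := x_vT (af_ax G) (af_ax G') (at_ax z) (xo x A).
by rewrite (x_vdom (at_ax x)) (x_vcod (at_ax x)).
Qed.

Lemma athcomp_nat_h J :
  acomposable (xh z (mh F' J)) [mc G (xh x J)] /\
  aT (mc G' (xh x J)) [xh z (mh F J)] = aT (xh z (mh F' J)) [mc G (xh x J)].
Proof.
have := at_aT (au_ax L) (au_ax M) (af_ax G) (af_ax G') (at_ax z) (xh x J).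
have := xr_composable (au_ax L) (au_ax M) (af_ax G) (at_ax z) (xh x J).
by rewrite (x_hs (at_ax x)) /xtgt (at_ht (at_ax x)).
Qed.
End Hcomp.

Lemma aT_idh K (J : hmor K) (phi : cell K) : ht phi = Some J ->
  aT (aidh J) [phi] = phi.
Proof. by move=> e; have := aT_idl_tgt (au_ax K) phi; rewrite e => -[]. Qed.

Lemma aT_idh_r K (J : hmor K) (phi : cell K) : hs phi = [J] ->
  aT phi [aidh J] = phi.
Proof.
move=> e; have c := a_hs_chain (au_ax K) phi; rewrite e /= in c.
have H : acomposable phi [aidh J].
  case: c => e1 e2; apply: acomposable1.
  - by rewrite (a_vs_idh (au_ax K)) vcod_id.
  - by rewrite (a_vt_idh (au_ax K)) vcod_id.
  - by rewrite (a_ht_idh (au_ax K)).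
by rewrite -(aTE H); apply: (a_idh_r (au_ax K) (Js := [J])).
Qed.

Definition AugVirtDblCat_u : strict2cat.
Proof.
refine (@Strict2cat avdcu (fun K L => afunctor K L) (fun K L F G => atransf F G)
  (fun K => aid K) (fun K L M G F => afcomp G F) atid atcomp athcomp
  _ _ _ _ _ _ _ _ _ _ _).
- by move=> K L M N H G F; apply: afunctor_ext.
- by move=> K L F; apply: afunctor_ext; apply: gmap_ext.
- by move=> K L F; apply: afunctor_ext; apply: gmap_ext.
- move=> K L F G H I c b a; apply: atransf_ext; apply: tmap_ext => [A|J].
    rewrite !atcomp_o vTA //; exact: atcomp_oc.
  rewrite !atcomp_h.
  by case: (aTA1 (au_ax L) (atcomp_hc c b J) (atcomp_hc b a J)).
- move=> K L F G a; apply: atransf_ext; apply: tmap_ext => [A|J].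
    by rewrite atcomp_o vT_idl // (x_vcod (at_ax a)).
  by rewrite atcomp_h aT_idh // (at_ht (at_ax a)).
- move=> K L F G a; apply: atransf_ext; apply: tmap_ext => [A|J].
    by rewrite atcomp_o vT_idr // (x_vdom (at_ax a)).
  by rewrite atcomp_h aT_idh_r // (x_hs (at_ax a)).
- move=> K L M G F; apply: atransf_ext; apply: tmap_ext => [A|J].
    by rewrite athcomp_o /= (m_vid (af_ax G)) vT_idl // vcod_id.
  by rewrite athcomp_h /= (af_idh (af_ax G)) aT_idh // (a_ht_idh (au_ax M)).
- move=> K L M G G' G'' F F' F'' d c b a.
  apply: atransf_ext; apply: tmap_ext => [A|J].
    rewrite (atcomp_o (athcomp d b) (athcomp c a)) !athcomp_o !atcomp_o.
    rewrite (m_vT (af_ax G'')) ?(atcomp_oc b a) //.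
    have e1 := athcomp_oc d a A; have e2 := athcomp_oc d b A.
    have e3 := athcomp_oc c a A; have e4 := athcomp_nat_o d a A.
    have e5 := atcomp_oc d c (mo F A).
    have e6 : vcod (mv G'' (xo a A)) = vdom (mv G'' (xo b A)).
      by rewrite (m_vcod (af_ax G'')) (m_vdom (af_ax G'')) (atcomp_oc b a).
    have e7 : vcod (mv G' (xo a A)) = vdom (xo d (mo F' A)).
      rewrite (m_vcod (af_ax G')) (x_vdom (at_ax d)) (x_vcod (at_ax a)).
      by [].
    rewrite -(vTA (f := vT _ (xo c (mo F A)))) ?vT_cod //.
    rewrite (vTA e5 e1) e4 -(vTA e3 e7) vTA //; last by rewrite vT_cod.
  rewrite (atcomp_h (athcomp d b) (athcomp c a)) !athcomp_h !atcomp_h.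
  have HM := au_ax M.
  have e0 := atcomp_hc b a J.
  rewrite (af_aT (af_ax G'') e0) /=.
  have e1 := athcomp_hc d a J; have e2 := athcomp_hc d b J.
  have e3 := athcomp_hc c a J; case: (athcomp_nat_h d a J) => e7 e4.
  have e5 := atcomp_hc d c (mh F J).
  have e6 : acomposable (mc G'' (xh b J)) [mc G'' (xh a J)].
    exact: (af_composable (af_ax G'') e0).
  case: (aTA1 HM e1 e5) => f1 f2 f3.
  case: (aTA1 HM e7 e3) => f4 f5 f6.
  case: (aTA1 HM e2 f4) => _ _ <-.
  by rewrite f6 -e4 -f3; case: (aTA1 HM e6 f1) => _ _ ->.
- move=> K L M N H H' G G' F F' c b a; apply: atransf_tot;
    [exact: afunctor_ext|exact: afunctor_ext|].
  apply: tmap_ext => [A|J].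
    rewrite !athcomp_o /= (m_vT (af_ax H') (athcomp_oc b a A)).
    rewrite vTA //; first exact: (athcomp_oc c b).
    rewrite !(m_vcod (af_ax H'), m_vdom (af_ax H')); congr mo.
    exact: (athcomp_oc b a).
  have HN := au_ax N.
  rewrite !athcomp_h /=.
  rewrite (af_aT (af_ax H') (athcomp_hc b a J)) /=.
  have e := af_composable (af_ax H') (athcomp_hc b a J).
  by case: (aTA1 HN e (athcomp_hc c b (mh F J))) => _ _ ->.
- move=> K L F F' a; apply: atransf_tot;
    [by apply: afunctor_ext; apply: gmap_ext
    |by apply: afunctor_ext; apply: gmap_ext|].
  apply: tmap_ext => [A|J].
    by rewrite athcomp_o /= vT_idr // (x_vdom (at_ax a)).
  by rewrite athcomp_h /= aT_idh_r // (x_hs (at_ax a)).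
- move=> K L F F' a; apply: atransf_tot;
    [by apply: afunctor_ext; apply: gmap_ext
    |by apply: afunctor_ext; apply: gmap_ext|].
  apply: tmap_ext => [A|J].
    by rewrite athcomp_o /= (m_vid (af_ax F')) vT_idl // (x_vcod (at_ax a)).
  by rewrite athcomp_h /= (af_idh (af_ax F')) aT_idh // (at_ht (at_ax a)).
Defined.
End Avd2catLaws.

Lemma chain_last (B : base) (X : Type) (s t : X -> vmor B) p a b :
  chain s t a p b -> last (map t p) a = b.
Proof.
have last_d (d d' z : vmor B) l : last (z :: l) d = last (z :: l) d'.
  by elim: l z => [//|z' l IH] z; apply: IH.
elim: p a => [//|x p IH] a /= [_ /IH].
by case: p {IH} => [//|y p]; rewrite (last_d a (t x)).
Qed.

Section VdcLaws.
Variables (K : vd_data) (HK : is_vdc K).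
Implicit Types (phi psi chi : cell K) (phis psis : list (cell K)) (f g p : vmor K).

Lemma uT_hs psi f phis : ucomposable psi f phis ->
  hs (uT psi f phis) = flat_map (@hs _ K) phis.
Proof. by move=> H; rewrite -(uTE H) (u_hs_comp HK). Qed.

Lemma uT_ht psi f phis : ucomposable psi f phis -> ht (uT psi f phis) = ht psi.
Proof. by move=> H; rewrite -(uTE H) (u_ht_comp HK). Qed.

Lemma ucomp_ends psi phis f g : ucomposable psi f phis ->
  chain (@vs _ K) (@vt _ K) f phis g ->
  vcod f = vdom (vs psi) /\ vcod g = vdom (vt psi).
Proof. by case=> g' [c e1 e2 _] c'; rewrite -(chain_fun c c'). Qed.

Lemma uT_vs psi f phis : ucomposable psi f phis ->
  vs (uT psi f phis) = vT (vs psi) f.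
Proof.
move=> H; case: (H) => g [_ e _ _].
by rewrite -(uTE H) (u_vs_comp HK H e) vTE.
Qed.

Lemma uT_vt psi phis f g : ucomposable psi f phis ->
  chain (@vs _ K) (@vt _ K) f phis g -> vt (uT psi f phis) = vT (vt psi) g.
Proof.
move=> H c; case: (ucomp_ends H c) => _ e.
by rewrite -(uTE H) (u_vt_comp HK H c e) vTE.
Qed.

Lemma ucomposable1 psi f phi : vs phi = f ->
  vcod f = vdom (vs psi) -> vcod (vt phi) = vdom (vt psi) ->
  hs psi = [ht phi] -> ucomposable psi f [phi].
Proof. by move=> e e1 e2 e3; exists (vt phi). Qed.

Lemma uT1_vt psi f phi : ucomposable psi f [phi] ->
  vt (uT psi f [phi]) = vT (vt psi) (vt phi).
Proof. by move=> H; apply: uT_vt (H) _; case: H => g [[]]. Qed.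

Lemma uT1_hs psi f phi : ucomposable psi f [phi] -> hs (uT psi f [phi]) = hs phi.
Proof. by move=> H; rewrite uT_hs //= app_nil_r. Qed.

Lemma uTA chi p psis f phiss thetas g :
  upcomp f psis phiss thetas -> ucomposable chi p psis -> vcod f = vdom p ->
  chain (@vs _ K) (@vt _ K) f (concat phiss) g ->
  [/\ ucomposable chi (vT p f) thetas,
      ucomposable (uT chi p psis) f (concat phiss) &
      uT chi (vT p f) thetas = uT (uT chi p psis) f (concat phiss)].
Proof.
move=> P H2 ep c; case: (H2) => q [cp e1 e2 e3].
have [eg [ct [et eh]]] :
  vcod g = vdom q /\
  chain (@vs _ K) (@vt _ K) (vT p f) thetas (vT q g) /\
  map (@ht _ K) thetas = map (@ht _ K) psis /\
  flat_map (@hs _ K) psis = map (@ht _ K) (concat phiss).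
  move: p ep c cp {H2 e1 e2 e3}.
  elim: P => [{}f|{}f psi phis H psis' phiss' thetas' P IH] p ep /=.
    by move=> <- <-.
  move=> c [ep' cp]; case: (chain_split c) => m [c1 c2].
  rewrite (chain_last c1) in P IH.
  case: (ucomp_ends H c1) => a1 a2.
  have eH : ucomp H = uT psi f phis by rewrite uTE.
  have hsH : hs psi = map (@ht _ K) phis by case: H {eH} => ? [].
  rewrite eH uT_ht // (uT_vs H) (uT_vt H c1) map_app ep'.
  case: (IH _ a2 c2 cp) => z1 [z2 [z3 z4]].
  by rewrite z3 z4 hsH.
have H1 : ucomposable chi (vT p f) thetas.
  exists (vT q g); split=> //.
  - by rewrite vT_cod.
  - by rewrite vT_cod.
  - by rewrite et.
have H3 : ucomposable (uT chi p psis) f (concat phiss).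
  exists g; split=> //.
  - by rewrite (uT_vs H2) vT_dom.
  - by rewrite (uT_vt H2 cp) vT_dom.
  - by rewrite uT_hs.
split=> //.
move: H1 H3; rewrite -(uTE H2) -(vTE ep) => H1 H3.
by rewrite -(uTE H1) -(uTE H3); apply: (u_assoc HK).
Qed.

Lemma uTA1 chi p psi f phis : ucomposable chi p [psi] -> ucomposable psi f phis ->
  [/\ ucomposable chi (vT p f) [uT psi f phis], ucomposable (uT chi p [psi]) f phis &
      uT chi (vT p f) [uT psi f phis] = uT (uT chi p [psi]) f phis].
Proof.
move=> H1 H2; case: (H2) => g [c e _ _].
have P : upcomp f [psi] [phis] [uT psi f phis].
  by rewrite -(uTE H2); do 2 constructor.
have c' : chain (@vs _ K) (@vt _ K) f (concat [phis]) g by rewrite /= app_nil_r.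
have ep : vcod f = vdom p by case: H1 => ? [[<-]].
by case: (uTA P H1 ep c'); rewrite /= app_nil_r.
Qed.

Lemma uTA0 chi p f : ucomposable chi p [] -> vcod f = vdom p ->
  [/\ ucomposable chi (vT p f) [], ucomposable (uT chi p []) f [] &
      uT chi (vT p f) [] = uT (uT chi p []) f []].
Proof. by move=> H e; apply: (uTA (phiss := []) (g := f) _ H e) => //=; constructor. Qed.

Lemma uT_idh phi J : ht phi = J ->
  ucomposable (uidh J) (vs phi) [phi] /\ uT (uidh J) (vs phi) [phi] = phi.
Proof.
move=> <-; have H : ucomposable (uidh (ht phi)) (vs phi) [phi].
  apply: ucomposable1; rewrite ?(u_vs_idh HK) ?(u_vt_idh HK) ?(u_hs_idh HK) ?vdom_id //.
  - by rewrite (u_ht_dom HK).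
  - by rewrite (u_ht_cod HK).
by split=> //; rewrite -(uTE H) (u_idh_l HK).
Qed.

Lemma uchain_idh (Js : list (hmor K)) A B : chain (@hdom K) (@hcod K) A Js B ->
  chain (@vs _ K) (@vt _ K) (vid A) (map (@uidh K) Js) (vid B).
Proof.
apply: chain_map => J; first by rewrite (u_vs_idh HK).
by rewrite (u_vt_idh HK).
Qed.

Lemma map_ht_uidh (Js : list (hmor K)) : map (@ht _ K) (map (@uidh K) Js) = Js.
Proof. by elim: Js => [//|J Js IH] /=; rewrite (u_ht_idh HK) IH. Qed.

Lemma flat_hs_uidh (Js : list (hmor K)) : flat_map (@hs _ K) (map (@uidh K) Js) = Js.
Proof. by elim: Js => [//|J Js IH] /=; rewrite (u_hs_idh HK) /= IH. Qed.

Lemma uT_idr phi A Js : A = vdom (vs phi) -> Js = hs phi ->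
  ucomposable phi (vid A) (map (@uidh K) Js) /\
  uT phi (vid A) (map (@uidh K) Js) = phi.
Proof.
move=> -> ->; have H : ucomposable phi (vid (vdom (vs phi))) (map (@uidh K) (hs phi)).
  exists (vid (vdom (vt phi))); split; rewrite ?vcod_id ?map_ht_uidh //.
  exact: uchain_idh (u_hs_chain HK phi).
by split=> //; rewrite -(uTE H) (u_id_r HK).
Qed.

Lemma uT_idh_r (J : hmor K) phi : hs phi = [J] ->
  uT phi (vs (uidh J)) [uidh J] = phi.
Proof.
move=> e; have c := u_hs_chain HK phi; rewrite e /= in c; case: c => c1 c2.
rewrite (u_vs_idh HK) c1.
by case: (uT_idr (phi := phi) (Js := [J]) (eq_refl _) _).
Qed.
End VdcLaws.

Section UfunctorLaws.
Variables (K L : vd_data) (F : gmap K L) (HF : is_ufunctor F).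

Lemma uf_chain f phis g : chain (@vs _ K) (@vt _ K) f phis g ->
  chain (@vs _ L) (@vt _ L) (mv F f) (map (mc F) phis) (mv F g).
Proof. by apply: chain_map => x; [apply: (m_vs HF)|apply: (m_vt HF)]. Qed.

Lemma uf_composable (psi : cell K) f phis : ucomposable psi f phis ->
  ucomposable (mc F psi) (mv F f) (map (mc F) phis).
Proof.
case=> g [c e1 e2 e3]; exists (mv F g); split.
- exact: uf_chain.
- by rewrite (m_vcod HF) (m_vs HF) (m_vdom HF) e1.
- by rewrite (m_vcod HF) (m_vt HF) (m_vdom HF) e2.
rewrite (m_hs HF) e3 !map_map; apply: map_ext => phi.
by rewrite (uf_ht HF).
Qed.

Lemma uf_uT (psi : cell K) f phis : ucomposable psi f phis ->
  mc F (uT psi f phis) = uT (mc F psi) (mv F f) (map (mc F) phis).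
Proof.
move=> H; have H' := uf_composable H.
by rewrite -(uTE H) -(uTE H') (uf_comp HF H H').
Qed.
End UfunctorLaws.

Section UtransfLaws.
Variables (K L : vd_data) (HK : is_vdc K) (HL : is_vdc L).
Variables (F G : gmap K L) (HF : is_ufunctor F) (HG : is_ufunctor G).
Variables (x : tmap K L) (Hx : is_utransf F G x).

Lemma uxpath_chain A Js B : chain (@hdom K) (@hcod K) A Js B ->
  chain (@vs _ L) (@vt _ L) (xo x A) (map (xh x) Js) (xo x B).
Proof. by apply: chain_map => x0; [apply: (x_vs Hx)|apply: (x_vt Hx)]. Qed.

Lemma uxl_composable phi :
  ucomposable (mc G phi) (xo x (vdom (vs phi))) (map (xh x) (hs phi)).
Proof.
exists (xo x (vdom (vt phi))); split.
- exact: uxpath_chain (u_hs_chain HK phi).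
- by rewrite (x_vcod Hx) (m_vs HG) (m_vdom HG).
- by rewrite (x_vcod Hx) (m_vt HG) (m_vdom HG).
- by rewrite (m_hs HG) map_map; apply: map_ext => J; rewrite (ut_ht Hx).
Qed.

Lemma uxr_composable phi : ucomposable (xh x (ht phi)) (vs (mc F phi)) [mc F phi].
Proof.
apply: ucomposable1 => //.
- by rewrite (x_vs Hx) (u_ht_dom HK) (x_vdom Hx) (m_vs HF) (m_vcod HF).
- by rewrite (x_vt Hx) (u_ht_cod HK) (x_vdom Hx) (m_vt HF) (m_vcod HF).
- by rewrite (x_hs Hx) (uf_ht HF).
Qed.

Lemma ut_uT phi :
  uT (mc G phi) (xo x (vdom (vs phi))) (map (xh x) (hs phi)) =
  uT (xh x (ht phi)) (vs (mc F phi)) [mc F phi].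
Proof.
rewrite -(uTE (uxl_composable phi)) -(uTE (uxr_composable phi)).
exact: (ut_cell Hx).
Qed.
End UtransfLaws.

Section Vd2cat.

Definition uid_map (K : vd_data) : gmap K K :=
  Gmap (fun A => A) (fun f => f) (fun J => J) (fun phi => phi).

Lemma uid_ax (K : vd_data) : is_ufunctor (uid_map K).
Proof.
split=> //=; first split=> //=.
- by move=> g f e e'; rewrite (proof_irrelevance _ e e').
- by move=> phi; rewrite map_id.
- by move=> psi f phis H; rewrite map_id => H'; rewrite (proof_irrelevance _ H H').
Qed.

Lemma uid_normal (K : vd_data) : is_normal (uid_map K).
Proof. by []. Qed.

Definition nfid (K : vd_data) : nfunctor K K := Nfunctor (uid_ax K) (@uid_normal K).

Lemma ucomp_ax (K L M : vd_data) (G : gmap L M) (F : gmap K L) :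
  is_ufunctor G -> is_ufunctor F -> is_ufunctor (gcomp G F).
Proof.
move=> HG HF; split=> /=; first exact: (gcomp_ax HG HF).
- by move=> phi; rewrite (uf_ht HG) (uf_ht HF).
- move=> psi f phis H H'.
  by rewrite !uTE (uf_uT HF H) (uf_uT HG (uf_composable HF H)) map_map.
- by move=> J; rewrite (uf_idh HF) (uf_idh HG).
Qed.

Lemma normal_comp (K L M : vd_data) (G : gmap L M) (F : gmap K L) :
  is_normal G -> is_normal F -> is_normal (gcomp G F).
Proof. by move=> HG HF A eta /HF /HG. Qed.

Definition nfcomp (K L M : vd_data) (G : nfunctor L M) (F : nfunctor K L) :
    nfunctor K M :=
  Nfunctor (ucomp_ax (nf_ax G) (nf_ax F))
           (normal_comp (@nf_normal _ _ G) (@nf_normal _ _ F)).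

Lemma nfunctor_ext (K L : vd_data) (F G : nfunctor K L) :
  nf_map F = nf_map G -> F = G.
Proof.
case: F => F HF NF; case: G => G HG NG /= e; move: HF NF; rewrite e => HF NF.
by rewrite (proof_irrelevance _ HF HG) (proof_irrelevance _ NF NG).
Qed.

Lemma utransf_ext (K L : vd_data) (F G : nfunctor K L) (x y : utransf F G) :
  ut_map x = ut_map y -> x = y.
Proof.
case: x => x Hx; case: y => y Hy /= e; move: Hx; rewrite e => Hx.
by rewrite (proof_irrelevance _ Hx Hy).
Qed.

Lemma utransf_tot (K L : vd_data) (F G F' G' : nfunctor K L)
    (x : utransf F G) (y : utransf F' G') :
  F = F' -> G = G' -> ut_map x = ut_map y ->
  @tot (nfunctor K L) (@utransf K L) F G x = @tot (nfunctor K L) (@utransf K L) F' G' y.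
Proof.
by move=> eF eG; subst F' G' => /utransf_ext ->.
Qed.

Definition uxid (K L : vd_data) (F : gmap K L) : tmap K L :=
  Tmap (fun A => vid (mo F A)) (fun J => uidh (mh F J)).

Lemma uxid_ax (K L : vd_data) (HK : is_vdc K) (HL : is_vdc L) (F : gmap K L) :
  is_ufunctor F -> is_utransf F F (uxid F).
Proof.
move=> HF; split=> /=; first split=> /=.
- by move=> A; rewrite vdom_id.
- by move=> A; rewrite vcod_id.
- move=> f e e'; rewrite !vTE vT_idl ?vT_idr //.
  + by rewrite (m_vcod HF).
  + by rewrite (m_vdom HF).
- by move=> J; rewrite (u_hs_idh HL).
- by move=> J; rewrite (u_vs_idh HL) (m_hdom HF).
- by move=> J; rewrite (u_vt_idh HL) (m_hcod HF).
- by move=> J; rewrite (u_ht_idh HL).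
move=> phi H H'; transitivity (mc F phi); last by rewrite (u_idh_l HL).
have e : map (fun J => uidh (mh F J)) (hs phi) = map (@uidh L) (map (mh F) (hs phi)).
  by rewrite map_map.
by move: H; rewrite e => H; apply: (u_id_r HL).
Qed.

Section UVcomp.
Variables (K L : vd_data) (HK : is_vdc K) (HL : is_vdc L).
Variables (F G M : gmap K L).
Hypotheses (HF : is_ufunctor F) (HG : is_ufunctor G) (HM : is_ufunctor M).
Variables (y x : tmap K L) (Hy : is_utransf G M y) (Hx : is_utransf F G x).

Lemma uxv_o A : vcod (xo x A) = vdom (xo y A).
Proof. by rewrite (x_vcod Hx) (x_vdom Hy). Qed.

Lemma uxv_h J : ucomposable (xh y J) (vs (xh x J)) [xh x J].
Proof.
apply: ucomposable1 => //.
- by rewrite (x_vs Hx) (x_vs Hy) uxv_o.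
- by rewrite (x_vt Hx) (x_vt Hy) uxv_o.
- by rewrite (x_hs Hy) (ut_ht Hx).
Qed.

Definition uxvcomp : tmap K L :=
  Tmap (fun A => vcomp (uxv_o A)) (fun J => ucomp (uxv_h J)).

Lemma uxvcomp_o A : xo uxvcomp A = vT (xo y A) (xo x A).
Proof. by rewrite /= vTE. Qed.

Lemma uxvcomp_h J : xh uxvcomp J = uT (xh y J) (vs (xh x J)) [xh x J].
Proof. by rewrite /= uTE. Qed.

Lemma uxvcomp_tmap : is_tmap F M uxvcomp.
Proof.
split.
- by move=> A; rewrite uxvcomp_o vT_dom ?uxv_o // (x_vdom Hx).
- by move=> A; rewrite uxvcomp_o vT_cod ?uxv_o // (x_vcod Hy).
- move=> f e e'; rewrite !vTE !uxvcomp_o.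
  have a1 := uxv_o (vdom f); have a2 := uxv_o (vcod f).
  have b1 : vcod (xo y (vdom f)) = vdom (mv M f).
    by rewrite (x_vcod Hy) (m_vdom HM).
  have b2 : vcod (mv F f) = vdom (xo x (vcod f)).
    by rewrite (x_vdom Hx) (m_vcod HF).
  have b3 : vcod (xo x (vdom f)) = vdom (mv G f).
    by rewrite (x_vcod Hx) (m_vdom HG).
  have b4 : vcod (mv G f) = vdom (xo y (vcod f)).
    by rewrite (x_vdom Hy) (m_vcod HG).
  rewrite vTA // (x_vT HG HM Hy) -vTA // (x_vT HF HG Hx).
  by rewrite vTA.
- by move=> J; rewrite uxvcomp_h uT1_hs ?(x_hs Hx) //; apply: uxv_h.
- move=> J; rewrite uxvcomp_h uT_vs ?uxvcomp_o ?(x_vs Hx) ?(x_vs Hy) //.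
  by rewrite -(x_vs Hx); apply: uxv_h.
- move=> J; rewrite uxvcomp_h uT1_vt ?uxvcomp_o ?(x_vt Hx) ?(x_vt Hy) //.
  exact: uxv_h.
Qed.

Lemma uxvcomp_path A Js B : chain (@hdom K) (@hcod K) A Js B ->
  upcomp (xo x A) (map (xh y) Js) (map (fun phi => [phi]) (map (xh x) Js))
         (map (xh uxvcomp) Js).
Proof.
elim: Js A => [|J Js IH] A /=; first by constructor.
case=> eA c; have := uxv_h J; rewrite {1}(x_vs Hx) eA => H.
have -> : ucomp (uxv_h J) = ucomp H.
  by rewrite !uTE (x_vs Hx) eA.
by constructor; rewrite /= (x_vt Hx); apply: IH.
Qed.

Lemma uxvcomp_ax : is_utransf F M uxvcomp.
Proof.
split; first exact: uxvcomp_tmap.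
- by move=> J; rewrite uxvcomp_h uT_ht ?(ut_ht Hy) //; apply: uxv_h.
move=> phi H H'; rewrite !uTE uxvcomp_o uxvcomp_h.
have ch := u_hs_chain HK phi.
have cx := uxpath_chain Hx ch.
rewrite -(concat_single (map (xh x) _)) in cx.
have eo : vcod (xo x (vdom (vs phi))) = vdom (xo y (vdom (vs phi))) by rewrite uxv_o.
case: (uTA HL (uxvcomp_path ch) (uxl_composable HK HM Hy phi) eo cx).
rewrite concat_single => _ h1 ->.
rewrite (ut_uT HK HG HM Hy phi).
case: (uTA1 HL (uxr_composable HK HG Hy phi) (uxl_composable HK HG Hx phi)).
move=> h3 _ <-; rewrite (ut_uT HK HF HG Hx phi).
case: (uTA1 HL (uxv_h (ht phi)) (uxr_composable HK HF Hx phi)) => _ _ <-.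
congr uT; rewrite (m_vs HG) (m_vs HF) (x_vs Hx) (u_ht_dom HK).
exact: (x_vT HF HG Hx).
Qed.
End UVcomp.

Lemma uxwr_ax (K L M : vd_data) (G G' : gmap L M) (z : tmap L M) (F : gmap K L) :
  is_ufunctor F -> is_utransf G G' z ->
  is_utransf (gcomp G F) (gcomp G' F) (xwr z F).
Proof.
move=> HF Hz; split; first exact: (xwr_tmap HF Hz).
  by move=> J /=; rewrite (ut_ht Hz).
move=> phi /=.
have -> : map (fun J => xh z (mh F J)) (hs phi) = map (xh z) (hs (mc F phi)).
  by rewrite (m_hs HF) map_map.
rewrite -(uf_ht HF) -(m_vdom HF) -(m_vs HF).
exact: (ut_cell Hz).
Qed.

Lemma uxwl_ax (K L M : vd_data) (HK : is_vdc K)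
    (G : gmap L M) (F F' : gmap K L) (x : tmap K L) :
  is_ufunctor G -> is_ufunctor F -> is_ufunctor F' -> is_utransf F F' x ->
  is_utransf (gcomp G F) (gcomp G F') (xwl G x).
Proof.
move=> HG HF HF' Hx; split; first exact: (xwl_tmap HG HF HF' Hx).
  by move=> J /=; rewrite (uf_ht HG) (ut_ht Hx).
move=> phi H H'; rewrite !uTE /= (m_vs HG) -(map_map (xh x) (mc G)).
rewrite -(uf_uT HG (uxl_composable HK HF' Hx phi)) (ut_uT HK HF HF' Hx).
by rewrite (uf_uT HG (uxr_composable HK HF Hx phi)).
Qed.
End Vd2cat.

Section Vd2catLaws.
Implicit Types K L M : vdcu.

Definition utid K L (F : nfunctor K L) : utransf F F :=
  Utransf (uxid_ax (vu_ax K) (vu_ax L) (nf_ax F)).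

Definition utcomp K L (F G H : nfunctor K L) (y : utransf G H) (x : utransf F G) :
    utransf F H :=
  Utransf (uxvcomp_ax (vu_ax K) (vu_ax L) (nf_ax F) (nf_ax G) (nf_ax H)
             (ut_ax y) (ut_ax x)).

Definition uthcomp K L M (G G' : nfunctor L M) (F F' : nfunctor K L)
    (z : utransf G G') (x : utransf F F') :
    utransf (nfcomp G F) (nfcomp G' F') :=
  @utcomp K M (nfcomp G F) (nfcomp G' F) (nfcomp G' F')
    (@Utransf _ _ (nfcomp G' F) (nfcomp G' F') _
       (uxwl_ax (vu_ax K) (nf_ax G') (nf_ax F) (nf_ax F') (ut_ax x)))
    (@Utransf _ _ (nfcomp G F) (nfcomp G' F) _ (uxwr_ax (nf_ax F) (ut_ax z))).

Lemma utcomp_o K L (F G H : nfunctor K L) (y : utransf G H) (x : utransf F G) A :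
  xo (utcomp y x) A = vT (xo y A) (xo x A).
Proof. by rewrite /= vTE. Qed.

Lemma utcomp_h K L (F G H : nfunctor K L) (y : utransf G H) (x : utransf F G) J :
  xh (utcomp y x) J = uT (xh y J) (vs (xh x J)) [xh x J].
Proof. by rewrite /= uTE. Qed.

Lemma utcomp_oc K L (F G H : nfunctor K L) (y : utransf G H) (x : utransf F G) A :
  vcod (xo x A) = vdom (xo y A).
Proof. exact: (uxv_o (ut_ax y) (ut_ax x)). Qed.

Lemma utcomp_hc K L (F G H : nfunctor K L) (y : utransf G H) (x : utransf F G) J :
  ucomposable (xh y J) (vs (xh x J)) [xh x J].
Proof. exact: (uxv_h (ut_ax y) (ut_ax x)). Qed.

Section Hcomp.
Variables (K L M : vdcu) (G G' : nfunctor L M) (F F' : nfunctor K L).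
Variables (z : utransf G G') (x : utransf F F').

Lemma uthcomp_o A :
  xo (uthcomp z x) A = vT (mv G' (xo x A)) (xo z (mo F A)).
Proof. by rewrite /uthcomp utcomp_o. Qed.

Lemma uthcomp_h J :
  xh (uthcomp z x) J =
  uT (mc G' (xh x J)) (vs (xh z (mh F J))) [xh z (mh F J)].
Proof. by rewrite /uthcomp utcomp_h. Qed.

Lemma uthcomp_oc A : vcod (xo z (mo F A)) = vdom (mv G' (xo x A)).
Proof.
by rewrite (x_vcod (ut_ax z)) (m_vdom (nf_ax G')) (x_vdom (ut_ax x)).
Qed.

Lemma uthcomp_hc J :
  ucomposable (mc G' (xh x J)) (vs (xh z (mh F J))) [xh z (mh F J)].
Proof.
apply: ucomposable1 => //.
- rewrite (x_vs (ut_ax z)) (m_vs (nf_ax G')) (x_vs (ut_ax x)).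
  by rewrite (m_hdom (nf_ax F)) uthcomp_oc.
- rewrite (x_vt (ut_ax z)) (m_vt (nf_ax G')) (x_vt (ut_ax x)).
  by rewrite (m_hcod (nf_ax F)) uthcomp_oc.
- by rewrite (m_hs (nf_ax G')) (x_hs (ut_ax x)) (ut_ht (ut_ax z)).
Qed.

Lemma uthcomp_nat_o A :
  vT (mv G' (xo x A)) (xo z (mo F A)) = vT (xo z (mo F' A)) (mv G (xo x A)).
Proof.
have := x_vT (nf_ax G) (nf_ax G') (ut_ax z) (xo x A).
by rewrite (x_vdom (ut_ax x)) (x_vcod (ut_ax x)).
Qed.

Lemma uthcomp_nat_h J :
  ucomposable (xh z (mh F' J)) (vs (mc G (xh x J))) [mc G (xh x J)] /\
  uT (mc G' (xh x J)) (vs (xh z (mh F J))) [xh z (mh F J)] =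
  uT (xh z (mh F' J)) (vs (mc G (xh x J))) [mc G (xh x J)].
Proof.
have := ut_uT (vu_ax L) (nf_ax G) (nf_ax G') (ut_ax z) (xh x J).
have := uxr_composable (vu_ax L) (nf_ax G) (ut_ax z) (xh x J).
rewrite (x_hs (ut_ax x)) (ut_ht (ut_ax x)) (x_vs (ut_ax z)) /=.
by rewrite (m_hdom (nf_ax F)) (x_vs (ut_ax x)) (x_vdom (ut_ax x)).
Qed.
End Hcomp.

Lemma uTA11 L (c b a : cell L) :
  ucomposable c (vs b) [b] -> ucomposable b (vs a) [a] ->
  [/\ ucomposable c (vs (uT b (vs a) [a])) [uT b (vs a) [a]],
      ucomposable (uT c (vs b) [b]) (vs a) [a] &
      uT c (vs (uT b (vs a) [a])) [uT b (vs a) [a]] =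
      uT (uT c (vs b) [b]) (vs a) [a]].
Proof. by move=> H1 H2; rewrite !(uT_vs (vu_ax L) H2); apply: (uTA1 (vu_ax L)). Qed.

Definition VirtDblCat_u : strict2cat.
Proof.
refine (@Strict2cat vdcu (fun K L => nfunctor K L) (fun K L F G => utransf F G)
  (fun K => nfid K) (fun K L M G F => nfcomp G F) utid utcomp uthcomp
  _ _ _ _ _ _ _ _ _ _ _).
- by move=> K L M N H G F; apply: nfunctor_ext.
- by move=> K L F; apply: nfunctor_ext; apply: gmap_ext.
- by move=> K L F; apply: nfunctor_ext; apply: gmap_ext.
- move=> K L F G H I c b a; apply: utransf_ext; apply: tmap_ext => [A|J].
    rewrite !utcomp_o vTA //; exact: utcomp_oc.
  rewrite !utcomp_h.
  by case: (uTA11 (utcomp_hc c b J) (utcomp_hc b a J)).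
- move=> K L F G a; apply: utransf_ext; apply: tmap_ext => [A|J].
    by rewrite utcomp_o vT_idl // (x_vcod (ut_ax a)).
  by rewrite utcomp_h; case: (uT_idh (vu_ax L) (ut_ht (ut_ax a) J)).
- move=> K L F G a; apply: utransf_ext; apply: tmap_ext => [A|J].
    by rewrite utcomp_o vT_idr // (x_vdom (ut_ax a)).
  by rewrite utcomp_h (uT_idh_r (vu_ax L)) // (x_hs (ut_ax a)).
- move=> K L M G F; apply: utransf_ext; apply: tmap_ext => [A|J].
    by rewrite uthcomp_o /= (m_vid (nf_ax G)) vT_idl // vcod_id.
  rewrite uthcomp_h /= (uf_idh (nf_ax G)).
  by case: (uT_idh (vu_ax M) (u_ht_idh (vu_ax M) (mh G (mh F J)))).
- move=> K L M G G' G'' F F' F'' d c b a.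
  apply: utransf_ext; apply: tmap_ext => [A|J].
    rewrite (utcomp_o (uthcomp d b) (uthcomp c a)) !uthcomp_o !utcomp_o.
    rewrite (m_vT (nf_ax G'')) ?(utcomp_oc b a) //.
    have e1 := uthcomp_oc d a A; have e2 := uthcomp_oc d b A.
    have e3 := uthcomp_oc c a A; have e4 := uthcomp_nat_o d a A.
    have e5 := utcomp_oc d c (mo F A).
    have e6 : vcod (mv G'' (xo a A)) = vdom (mv G'' (xo b A)).
      by rewrite (m_vcod (nf_ax G'')) (m_vdom (nf_ax G'')) (utcomp_oc b a).
    have e7 : vcod (mv G' (xo a A)) = vdom (xo d (mo F' A)).
      by rewrite (m_vcod (nf_ax G')) (x_vdom (ut_ax d)) (x_vcod (ut_ax a)).
    rewrite -(vTA (f := vT _ (xo c (mo F A)))) ?vT_cod //.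
    by rewrite (vTA e5 e1) e4 -(vTA e3 e7) vTA //; last by rewrite vT_cod.
  rewrite (utcomp_h (uthcomp d b) (uthcomp c a)) !uthcomp_h !utcomp_h.
  have e0 := utcomp_hc b a J.
  rewrite (uf_uT (nf_ax G'') e0) /= -(m_vs (nf_ax G'')).
  have e1 := uthcomp_hc d a J; have e2 := uthcomp_hc d b J.
  have e3 := uthcomp_hc c a J; case: (uthcomp_nat_h d a J) => e7 e4.
  have e5 := utcomp_hc d c (mh F J).
  have e6 : ucomposable (mc G'' (xh b J)) (vs (mc G'' (xh a J))) [mc G'' (xh a J)].
    by rewrite (m_vs (nf_ax G'')); apply: (uf_composable (nf_ax G'') e0).
  case: (uTA11 e1 e5) => f1 f2 f3.
  case: (uTA11 e7 e3) => f4 f5 f6.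
  case: (uTA11 e2 f4) => _ _ <-.
  by rewrite f6 -e4 -f3; case: (uTA11 e6 f1) => _ _ ->.
- move=> K L M N H H' G G' F F' c b a; apply: utransf_tot;
    [exact: nfunctor_ext|exact: nfunctor_ext|].
  apply: tmap_ext => [A|J].
    rewrite !uthcomp_o /= (m_vT (nf_ax H') (uthcomp_oc b a A)).
    rewrite vTA //; first exact: (uthcomp_oc c b).
    rewrite !(m_vcod (nf_ax H'), m_vdom (nf_ax H')); congr mo.
    exact: (uthcomp_oc b a).
  rewrite !uthcomp_h /=.
  rewrite (uf_uT (nf_ax H') (uthcomp_hc b a J)) /= -(m_vs (nf_ax H')).
  have e := uf_composable (nf_ax H') (uthcomp_hc b a J).
  rewrite /= -(m_vs (nf_ax H')) in e.
  by case: (uTA11 e (uthcomp_hc c b (mh F J))) => _ _ ->.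
- move=> K L F F' a; apply: utransf_tot;
    [by apply: nfunctor_ext; apply: gmap_ext
    |by apply: nfunctor_ext; apply: gmap_ext|].
  apply: tmap_ext => [A|J].
    by rewrite uthcomp_o /= vT_idr // (x_vdom (ut_ax a)).
  by rewrite uthcomp_h /= (uT_idh_r (vu_ax L)) // (x_hs (ut_ax a)).
- move=> K L F F' a; apply: utransf_tot;
    [by apply: nfunctor_ext; apply: gmap_ext
    |by apply: nfunctor_ext; apply: gmap_ext|].
  apply: tmap_ext => [A|J].
    by rewrite uthcomp_o /= (m_vid (nf_ax F')) vT_idl // (x_vcod (ut_ax a)).
  rewrite uthcomp_h /= (uf_idh (nf_ax F')).
  by case: (uT_idh (vu_ax L) (ut_ht (ut_ax a) J)).
Defined.
End Vd2catLaws.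

Definition ucell (K : avd_data) : Type :=
  {p : cell K * hmor K | ht (fst p) = Some (snd p)}.

Definition uval (K : avd_data) (p : ucell K) : cell K := fst (proj1_sig p).
Definition utgt (K : avd_data) (p : ucell K) : hmor K := snd (proj1_sig p).

Lemma uval_ht (K : avd_data) (p : ucell K) : ht (uval p) = Some (utgt p).
Proof. exact: (proj2_sig p). Qed.

Lemma ucell_ext (K : avd_data) (p q : ucell K) : uval p = uval q -> p = q.
Proof.
move=> e; have := uval_ht p; rewrite e uval_ht => -[].
case: p e => [[a I] Hp]; case: q => [[b J] Hq]; rewrite /uval /utgt /= => e1 e2.
move: Hp; rewrite e1 -e2 => Hp; by rewrite (proof_irrelevance _ Hp Hq).
Qed.

Definition U_graph (K : avd_data) : vd_graph :=
  @Graph hmor K (ucell K) (fun p => hs (uval p)) (@utgt K)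
    (fun p => vs (uval p)) (fun p => vt (uval p)).

(** The path of cells of [K] denoted by a path of unary cells.  *)
Definition upath (K : avd_data) (f : vmor K) (phis : list (ucell K)) :
    list (cell K) :=
  match phis with
  | [] => [aidv f]
  | _ => map (@uval K) phis
  end.

Section Udata.
Variables (K : avd_data) (HK : is_avdc K).

Lemma upath_chain f (phis : list (cell (U_graph K))) g :
  chain (@vs _ (U_graph K)) (@vt _ (U_graph K)) f phis g ->
  chain (@vs _ K) (@vt _ K) f (upath f phis) g.
Proof.
case: phis => [|phi phis] /=; first by move=> ->; rewrite (a_vs_idv HK) (a_vt_idv HK).
case=> e c; split=> //.
exact: (chain_map (h := @uval K) (k := fun x => x) _ _ c).
Qed.

Lemma upath_tgt f (phis : list (cell (U_graph K))) :
  flat_map (fun phi => olist (ht phi)) (upath f phis) = map (@utgt K) phis.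
Proof.
case: phis => [|phi phis]; first by rewrite /= (a_ht_idv HK).
rewrite /upath; elim: (phi :: phis) => [//|p l IH].
by rewrite /= uval_ht /= IH.
Qed.

Lemma upath_hs f (phis : list (cell (U_graph K))) :
  flat_map (@hs _ K) (upath f phis) = flat_map (@hs _ (U_graph K)) phis.
Proof.
case: phis => [|phi phis]; first by rewrite /= (a_hs_idv HK).
rewrite /upath; elim: (phi :: phis) => [//|p l IH].
by rewrite /= IH.
Qed.

Lemma U_composable (psi : cell (U_graph K)) f phis :
  ucomposable psi f phis -> acomposable (uval psi) (upath f phis).
Proof.
case=> g [c e1 e2 e3]; split; first by case: (phis).
exists f, g; split=> //; first exact: upath_chain.
by rewrite upath_tgt.
Qed.

Lemma U_comp_ht (psi : cell (U_graph K)) f phis (H : ucomposable psi f phis) :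
  ht (acomp (U_composable H)) = Some (utgt psi).
Proof. by rewrite (a_ht_comp HK) uval_ht. Qed.

Definition U_comp (psi : cell (U_graph K)) f phis (H : ucomposable psi f phis) :
    cell (U_graph K) :=
  exist (fun p => ht (fst p) = Some (snd p)) (acomp (U_composable H), utgt psi)
    (U_comp_ht H).

Definition U_idh (J : hmor K) : cell (U_graph K) :=
  exist (fun p => ht (fst p) = Some (snd p)) (aidh J, J) (a_ht_idh HK J).

Definition U_data : vd_data := @VdData (U_graph K) U_comp U_idh.

Lemma U_uT (psi : cell U_data) f phis : ucomposable psi f phis ->
  uval (uT psi f phis) = aT (uval psi) (upath f phis).
Proof. by move=> H; rewrite -(uTE H) -(aTE (U_composable H)). Qed.

Lemma aT_ins (psi : cell K) p q a b c : p ++ q <> [] ->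
  chain (@vs _ K) (@vt _ K) a p b -> chain (@vs _ K) (@vt _ K) b q c ->
  acomposable psi (p ++ q) ->
  acomposable psi (p ++ aidv b :: q) /\ aT psi (p ++ aidv b :: q) = aT psi (p ++ q).
Proof.
move=> nz c1 c2 H; have [ea ec] := acomp_ends H (chain_cat c1 c2).
have H' : acomposable psi (p ++ aidv b :: q).
  split; first by case: (p).
  exists a, c; split=> //.
    apply: (chain_cat c1); split; first by rewrite (a_vs_idv HK).
    by rewrite (a_vt_idv HK).
  by case: H => _ [? [? [_ _ _ ->]]]; rewrite !flat_map_app /= (a_ht_idv HK).
by split=> //; rewrite -(aTE H) -(aTE H'); apply: (a_idv_del HK).
Qed.

Lemma upcomp_apcomp f (psis : list (cell U_data)) phiss thetas g :
  upcomp f psis phiss thetas ->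
  chain (@vs _ U_data) (@vt _ U_data) f (concat phiss) g ->
  exists l : list (list (cell K)),
    [/\ apcomp (map (@uval K) psis) l (map (@uval K) thetas),
     chain (@vs _ K) (@vt _ K) f (concat l) g,
     psis <> [] -> concat l <> [] &
     forall pre (x : cell K) a, pre <> [] -> chain (@vs _ K) (@vt _ K) a pre f ->
       acomposable x (pre ++ map (@uval K) (concat phiss)) ->
       aT x (pre ++ concat l) = aT x (pre ++ map (@uval K) (concat phiss))].
Proof.
elim=> [{}f|{}f psi phis H psis' phiss' thetas' P IH] /= c.
  by exists []; split=> //; constructor.
case: (chain_split c) => m [c1 c2]; rewrite (chain_last c1) in P IH.
case: (IH c2) => l [l1 l2 _ l4].
have cm : forall p s t, chain (@vs _ U_data) (@vt _ U_data) s p t ->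
    chain (@vs _ K) (@vt _ K) s (map (@uval K) p) t.
  by move=> p s t; apply: (chain_map (h := @uval K) (k := fun x => x)).
exists (upath f phis :: l); split.
- by constructor.
- by apply: chain_cat l2; apply: upath_chain.
- by move=> _ /app_eq_nil []; case: (phis).
move=> pre x a nz cp; rewrite map_app => Hx /=.
have cmid : chain (@vs _ K) (@vt _ K) a (pre ++ map (@uval K) phis) m.
  by apply: chain_cat cp _; apply: cm.
have Hx' := Hx; rewrite app_assoc in Hx'.
have nz2 : pre ++ map (@uval K) phis <> [] by move=> /app_eq_nil [/nz].
have := l4 _ _ _ nz2 cmid Hx'; rewrite -!app_assoc => e.
case: phis H c c1 Hx Hx' e cmid nz2 => [|phi phis] H c c1 Hx Hx' e cmid nz2 //.
rewrite -e /=; move: c1 => /= ?; subst m.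
have cl : chain (@vs _ K) (@vt _ K) a (pre ++ concat l) g by apply: chain_cat l2.
have Hl : acomposable x (pre ++ concat l).
  split; first by move=> /app_eq_nil [/nz].
  have Hc : chain (@vs _ K) (@vt _ K) a (pre ++ map (@uval K) (concat phiss')) g.
    by apply: (chain_cat cp); apply: cm.
  have [ea eg] := acomp_ends Hx Hc.
  exists a, g; split=> //.
  case: Hx => _ [? [? [_ _ _ ->]]]; rewrite !flat_map_app; congr app.
  clear -P l1 HK.
  have : forall s p q r, @upcomp U_data s p q r -> forall l0,
    apcomp (map (@uval K) p) l0 (map (@uval K) r) ->
    flat_map (fun phi => olist (ht phi)) (map (@uval K) (concat q)) =
    flat_map (fun phi => olist (ht phi)) (concat l0).
    move=> s p q r; elim=> [s0|s0 psi0 phis1 H p0 q0 r0 _ IH] l0 /=.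
      by move=> A; inversion A.
    move=> A; inversion A as [|? phis0 H0 ? l' ? A' e1 e2 e3]; subst.
    rewrite map_app !flat_map_app (IH _ A'); congr app.
    case: H0 {e3 A} => _ [? [? [_ _ _ <-]]].
    case: H => ? [_ _ _ /= ->]; elim: (phis1) => [//|z w IHw] /=.
    by rewrite uval_ht /= IHw.
  by move/(_ _ _ _ _ P _ l1).
have nzl : pre ++ concat l <> [] by move=> /app_eq_nil [/nz].
by case: (aT_ins nzl cp l2 Hl).
Qed.

Lemma U_vdc : is_vdc U_data.
Proof.
split=> /=.
- by move=> phi; apply: (a_hs_chain HK).
- by move=> phi; have := a_ht_chain HK (uval phi); rewrite uval_ht => -[].
- by move=> phi; have := a_ht_chain HK (uval phi); rewrite uval_ht => -[_].
- by move=> psi f phis H; rewrite /uval /= (a_hs_comp HK) upath_hs.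
- by [].
- move=> psi f phis H e; rewrite /uval /=; have [g [c _ _ _]] := H.
  exact: (a_vs_comp HK _ (upath_chain c)).
- move=> psi f phis H g c e; rewrite /uval /=.
  exact: (a_vt_comp HK _ (upath_chain c)).
- by move=> J; rewrite /uval /= (a_hs_idh HK).
- by [].
- by move=> J; rewrite /uval /= (a_vs_idh HK).
- by move=> J; rewrite /uval /= (a_vt_idh HK).
- move=> chi p psis f phiss thetas P e H1 H2 H3; apply: ucell_ext.
  rewrite [LHS]aTE [RHS]aTE vTE -!/(uval _).
  have -> : uval (U_comp H2) = aT (uval chi) (upath p psis).
    exact: (aTE (U_composable H2)).
  have [g [c _ _ _]] := H3; case: (upcomp_apcomp P c) => l [l1 l2 l3 l4].
  have H2' := U_composable H2.
  inversion P as [|? psi phis H psis' phiss' thetas' P' e1 e2 e3 e4]; subst.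
    case: (aT_idv HK e) => h1 /= <-.
    by case: (aTA1 HK H2' h1).
  case: (aTA HK l1 H2' l2) => _ h2 ->.
  move: l2 l4 h2 l3; set m := concat l => l2 l4 h2 l3.
  have nzm : m <> [] by apply: l3.
  have cf : chain (@vs _ K) (@vt _ K) f [] f by [].
  have ci : chain (@vs _ K) (@vt _ K) f [aidv f] f.
    by rewrite /= (a_vs_idv HK) (a_vt_idv HK).
  case: (aT_ins (p := []) nzm cf l2 h2) => _ <-.
  have H3' := U_composable H3; rewrite /uval /= aTE in H3'.
  have [H4 e4] : acomposable (aT (uval chi) (upath p (psi :: psis')))
       ([aidv f] ++ map (@uval K) (concat (phis :: phiss'))) /\
     aT (aT (uval chi) (upath p (psi :: psis')))
       ([aidv f] ++ map (@uval K) (concat (phis :: phiss'))) =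
     aT (aT (uval chi) (upath p (psi :: psis')))
       (upath f (concat (phis :: phiss'))).
    have c' := upath_chain c; move: c' H3' => /=.
    case: (phis ++ concat phiss') => [|z w] c' H3'; first by [].
    exact: (aT_ins (p := []) _ cf c' H3').
  by rewrite -e4 -(l4 [aidv f] _ f _ ci H4).
- move=> J f phi H; apply: ucell_ext; rewrite /uval /=.
  exact: (a_idh_l HK).
- move=> phi A Js H; apply: ucell_ext; rewrite /uval /=.
  case: Js H => [|J Js] H; first exact: (a_idv_r HK).
  have e : upath (vid A) (map U_idh (J :: Js)) = map (@aidh K) (J :: Js).
    by rewrite /upath /= map_map.
  rewrite [LHS]aTE e; have := U_composable H; rewrite e => H'.
  by rewrite -(aTE H'); apply: (a_idh_r HK).
Qed.

Lemma upath_idh J' J'' (eta : cell U_data) f :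
  upath f (map U_idh J' ++ eta :: map U_idh J'') =
  map (@aidh K) J' ++ uval eta :: map (@aidh K) J''.
Proof.
have -> : upath f (map U_idh J' ++ eta :: map U_idh J'') =
          map (@uval K) (map U_idh J' ++ eta :: map U_idh J'').
  by case: J'.
by rewrite map_app /= !map_map.
Qed.

Lemma U_unit A (eta : cell U_data) :
  a_unit A (utgt eta) (uval eta) -> @u_unit U_data A eta.
Proof.
case=> e1 e2 e3 e4 u; split=> // J' J'' chi h1 h2 h3.
case: (u J' J'' (uval chi) h1 h2 h3) => chi' [[k1 k2 k3 k4 [H e]] un].
have hu : ht chi' = Some (utgt chi) by rewrite k2 uval_ht.
have cJ : chain (@vs _ U_data) (@vt _ U_data) (vid (vdom (vs (uval chi))))
            (map (@uidh U_data) J' ++ eta :: map (@uidh U_data) J'')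
            (vid (vdom (vt (uval chi)))).
  apply: chain_cat (uchain_idh U_vdc h2) _; split; first exact: e3.
  have -> : vt eta = vid A by exact: e4.
  exact: (uchain_idh U_vdc h3).
exists (exist (fun p => ht (fst p) = Some (snd p)) (chi', utgt chi) hu); split.
  split=> //.
  have Hu : @ucomposable U_data
      (exist (fun p => ht (fst p) = Some (snd p)) (chi', utgt chi) hu)
      (vid (vdom (vs chi)))
      (map (@uidh U_data) J' ++ eta :: map (@uidh U_data) J'').
    exists (vid (vdom (vt (uval chi)))); split=> //=.
    - by rewrite vcod_id k3.
    - by rewrite vcod_id k4.
    - rewrite /uval /= k1 map_app /= !map_map /=.
      by rewrite !map_id.
  exists Hu; apply: ucell_ext; rewrite e /uval /= !aTE.
  by rewrite upath_idh.
move=> c' [k1' k2' k3' k4' [H' e']]; apply: ucell_ext; rewrite /uval /=.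
apply: un; split=> //.
  by rewrite !uval_ht -[utgt c']/(ht c') k2'.
have Hc := U_composable H'; rewrite upath_idh in Hc.
by exists Hc; rewrite e' /uval /= !aTE upath_idh.
Qed.
End Udata.

Lemma U_has_units (K : avdcu) : u_has_units (U_data (au_ax K)).
Proof.
move=> A; case: (au_units A) => I [eta u].
have h : ht eta = Some I by case: u.
exists (exist (fun p => ht (fst p) = Some (snd p)) (eta, I) h).
exact: U_unit.
Qed.

Definition U_obj (K : avdcu) : vdcu := Vdcu (U_vdc (au_ax K)) (U_has_units (K := K)).

(** Functors of augmented virtual double categories preserve units, because
    a unit [eta : (A) => I] amounts to a nullary inverse [eps : I => A].  *)
Section UnitInverse.
Variables (K : avd_data) (HK : is_avdc K).

Definition unit_inverse (A : ob K) (I : hmor K) (eta eps : cell K) : Prop :=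
  [/\ [/\ hs eta = [], ht eta = Some I, vs eta = vid A & vt eta = vid A],
      [/\ hs eps = [I], ht eps = None, vs eps = vid A & vt eps = vid A],
      aT eps [eta] = aidv (vid A) & aT eta [eps] = aidh I].

Lemma unit_inverse_comp A I eta eps : unit_inverse A I eta eps ->
  acomposable eps [eta] /\ acomposable eta [eps].
Proof.
case=> -[e1 e2 e3 e4] [d1 d2 d3 d4] _ _; split; apply: acomposable1.
- by rewrite e3 d3 vcod_id vdom_id.
- by rewrite e4 d4 vcod_id vdom_id.
- by rewrite d1 e2.
- by rewrite e3 d3 vcod_id vdom_id.
- by rewrite e4 d4 vcod_id vdom_id.
- by rewrite e1 d2.
Qed.

Definition plug (J' : list (hmor K)) (phi : cell K) (J'' : list (hmor K)) :=
  map (@aidh K) J' ++ phi :: map (@aidh K) J''.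

Lemma plug_chain J' phi J'' A B A' : vs phi = vid A -> vt phi = vid A ->
  chain (@hdom K) (@hcod K) A' J' A -> chain (@hdom K) (@hcod K) A J'' B ->
  chain (@vs _ K) (@vt _ K) (vid A') (plug J' phi J'') (vid B).
Proof.
move=> e1 e2 c1 c2; apply: chain_cat (chain_idh HK c1) _; split=> //.
by rewrite e2; apply: (chain_idh HK c2).
Qed.

Lemma plug_tgt J' phi J'' :
  flat_map (fun phi => olist (ht phi)) (plug J' phi J'') =
  J' ++ olist (ht phi) ++ J''.
Proof. by rewrite flat_map_app /= !(flat_idh HK). Qed.

Lemma plug_hs J' phi J'' :
  flat_map (@hs _ K) (plug J' phi J'') = J' ++ hs phi ++ J''.
Proof. by rewrite flat_map_app /= !(flat_hs_idh HK). Qed.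

Lemma plug_apcomp J' J'' psi phi : acomposable psi [phi] ->
  apcomp (plug J' psi J'')
    (map (fun J => [aidh J]) J' ++ [phi] :: map (fun J => [aidh J]) J'')
    (plug J' (aT psi [phi]) J'').
Proof.
have id1 (J : hmor K) (H : acomposable (aidh J) [aidh J]) : acomp H = aidh J.
  exact: (a_idh_l HK).
have Hid (J : hmor K) : acomposable (aidh J) [aidh J].
  apply: acomposable1.
  - by rewrite (a_vs_idh HK) vcod_id vdom_id.
  - by rewrite (a_vt_idh HK) vcod_id vdom_id.
  - by rewrite (a_hs_idh HK) (a_ht_idh HK).
move=> H; rewrite -(aTE H).
have base : apcomp (map (@aidh K) J'') (map (fun J => [aidh J]) J'')
              (map (@aidh K) J'').
  elim: J'' => [|J Js IH] /=; first by constructor.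
  by rewrite -[X in _ _ _ (X :: _)](id1 J (Hid J)); constructor.
elim: J' => [|J Js IH] /=; first by constructor.
by rewrite /plug /= -[X in _ _ _ (X :: _)](id1 J (Hid J)); constructor.
Qed.

Lemma plug_concat J' phi J'' :
  concat (map (fun J : hmor K => [aidh J]) J' ++
          [phi] :: map (fun J : hmor K => [aidh J]) J'') = plug J' phi J''.
Proof.
rewrite concat_app /=; congr app; last congr cons.
  by elim: (J') => [//|J Js IH] /=; rewrite IH.
by elim: (J'') => [//|J Js IH] /=; rewrite IH.
Qed.

Lemma aT_idall chi : hs chi <> [] ->
  acomposable chi (map (@aidh K) (hs chi)) /\
  aT chi (map (@aidh K) (hs chi)) = chi.
Proof.
move=> nz; have H : acomposable chi (map (@aidh K) (hs chi)).
  split; first by case: (hs chi) nz.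
  exists (vid (vdom (vs chi))), (vid (vdom (vt chi))); split.
  - exact: (chain_idh HK (a_hs_chain HK chi)).
  - by rewrite vcod_id.
  - by rewrite vcod_id.
  - by rewrite (flat_idh HK).
by split=> //; rewrite -(aTE H); apply: (a_idh_r HK).
Qed.

Lemma unit_inverse_unit A I eta eps : unit_inverse A I eta eps -> a_unit A I eta.
Proof.
move=> ui; case: (unit_inverse_comp ui) => c1 c2.
case: ui => -[e1 e2 e3 e4] [d1 d2 d3 d4] i1 i2; split=> // J' J'' chi h1 h2 h3.
have ceps := plug_chain d3 d4 h2 h3.
have ceta := plug_chain e3 e4 h2 h3.
have H1 : acomposable chi (plug J' eps J'').
  split; first by rewrite /plug; case: (J').
  exists (vid (vdom (vs chi))), (vid (vdom (vt chi))); split=> //.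
  - by rewrite vcod_id.
  - by rewrite vcod_id.
  - by rewrite plug_tgt d2.
have ceta' := ceta; rewrite -plug_concat in ceta'.
case: (aTA HK (plug_apcomp J' J'' c1) H1 ceta'); rewrite plug_concat i1 => k1 k2 k3.
exists (aT chi (plug J' eps J'')); split.
  split.
  - by rewrite (aT_hs HK H1) plug_hs d1.
  - by rewrite (aT_ht HK H1).
  - by rewrite (aT_vs HK H1 ceps) vT_idr.
  - by rewrite (aT_vt HK H1 ceps) vT_idr.
  exists k2; rewrite aTE -[map _ _ ++ _]/(plug J' eta J'') -k3.
  case E: (J' ++ J'') => [|J Js].
    case: (app_eq_nil _ _ E) => E1 E2; subst J' J''; rewrite /plug /= in k1 *.
    by rewrite -(aTE k1) (a_idv_r HK).
  have [z1 z2] : acomposable chi (map (@aidh K) J' ++ map (@aidh K) J'') /\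
         aT chi (map (@aidh K) J' ++ map (@aidh K) J'') = chi.
    by rewrite -map_app -h1; apply: aT_idall; rewrite h1 E.
  rewrite -[LHS]z2 -(aTE z1) -(aTE k1).
  by rewrite (a_idv_del HK k1 z1).
move=> chi' [g1 g2 g3 g4 [H e]]; rewrite e aTE -[map _ _ ++ _]/(plug J' eta J'').
have Hc : acomposable chi' (plug J' eta J'') by exact: H.
have ceps' := ceps; rewrite -plug_concat in ceps'.
case: (aTA HK (plug_apcomp J' J'' c2) Hc ceps'); rewrite plug_concat i2 => _ _ <-.
have -> : plug J' (aidh I) J'' = map (@aidh K) (hs chi').
  by rewrite g1 /plug map_app.
by case: (aT_idall (chi := chi')); rewrite ?g1 //; case: (J').
Qed.
End UnitInverse.

Lemma U_unit_inverse (K : avdcu) A (eta : cell (U_obj K)) :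
  @u_unit (U_obj K) A eta -> exists eps, unit_inverse A (utgt eta) (uval eta) eps.
Proof.
have HK := au_ax K; case=> e1 e3 e4 u; have e2 := uval_ht eta.
rewrite /= in e1 e3 e4.
case: (au_units A) => I0 [eta0 u0]; case: (u0) => f1 f2 f3 f4 v.
have nA : chain (@hdom K) (@hcod K) (vdom (vs (aidv (vid A)))) [] A.
  by rewrite /= (a_vs_idv HK) vdom_id.
have nA' : chain (@hdom K) (@hcod K) A [] (vdom (vt (aidv (vid A)))).
  by rewrite /= (a_vt_idv HK) vdom_id.
case: (v [] [] (aidv (vid A)) (a_hs_idv HK _) nA nA') => eps0 [].
rewrite /= (a_ht_idv HK) (a_vs_idv HK) (a_vt_idv HK).
case=> g1 g2 g3 g4 [H0]; rewrite aTE => i0 _.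
pose eta0' : cell (U_obj K) :=
  exist (fun p => ht (fst p) = Some (snd p)) (eta0, I0) f2.
have m1 : chain (@hdom (U_obj K)) (@hcod (U_obj K)) (vdom (vs eta0')) [] A.
  by rewrite /= /uval /= f3 vdom_id.
have m2 : chain (@hdom (U_obj K)) (@hcod (U_obj K)) A [] (vdom (vt eta0')).
  by rewrite /= /uval /= f4 vdom_id.
case: (u [] [] eta0' f1 m1 m2) => w [[w1 w2 w3 w4 [Hw ew]] _].
have Hw' : acomposable (uval w) [uval eta] by exact: (U_composable HK Hw).
have {}ew : eta0 = aT (uval w) [uval eta].
  transitivity (uval (U_comp (au_ax K) Hw)); first exact: (f_equal (@uval K) ew).
  exact: (aTE (U_composable (au_ax K) Hw)).
rewrite /= /uval /= -/(uval w) in w1 w2 w3 w4.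
have hw : ht (uval w) = Some I0 by rewrite uval_ht w2.
have H1 : acomposable eps0 [uval w].
  apply: acomposable1.
  - by rewrite w3 f3 g3 vcod_id vdom_id.
  - by rewrite w4 f4 g4 vcod_id vdom_id.
  - by rewrite g1 hw.
exists (aT eps0 [uval w]).
case: (aTA1 HK H1 Hw') => _ h2 h3.
have k1 : hs (aT eps0 [uval w]) = [utgt eta] by rewrite aT1_hs.
have k2 : ht (aT eps0 [uval w]) = None by rewrite aT_ht.
have k3 : vs (aT eps0 [uval w]) = vid A.
  by rewrite aT1_vs // g3 w3 f3 vT_idl // vcod_id.
have k4 : vt (aT eps0 [uval w]) = vid A.
  by rewrite aT1_vt // g4 w4 f4 vT_idl // vcod_id.
have i1 : aT (aT eps0 [uval w]) [uval eta] = aidv (vid A) by rewrite -h3 -ew -i0.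
split=> //.
have H2 : acomposable (uval eta) [aT eps0 [uval w]].
  apply: acomposable1.
  - by rewrite e3 k3 vcod_id vdom_id.
  - by rewrite e4 k4 vcod_id vdom_id.
  - by rewrite e1 k2.
case: (aTA1 HK H2 h2) => h4 h5; rewrite i1 in h4 *.
rewrite -(aTE h4) (a_idv_r HK) => h6.
have n1 : chain (@hdom (U_obj K)) (@hcod (U_obj K)) (vdom (vs eta)) [] A.
  by rewrite /= e3 vdom_id.
have n2 : chain (@hdom (U_obj K)) (@hcod (U_obj K)) A [] (vdom (vt eta)).
  by rewrite /= e4 vdom_id.
case: (u [] [] eta e1 n1 n2) => s [_ un].
have step (c : cell K) : hs c = [utgt eta] -> ht c = Some (utgt eta) ->
    vs c = vid A -> vt c = vid A -> acomposable c [uval eta] ->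
    uval eta = aT c [uval eta] -> c = uval s.
  move=> c1 c2 c3 c4 c5 c6.
  pose c' : cell (U_obj K) :=
    exist (fun p => ht (fst p) = Some (snd p)) (c, utgt eta) c2.
  rewrite (un c') //; split=> //=.
  - by rewrite /uval /= c3 e3.
  - by rewrite /uval /= c4 e4.
  have Hc' : ucomposable c' (vid (vdom (vs eta))) [eta].
    exists (vid A); split=> /=.
    + by rewrite e3 vdom_id.
    + by rewrite vcod_id /uval /= c3 e3 !vdom_id.
    + by rewrite vcod_id /uval /= c4 vdom_id.
    + by rewrite /uval /= c1.
  exists Hc'; apply: ucell_ext; apply: (eq_trans c6).
  by symmetry; apply: (aTE (U_composable (au_ax K) Hc')).
transitivity (uval s); [apply: step => //|symmetry; apply: step].
  + by rewrite aT1_hs.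
  + by rewrite aT_ht.
  + by rewrite aT1_vs // e3 k3 vT_idl // vcod_id.
  + by rewrite aT1_vt // e4 k4 vT_idl // vcod_id.
- exact: (a_hs_idh HK).
- exact: (a_ht_idh HK).
- rewrite (a_vs_idh HK); have := a_ht_chain HK (uval eta).
  by rewrite e2 e3 vcod_id => -[-> _].
- rewrite (a_vt_idh HK); have := a_ht_chain HK (uval eta).
  by rewrite e2 e4 vcod_id => -[_ ->].
- by have := aT_idl_tgt HK (uval eta); rewrite e2 => -[].
- by have := aT_idl_tgt HK (uval eta); rewrite e2 => -[].
Qed.

Section Umap.
Variables (K L : avdcu) (F : afunctor K L).

Definition U_mc (p : cell (U_obj K)) : cell (U_obj L) :=
  exist (fun p => ht (fst p) = Some (snd p)) (mc F (uval p), mh F (utgt p))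
    (eq_trans (af_ht (af_ax F) (uval p)) (f_equal (option_map (mh F)) (uval_ht p))).

Definition U_map : gmap (U_obj K) (U_obj L) :=
  @Gmap _ (U_obj K) (U_obj L) (mo F) (mv F) (mh F) U_mc.

Lemma U_map_ax : is_ufunctor U_map.
Proof.
have HF := af_ax F; split=> //=; first split=> //=.
- exact: (m_vdom HF).
- exact: (m_vcod HF).
- exact: (m_hdom HF).
- exact: (m_hcod HF).
- exact: (m_vid HF).
- exact: (m_vcomp HF).
- by move=> phi; apply: (m_hs HF).
- by move=> phi; apply: (m_vs HF).
- by move=> phi; apply: (m_vt HF).
- move=> psi f phis H H'; apply: ucell_ext.
  have c := U_composable (au_ax K) H.
  transitivity (mc F (aT (uval psi) (upath f phis))).
    exact: (f_equal (mc F) (aTE (U_composable (au_ax K) H))).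
  transitivity (aT (uval (U_mc psi)) (upath (mv F f) (map U_mc phis))); last first.
    by symmetry; apply: (aTE (U_composable (au_ax L) H')).
  rewrite (af_aT HF c); congr aT.
  by case: (phis) => [|phi l] /=; rewrite ?(af_idv HF) // !map_map.
- by move=> J; apply: ucell_ext; rewrite /uval /= (af_idh HF).
Qed.

Lemma U_map_normal : is_normal U_map.
Proof.
have HF := af_ax F.
move=> A eta /U_unit_inverse [eps ui]; apply: U_unit.
apply: (@unit_inverse_unit _ (au_ax L) _ _ _ (mc F eps)).
case: (unit_inverse_comp ui) => c1 c2.
case: ui => -[e1 e2 e3 e4] [d1 d2 d3 d4] i1 i2; split.
- by split; rewrite /uval /= ?(m_hs HF) ?(af_ht HF) ?(m_vs HF) ?(m_vt HF) -/(uval eta)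
    ?e1 ?e2 ?e3 ?e4 ?(m_vid HF).
- by split; rewrite ?(m_hs HF) ?(af_ht HF) ?(m_vs HF) ?(m_vt HF)
    ?d1 ?d2 ?d3 ?d4 ?(m_vid HF).
- by have := af_aT HF c1; rewrite i1 (af_idv HF) (m_vid HF).
- by have := af_aT HF c2; rewrite i2 (af_idh HF).
Qed.

Definition U_functor : nfunctor (U_obj K) (U_obj L) :=
  Nfunctor U_map_ax U_map_normal.
End Umap.

Section Utransf.
Variables (K L : avdcu) (F G : afunctor K L) (x : atransf F G).

Definition U_tmap : tmap (U_obj K) (U_obj L) :=
  @Tmap _ (U_obj K) (U_obj L) (xo x)
    (fun J => exist (fun p => ht (fst p) = Some (snd p)) (xh x J, mh G J)
                (at_ht (at_ax x) J)).

Lemma U_tmap_ax : is_utransf (U_map F) (U_map G) U_tmap.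
Proof.
have Hx := at_ax x; split=> //=; first split=> //=.
- exact: (x_vdom Hx).
- exact: (x_vcod Hx).
- exact: (x_nat Hx).
- exact: (x_hs Hx).
- exact: (x_vs Hx).
- exact: (x_vt Hx).
move=> phi H H'; apply: ucell_ext; rewrite /uval /= !aTE.
have := at_aT (au_ax K) (au_ax L) (af_ax F) (af_ax G) Hx (uval phi).
rewrite {1}/xtgt uval_ht => <-; congr aT.
by rewrite /xpath; case: (hs (uval phi)) => [|J Js] //=; rewrite map_map.
Qed.

Definition U_transf : utransf (U_functor F) (U_functor G) :=
  @Utransf _ _ (U_functor F) (U_functor G) U_tmap U_tmap_ax.
End Utransf.

Definition U : strict2functor AugVirtDblCat_u VirtDblCat_u.
Proof.
refine (@Strict2functor AugVirtDblCat_u VirtDblCat_u U_obj U_functor U_transf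
  _ _ _ _ _).
- move=> K; apply: nfunctor_ext; apply: gmap_ext => //=.
  by apply: functional_extensionality => p; apply: ucell_ext.
- move=> K L M G F; apply: nfunctor_ext; apply: gmap_ext => //=.
  by apply: functional_extensionality => p; apply: ucell_ext.
- move=> K L F; apply: utransf_ext; apply: tmap_ext => //= J.
  exact: ucell_ext.
- move=> K L F G H b a; apply: utransf_ext; apply: tmap_ext => [A|J] /=.
    by rewrite !vTE.
  by apply: ucell_ext; rewrite /uval /= !aTE.
- move=> K L M G G' F F' b a; apply: utransf_tot.
  + apply: nfunctor_ext; apply: gmap_ext => //=.
    by apply: functional_extensionality => p; apply: ucell_ext.
  + apply: nfunctor_ext; apply: gmap_ext => //=.
    by apply: functional_extensionality => p; apply: ucell_ext.
  apply: tmap_ext => [A|J] /=.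
    by rewrite !vTE.
  by apply: ucell_ext; rewrite /uval /= !aTE.
Defined.

Record unit_choice (K : vd_data) : Type := UnitChoice {
  ueta : ob K -> cell K;
  ueta_unit : forall A, u_unit A (ueta A)
}.

Section Ndata.
Variables (K : vd_data) (HK : is_vdc K) (E : unit_choice K).

(** The chosen unit [I_C] is [ht (ueta E C)].  *)
Inductive ncell : Type :=
| ubar (phi : cell K)
| nbar (C : ob K) (psi : cell K) (e : ht psi = ht (ueta E C)).
Arguments nbar C psi e : clear implicits.

Definition nval (phib : ncell) : cell K :=
  match phib with ubar phi => phi | nbar _ psi _ => psi end.

(** [None] stands for the empty path at [vcod (vs psi)], which is [C] for a
    cell [nbar C psi e] because [ht psi = I_C].  *)
Definition nht (phib : ncell) : option (hmor K) :=
  match phib with ubar phi => Some (ht phi) | nbar _ _ _ => None end.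

Definition N_graph : avd_graph :=
  @Graph (fun B => option (hmor B)) K ncell
    (fun phib => hs (nval phib)) nht
    (fun phib => vs (nval phib)) (fun phib => vt (nval phib)).

Definition eta_bar (phib : cell N_graph) : cell K :=
  match phib with ubar phi => uidh (ht phi) | nbar C _ _ => ueta E C end.

(** [psi = psi' o (eta_phi1, .., eta_phin)], where [psi] underlies [psib].  *)
Definition N_factor (psib : cell N_graph) (phibs : list (cell N_graph))
    (psi' : cell K) : Prop :=
  exists H : ucomposable psi' (vid (vdom (vs psib))) (map eta_bar phibs),
    nval psib = ucomp H.

Definition N_is_comp (psib : cell N_graph) (phibs : list (cell N_graph))
    (chib : cell N_graph) : Prop :=
  ht chib = ht psib /\
  exists psi' f (H : ucomposable psi' f (map nval phibs)),
    N_factor psib phibs psi' /\ nval chib = ucomp H.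

(** The cell satisfying [N_is_comp]; the default value is [psib].  *)
Definition N_comp (psib : cell N_graph) (phibs : list (cell N_graph))
    (_ : acomposable psib phibs) : cell N_graph :=
  epsilon (inhabits psib) (N_is_comp psib phibs).

Lemma N_idv_composable (f : vmor K) : ucomposable (ueta E (vcod f)) f [].
Proof.
case: (ueta_unit E (vcod f)) => e1 e2 e3 _; exists f; split=> //.
- by rewrite e2 vdom_id.
- by rewrite e3 vdom_id.
Qed.

Definition N_idv (f : vmor K) : cell N_graph :=
  nbar (vcod f) _ (u_ht_comp HK (N_idv_composable f)).

Definition N_data : avd_data :=
  @AvdData N_graph N_comp (fun J => ubar (uidh J)) N_idv.
End Ndata.

(* Main.v *)
(** A unit [eta_A : (A) => I_A] lets a nullary cell [J => C] be recorded as the unary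
    cell [J => I_C] obtained by postcomposing with [eta_C].  Factorisation through a
    path of units and identities is unique (one unit at a time), so a
    composite in [N(K)] is well defined and associativity is inherited from [K].
    A normal functor [F] sends [eta_C] to another unit of [F C], hence there is a
    unique comparison [F I_C => I_(F C)] with which nullary cells are transported;
    all functoriality and naturality laws for it hold because they hold after
    precomposition with [F eta_C].  Conversely, in an augmented virtual double
    category each [eta_C] has a nullary inverse [eps_C : I_C => C], and
    [psi |-> eps_C o psi] is the isomorphism from [N(U(K))] to [K]; the
    isomorphism from [U(N(K))] to [K] only forgets the bars.  *)

Require Import Defs.
From Stdlib Require Import List ProofIrrelevance FunctionalExtensionality
  ClassicalEpsilon.
From Corelib Require Import ssreflect ssrbool.
Import ListNotations.
Set Implicit Arguments.
Unset Strict Implicit.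
Unset Printing Implicit Defensive.
Set Bullet Behavior "None".

(** A path of cells in [N(K)] has two images in [K]: the underlying cells ([nval]) and the units and
    identities at their targets ([eta_bar]). Both have the same horizontal targets. A composite in
    [N(K)] is found by solving for [psi'] against the second image and then composing [psi'] with
    the first. Hence associativity, deletion of vertical identities and compatibility with functors
    each come from using a law of [K] twice, once per image, with the same [psi']. The delicate case
    is the empty path. In [K] it is a bare vertical morphism [f], whereas in [N(K)] it has to be
    filled by the cell [eta o f]; [npath] and [upath] translate between the two conventions.
    Strictness has two sources. Comparisons of units are unique, so they compose on the nose. The
    isomorphisms relating [N] and [U] are identities on objects and on vertical and horizontal
    morphisms, so they leave the components of transformations unchanged. *)

Notation "s ->[ p ] t" := (chain (@vs _ _) (@vt _ _) s p t) (at level 70).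

(** * Factorisation through paths of units and identity cells *)

Section Paths.
Variables (K : vd_data) (HK : is_vdc K).
Implicit Types (phi psi chi e : cell K) (phis es p : list (cell K)) (f g : vmor K).

Lemma path_hs_chain p f g : f ->[p] g ->
  chain (@hdom K) (@hcod K) (vdom f) (flat_map (@hs _ K) p) (vdom g).
Proof.
elim: p f => [|phi p IH] f /=; first by move=> ->.
by case=> <- /IH; apply: chain_cat (u_hs_chain HK phi).
Qed.

Lemma path_ht_chain p f g : f ->[p] g ->
  chain (@hdom K) (@hcod K) (vcod f) (map (@ht _ K) p) (vcod g).
Proof.
elim: p f => [|phi p IH] f /=; first by move=> ->.
by case=> <- /IH; rewrite (u_ht_dom HK) (u_ht_cod HK).
Qed.

(** Used to exchange a path of cells for the path of their units, identities or comparisons: of the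
    vertical morphisms, composability sees only the codomains of the two ends. *)
Lemma ucomposable_path psi f p g f' p' g' : ucomposable psi f p ->
  f ->[p] g -> f' ->[p'] g' -> vcod f' = vcod f -> vcod g' = vcod g ->
  map (@ht _ K) p' = map (@ht _ K) p -> ucomposable psi f' p'.
Proof.
move=> H c c' e1 e2 e3; have [k1 k2] := ucomp_ends H c.
exists g'; split; rewrite ?e1 ?e2 ?e3 //; by case: H => ? [].
Qed.

Lemma upcomp_consT f g psi phis theta psis phiss thetas :
  ucomposable psi f phis -> uT psi f phis = theta -> f ->[phis] g ->
  upcomp g psis phiss thetas ->
  upcomp f (psi :: psis) (phis :: phiss) (theta :: thetas).
Proof.
by move=> H <- c P; rewrite -(uTE H); constructor; rewrite (chain_last c).
Qed.

Lemma upcomp_app f g p1 q1 (t1 : list (cell K)) p2 q2 t2 : upcomp f p1 q1 t1 ->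
  f ->[concat q1] g -> upcomp g p2 q2 t2 ->
  upcomp f (p1 ++ p2) (q1 ++ q2) (t1 ++ t2).
Proof.
move=> P; elim: P => [{}f|{}f psi phis H psis phiss thetas P IH] /=.
  by move=> ->.
move=> c P2; case: (chain_split c) => m [c1 c2]; rewrite (chain_last c1) in P IH.
by constructor; rewrite (chain_last c1); apply: IH.
Qed.

(** Every cell is the identity on its target composed with itself. Together with [upcomp_idr], which
    composes with identities on the sources, this lets associativity act on one member of a path and
    leave the others in place. *)
Lemma upcomp_idl f g phis : f ->[phis] g ->
  upcomp f (map (fun phi => uidh (ht phi)) phis) (map (fun phi => [phi]) phis) phis.
Proof.
elim: phis f => [|phi phis IH] f /=; first by constructor.
case=> <- c; case: (uT_idh HK (eq_refl (ht phi))) => h1 h2.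
by apply: upcomp_consT h1 h2 _ (IH _ c).
Qed.

Definition horizontal e := exists A B, vs e = vid A /\ vt e = vid B.

Lemma upcomp_idr A B es : Forall horizontal es -> vid A ->[es] vid B ->
  upcomp (vid A) es (map (fun e => map (@uidh K) (hs e)) es) es.
Proof.
move=> Hh; elim: Hh A => [|e es' [A0 [B0 [e1 e2]]] _ IH] A /=; first by constructor.
rewrite e1 e2 => -[eA c].
have eA' : A = vdom (vs e) by rewrite e1 eA vdom_id.
case: (uT_idr HK (phi := e) eA' (eq_refl _)) => h1 h2.
have c' : vid A ->[map (@uidh K) (hs e)] vid B0.
  by have := uchain_idh HK (u_hs_chain HK e); rewrite -eA' e2 vdom_id.
exact: upcomp_consT h1 h2 c' (IH _ c).
Qed.

Lemma concat_idr es :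
  concat (map (fun e => map (@uidh K) (hs e)) es) =
  map (@uidh K) (flat_map (@hs _ K) es).
Proof. by elim: es => [//|e es IH] /=; rewrite IH map_app. Qed.

Lemma map_idl Js : map (fun phi => uidh (ht phi)) (map (@uidh K) Js) = map (@uidh K) Js.
Proof. by rewrite map_map; apply: map_ext => J; rewrite (u_ht_idh HK). Qed.

Definition idunit e := (exists J, e = uidh J) \/ exists A, u_unit A e.

Lemma idunit_horizontal e : idunit e -> horizontal e.
Proof.
case=> [[J ->]|[A [_ e2 e3 _]]]; last by exists A, A.
by exists (hdom J), (hcod J); rewrite (u_vs_idh HK) (u_vt_idh HK).
Qed.

Lemma unit_ht_ends A e : u_unit A e -> hdom (ht e) = A /\ hcod (ht e) = A.
Proof.
by case=> _ e1 e2 _; rewrite (u_ht_dom HK) (u_ht_cod HK) e1 e2 vcod_id.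
Qed.

Definition factors chi es chi' :=
  ucomposable chi' (vid (vdom (vs chi))) es /\
  chi = uT chi' (vid (vdom (vs chi))) es.

Lemma factors_bd chi es chi' : vid (vdom (vs chi)) ->[es] vid (vdom (vt chi)) ->
  factors chi es chi' ->
  [/\ hs chi' = map (@ht _ K) es, ht chi' = ht chi, vs chi' = vs chi & vt chi' = vt chi].
Proof.
move=> c [H e]; case: (ucomp_ends H c); rewrite !vcod_id => e1 e2.
split; first by case: H => ? [].
- by rewrite [in RHS]e uT_ht.
- by rewrite [in RHS]e uT_vs // vT_idr.
- by rewrite [in RHS]e (uT_vt HK H c) vT_idr.
Qed.

(** Associativity, applied to [eta] as an identity composed with [eta] and to each cell of [es]
    composed with identities. Composition with [eta :: es] thus splits into two stages, the second
    involving [eta] alone, where the universal property of a single unit applies. *)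
Lemma uT_unit_split chi' a J' eta A es b : u_unit A eta -> Forall horizontal es ->
  vid a ->[map (@uidh K) J'] vid A -> vid A ->[es] vid b ->
  ucomposable chi' (vid a) (map (@uidh K) J' ++ uidh (ht eta) :: es) ->
  let chi1 := uT chi' (vid a) (map (@uidh K) J' ++ uidh (ht eta) :: es) in
  let rest := map (@uidh K) J' ++ eta :: map (@uidh K) (flat_map (@hs _ K) es) in
  [/\ ucomposable chi' (vid a) (map (@uidh K) J' ++ eta :: es),
      ucomposable chi1 (vid a) rest &
      uT chi' (vid a) (map (@uidh K) J' ++ eta :: es) = uT chi1 (vid a) rest].
Proof.
move=> u Hes c1 c2 H; case: (u) => k1 k2 k3 _.
have [k4 k5] := unit_ht_ends u.
have P : upcomp (vid a) (map (@uidh K) J' ++ uidh (ht eta) :: es)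
  (map (fun phi => [phi]) (map (@uidh K) J') ++
     [eta] :: map (fun e => map (@uidh K) (hs e)) es)
  (map (@uidh K) J' ++ eta :: es).
  apply: (@upcomp_app _ (vid A)).
  - by have := upcomp_idl c1; rewrite map_idl.
  - by rewrite concat_single.
  - case: (uT_idh HK (eq_refl (ht eta))); rewrite k2 => h1 h2.
    by apply: upcomp_consT h1 h2 _ (upcomp_idr Hes c2); rewrite /= k3.
have c : vid a ->[concat (map (fun phi => [phi]) (map (@uidh K) J') ++
     [eta] :: map (fun e => map (@uidh K) (hs e)) es)] vid b.
  rewrite concat_app /= concat_single concat_idr; apply: chain_cat c1 _.
  split=> //; rewrite k3; apply: (uchain_idh HK).
  by have := path_hs_chain c2; rewrite !vdom_id.
case: (uTA HK P H _ c); first by rewrite vcod_id vdom_id.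
by rewrite concat_app /= concat_single concat_idr vT_idl ?vcod_id.
Qed.

(** Induction on [es]; the prefix [J'] collects the cells already turned into identities. A unit [e]
    at the head is treated by factoring [chi] through [e] alone, which gives [chi1], and then
    factoring [chi1] through the remaining cells. *)
Lemma factor_path_from es : Forall idunit es -> forall J' chi,
  vid (vdom (vs chi)) ->[map (@uidh K) J' ++ es] vid (vdom (vt chi)) ->
  hs chi = J' ++ flat_map (@hs _ K) es ->
  exists! chi', factors chi (map (@uidh K) J' ++ es) chi'.
Proof.
elim=> [|e es' Ie Ies IH] J' chi c eh.
  rewrite /= !app_nil_r in c eh *.
  case: (uT_idr HK (phi := chi) (eq_refl _) (eq_sym eh)) => h1 h2.
  exists chi; split=> // chi' F; case: (factors_bd c F) => e1 _ e3 _.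
  rewrite map_ht_uidh // in e1; case: F => H ->; rewrite -e3.
  by case: (uT_idr HK (phi := chi') (eq_refl _) (eq_sym e1)).
(* The induction hypothesis once the head has become [uidh J], which is moved to the end of the
   prefix. *)
have IHJ J : vid (vdom (vs chi)) ->[map (@uidh K) (J' ++ [J]) ++ es'] vid (vdom (vt chi)) ->
    forall chi1, vs chi1 = vs chi -> vt chi1 = vt chi ->
    hs chi1 = (J' ++ [J]) ++ flat_map (@hs _ K) es' ->
    exists! chi', factors chi1 (map (@uidh K) J' ++ uidh J :: es') chi'.
  move=> cJ chi1 e1 e2 e3; have := IH (J' ++ [J]) chi1.
  by rewrite e1 e2 [map _ (J' ++ _)]map_app -app_assoc /= => /(_ _ e3); apply; move: cJ;
     rewrite map_app -app_assoc.
case: Ie c eh => [[J ->]|[A u]] c eh.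
  apply: IHJ => //; first by rewrite map_app -app_assoc.
  by rewrite eh /= (u_hs_idh HK) -app_assoc.
have Hes : Forall horizontal es' by apply: Forall_impl Ies => ?; apply: idunit_horizontal.
case: (u) => k1 k2 k3 k4; rewrite /= k1 /= in eh; have [k5 k6] := unit_ht_ends u.
case: (chain_split c) => m [c1 /= [em c2]]; rewrite k2 in em; rewrite -em in c1 => {m em}.
rewrite k3 in c2.
have d1 := path_hs_chain c1; rewrite flat_hs_uidh // !vdom_id in d1.
have d2 := path_hs_chain c2; rewrite !vdom_id in d2.
case: (k4 _ _ _ eh d1 d2) => chi1 [[g1 g2 g3 g4 [H g5]] un].
have cI : vid (vdom (vs chi)) ->[map (@uidh K) (J' ++ [ht e]) ++ es'] vid (vdom (vt chi)).
  rewrite map_app -app_assoc; apply: chain_cat c1 _ => /=.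
  by rewrite (u_vs_idh HK) (u_vt_idh HK) k5 k6.
have cI' := cI; rewrite map_app -app_assoc /= in cI'.
have [|chi' [F un']] := IHJ _ cI chi1 g3 g4; first by rewrite g1 -app_assoc.
case: (F) => F1 F2; rewrite g3 in F1 F2.
case: (uT_unit_split u Hes c1 c2 F1) => h1 h2 h3.
exists chi'; split; first by split=> //; rewrite h3 -F2 -(uTE H).
(* Uniqueness: composing another factorisation [chi2] with an identity in place of [e] must give
   [chi1], by the uniqueness [un] for [e]; then [un'] identifies [chi2] with [chi']. *)
move=> chi2 F'; apply: un'; case: (F') => H2 e2.
have H2' : ucomposable chi2 (vid (vdom (vs chi))) (map (@uidh K) J' ++ uidh (ht e) :: es').
  apply: ucomposable_path H2 c cI' _ _ _ => //.
  by rewrite !map_app /= (u_ht_idh HK).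
case: (uT_unit_split u Hes c1 c2 H2') => l1 l2 l3.
case: (factors_bd c F') => b1 b2 b3 b4.
rewrite /factors g3; split=> //; apply: un; split.
- rewrite uT_hs // flat_map_app /= flat_hs_uidh // (u_hs_idh HK) //.
- by rewrite uT_ht.
- by rewrite uT_vs // b3 vT_idr.
- by rewrite (uT_vt HK H2' cI') b4 vT_idr.
by exists l2; rewrite uTE -l3.
Qed.

Lemma factor_path es chi : Forall idunit es ->
  vid (vdom (vs chi)) ->[es] vid (vdom (vt chi)) ->
  hs chi = flat_map (@hs _ K) es -> exists! chi', factors chi es chi'.
Proof. by move=> Ies c eh; apply: (factor_path_from (J' := []) Ies). Qed.

(** Both cells are factorisations of their common composite. This cancellation is the tool for every
    equation between comparisons below. *)
Lemma factors_uniq es a b chi1 chi2 : Forall idunit es -> vid a ->[es] vid b ->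
  ucomposable chi1 (vid a) es -> ucomposable chi2 (vid a) es ->
  uT chi1 (vid a) es = uT chi2 (vid a) es -> chi1 = chi2.
Proof.
move=> Ies c H1 H2 e.
have [a1 a2] := ucomp_ends H1 c; have v1 := uT_vs HK H1; have v2 := uT_vt HK H1 c.
have w1 : vdom (vs (uT chi1 (vid a) es)) = a by rewrite v1 vT_dom // vdom_id.
have w2 : vdom (vt (uT chi1 (vid a) es)) = b by rewrite v2 vT_dom // vdom_id.
have [||x [_ un]] := factor_path (chi := uT chi1 (vid a) es) Ies.
- by rewrite w1 w2.
- by rewrite uT_hs.
- by rewrite -(un chi1) ?(un chi2) //; rewrite /factors w1.
Qed.
Lemma chain_idl phis f g : f ->[phis] g ->
  vid (vcod f) ->[map (fun phi => uidh (ht phi)) phis] vid (vcod g).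
Proof.
move=> c; rewrite -(map_map (@ht _ K)); exact: (uchain_idh HK (path_ht_chain c)).
Qed.

(** The vertical identity cell of [N(K)] on [m] has the form [uT u m []]. Associativity, with the
    empty path over [m] placed under [u], absorbs it into [psi]. The resulting [w] depends on [p1]
    and [p2] only through their horizontal targets, which [N_idv_del] exploits. *)
Lemma uT_insert psi f m g p1 p2 u C :
  hs u = [] -> vs u = vid C -> vt u = vid C -> vcod m = C ->
  f ->[p1] m -> m ->[p2] g -> ucomposable psi f (p1 ++ uT u m [] :: p2) ->
  let idl := map (fun phi => uidh (ht phi)) in
  let w := uT psi (vid (vcod f)) (idl p1 ++ u :: idl p2) in
  ucomposable w f (p1 ++ p2) /\ uT psi f (p1 ++ uT u m [] :: p2) = uT w f (p1 ++ p2).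
Proof.
move=> u1 u2 u3 em c1 c2 H idl w.
have Hu : ucomposable u m [].
  by exists m; split; rewrite ?u1 ?u2 ?u3 ?vdom_id.
have cu : m ->[[uT u m []]] m.
  by rewrite /= (uT_vs HK Hu) (uT_vt HK Hu (g := m)) // u2 u3 vT_idl.
have P : upcomp f (idl p1 ++ u :: idl p2)
    (map (fun phi => [phi]) p1 ++ [] :: map (fun phi => [phi]) p2)
    (p1 ++ uT u m [] :: p2).
  apply: (upcomp_app (g := m)); first exact: upcomp_idl c1.
    by rewrite concat_single.
  by apply: upcomp_consT Hu _ _ (upcomp_idl c2).
have ec : concat (map (fun phi => [phi]) p1 ++ [] :: map (fun phi => [phi]) p2) = p1 ++ p2.
  by rewrite concat_app /= !concat_single.
have cw : vid (vcod f) ->[idl p1 ++ u :: idl p2] vid (vcod g).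
  apply: chain_cat (chain_idl c1) _ => /=.
  by rewrite u2 u3 em; split=> //; rewrite -em; apply: chain_idl.
have Hw : ucomposable psi (vid (vcod f)) (idl p1 ++ u :: idl p2).
  apply: ucomposable_path H (chain_cat c1 (chain_cat cu c2)) cw _ _ _; rewrite ?vcod_id //.
  rewrite !map_app /= (uT_ht HK Hu) !map_map.
  by congr (_ ++ _ :: _); apply: map_ext => x; rewrite (u_ht_idh HK).
case: (uTA HK P Hw (g := g)); rewrite ?vdom_id //.
  by rewrite ec; apply: chain_cat c1 c2.
by rewrite ec vT_idl.
Qed.

Lemma uTA1_vs chi psi f phis : ucomposable chi (vs psi) [psi] -> ucomposable psi f phis ->
  [/\ ucomposable chi (vs (uT psi f phis)) [uT psi f phis],
      ucomposable (uT chi (vs psi) [psi]) f phis &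
      uT chi (vs (uT psi f phis)) [uT psi f phis] = uT (uT chi (vs psi) [psi]) f phis].
Proof. by move=> H1 H2; rewrite (uT_vs HK H2); apply: uTA1. Qed.

End Paths.

(** * Composition of cells in [N(K)] *)

Section Ncomposition.
Variables (K : vd_data) (HK : is_vdc K) (E : unit_choice K).
Notation N := (N_data HK E).
Notation "s =>[ p ] t" := (chain (@vs _ N) (@vt _ N) s p t) (at level 70).
Implicit Types (phib psib chib : cell N) (phibs : list (cell N)) (f g : vmor K).

Lemma unit_target_ob psi C : ht psi = ht (ueta E C) ->
  C = vcod (vs psi) /\ C = vcod (vt psi).
Proof.
move=> e; have [e1 e2] := unit_ht_ends HK (ueta_unit E C).
by rewrite -(u_ht_dom HK) -(u_ht_cod HK) e e1 e2.
Qed.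

(** The object stored in a nullary cell is no extra datum: [unit_target_ob] recovers it from the
    boundary of the underlying cell. *)
Lemma ncell_ext phib psib : ht phib = ht psib -> nval phib = nval psib -> phib = psib.
Proof.
case: phib => [phi|C phi e]; case: psib => [psi|D psi d] //= _ x; subst psi=> //.
have [eC _] := unit_target_ob e; have [eD _] := unit_target_ob d.
have eDC : D = C by rewrite eD.
by move: d {eD}; rewrite eDC => d; rewrite (proof_irrelevance _ e d).
Qed.

Lemma chain_nval phibs f g :
  (f =>[phibs] g) = (f ->[map (@nval K E) phibs] g).
Proof. by elim: phibs f => [//|x p IH] f /=; rewrite IH. Qed.

Lemma eta_bar_ht phib : ht (eta_bar phib) = ht (nval phib).
Proof. by case: phib => [phi|C psi e] //=; rewrite (u_ht_idh HK). Qed.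

Lemma eta_bar_hs phib : hs (eta_bar phib) = olist (ht phib).
Proof.
case: phib => [phi|C psi e] /=; first by rewrite (u_hs_idh HK).
by case: (ueta_unit E C).
Qed.

Lemma eta_bar_vs phib : vs (eta_bar phib) = vid (vcod (vs phib)).
Proof.
case: phib => [phi|C psi e] /=; first by rewrite (u_vs_idh HK) (u_ht_dom HK).
by have [<- _] := unit_target_ob e; case: (ueta_unit E C).
Qed.

Lemma eta_bar_vt phib : vt (eta_bar phib) = vid (vcod (vt phib)).
Proof.
case: phib => [phi|C psi e] /=; first by rewrite (u_vt_idh HK) (u_ht_cod HK).
by have [_ <-] := unit_target_ob e; case: (ueta_unit E C).
Qed.

(** The hypothesis on codomains identifies the objects in the nullary case, where the target is
    merely [None]. *)
Lemma eta_bar_eq phib psib : ht phib = ht psib -> vcod (vs phib) = vcod (vs psib) ->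
  eta_bar phib = eta_bar psib.
Proof.
case: phib => [phi|C phi e]; case: psib => [psi|D psi d] //=; first by case=> ->.
by have [<- _] := unit_target_ob e; have [<- _] := unit_target_ob d => _ ->.
Qed.

Lemma eta_bar_idunit phibs : Forall (@idunit K) (map (@eta_bar K E) phibs).
Proof.
elim: phibs => [|[phi|C psi e] phibs IH] /=; constructor=> //.
  by left; exists (ht phi).
by right; exists C; apply: ueta_unit.
Qed.

Lemma eta_bar_chain phibs f g : f =>[phibs] g ->
  vid (vcod f) ->[map (@eta_bar K E) phibs] vid (vcod g).
Proof.
by apply: (chain_map (k := fun f => vid (vcod f))) => x; [apply: eta_bar_vs|apply: eta_bar_vt].
Qed.

Lemma map_eta_bar_ht phibs :
  map (@ht _ K) (map (@eta_bar K E) phibs) = map (@ht _ K) (map (@nval K E) phibs).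
Proof. by rewrite !map_map; apply: map_ext => x; apply: eta_bar_ht. Qed.

Lemma map_eta_bar_hs phibs :
  flat_map (@hs _ K) (map (@eta_bar K E) phibs) =
  flat_map (fun phib => olist (ht phib)) phibs.
Proof. by elim: phibs => [//|x l IH] /=; rewrite IH eta_bar_hs. Qed.

Lemma N_factorE psib phibs psi' :
  N_factor psib phibs psi' <-> factors (nval psib) (map (@eta_bar K E) phibs) psi'.
Proof.
split=> [[H e]|[H e]]; first by split=> //; rewrite -(uTE H).
by exists H; rewrite uTE.
Qed.

Lemma eta_bar_path psib phibs f g : acomposable psib phibs -> f =>[phibs] g ->
  vid (vdom (vs (nval psib))) ->[map (@eta_bar K E) phibs] vid (vdom (vt (nval psib))).
Proof.
move=> H c; case: (acomp_ends H c) => e1 e2.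
by move: (eta_bar_chain c); rewrite e1 e2.
Qed.

Lemma N_factor_exists psib phibs : acomposable psib phibs ->
  exists! psi', N_factor psib phibs psi'.
Proof.
move=> H; case: (H) => _ [f [g [c _ _ e]]].
have [x [F un]] := factor_path HK (eta_bar_idunit phibs) (eta_bar_path H c)
  (eq_trans e (eq_sym (map_eta_bar_hs phibs))).
by exists x; split=> [|x' F']; [apply/N_factorE|apply: un; apply/N_factorE].
Qed.

Lemma N_factor_composable psib phibs psi' f g : acomposable psib phibs ->
  f =>[phibs] g -> N_factor psib phibs psi' ->
  ucomposable psi' f (map (@nval K E) phibs).
Proof.
move=> H c /N_factorE [H' _]; have ce := eta_bar_path H c.
have [e1 e2] := acomp_ends H c; rewrite chain_nval in c.
by apply: ucomposable_path H' ce c _ _ _; rewrite ?vcod_id ?map_eta_bar_ht.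
Qed.

(** Since [N_comp] is chosen by [epsilon], a witness is required, of the same kind as [psib]. In the
    nullary case the composite in [K] keeps the target [I_C], so it can again be barred as a nullary
    cell. *)
Lemma N_comp_spec psib phibs (H : acomposable psib phibs) :
  N_is_comp psib phibs (@acomp N psib phibs H).
Proof.
apply: epsilon_spec; have [psi' [F _]] := N_factor_exists H.
case: (H) => _ [f [g [c _ _ _]]].
have Hf := N_factor_composable H c F; case/N_factorE: (F) => H' e.
have ehs : ht (uT psi' f (map (@nval K E) phibs)) = ht (nval psib).
  by rewrite uT_ht // e uT_ht.
case: psib {H} e ehs F H' => [psi|C psi d] /= e ehs F H'.
  exists (ubar E (uT psi' f (map (@nval K E) phibs))); split=> /=; first by rewrite ehs.
  by exists psi', f, Hf; rewrite uTE.
exists (nbar (eq_trans ehs d)); split=> //=.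
by exists psi', f, Hf; rewrite uTE.
Qed.

Lemma N_compE psib phibs (H : acomposable psib phibs) : N_comp H = aT psib phibs.
Proof. exact: (@aTE N _ _ H). Qed.

(** The working form of the definition: by uniqueness of factorisations, any [psi'] computes the
    composite selected by [epsilon]. *)
Lemma N_aT psib phibs f g psi' : acomposable psib phibs -> f =>[phibs] g ->
  factors (nval psib) (map (@eta_bar K E) phibs) psi' ->
  nval (aT psib phibs) = uT psi' f (map (@nval K E) phibs).
Proof.
move=> H c /N_factorE F; rewrite -(aTE H).
case: (N_comp_spec H) => _ [psi2 [f' [H2 [F2 ->]]]]; rewrite uTE.
have [x [_ un]] := N_factor_exists H; rewrite -(un _ F) -(un _ F2).
have [g' [c' _ _ _]] := H2; rewrite chain_nval in c.
(* A non-empty path determines its vertical source, so the [f'] supplied by [N_is_comp] is [f]. *)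
have nz : map (@nval K E) phibs <> [] by case: H => nz _ /map_eq_nil /nz.
by case: (chain_funl nz c c') => -> _.
Qed.

Lemma N_aT_ht psib phibs : acomposable psib phibs -> ht (aT psib phibs) = ht psib.
Proof. by move=> H; rewrite -(aTE H); case: (N_comp_spec H). Qed.

Lemma N_factorP psib phibs f g : acomposable psib phibs -> f =>[phibs] g ->
  exists psi', [/\ factors (nval psib) (map (@eta_bar K E) phibs) psi',
    ucomposable psi' f (map (@nval K E) phibs),
    vs psi' = vs psib & vt psi' = vt psib].
Proof.
move=> H c; have [x [F _]] := N_factor_exists H; exists x.
have Hf := N_factor_composable H c F; move/N_factorE: F => F.
by case: (factors_bd HK (eta_bar_path H c) F).
Qed.

Lemma N_idv_val f : nval (N_idv HK E f) = uT (ueta E (vcod f)) f [].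
Proof. by rewrite /= uTE. Qed.

Lemma N_idv_bd f : [/\ hs (N_idv HK E f) = [], vs (N_idv HK E f) = f & vt (N_idv HK E f) = f].
Proof.
have H := N_idv_composable E f; case: (ueta_unit E (vcod f)) => _ e1 e2 _.
rewrite /= !uTE (uT_hs HK H) (uT_vs HK H) (uT_vt HK (g := f) H) // e1 e2.
by rewrite vT_idl.
Qed.

(** The path of cells of [N] denoted by a path of cells of [K].  *)
Definition npath f (phis : list (cell K)) : list (cell N) :=
  match phis with [] => [N_idv HK E f : cell N] | _ => map (ubar E) phis end.

Lemma npath_chain f phis g : f ->[phis] g -> f =>[npath f phis] g.
Proof.
case: phis => [|phi phis] /=; first by case: (N_idv_bd f) => /= _ -> ->.
by move=> c; rewrite chain_nval map_map map_id.
Qed.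

Lemma npath_tgt f phis :
  flat_map (fun phib : cell N => olist (ht phib)) (npath f phis) = map (@ht _ K) phis.
Proof.
by case: phis => [//|phi phis]; rewrite /npath; elim: (phi :: phis) => [//|x l IH] /=; rewrite IH.
Qed.

Lemma npath_composable psib f phis : ucomposable (nval psib) f phis ->
  acomposable psib (npath f phis).
Proof.
case=> g [c e1 e2 e3]; split; first by case: (phis).
by exists f, g; split=> //; [apply: npath_chain|rewrite npath_tgt].
Qed.

(** On a non-empty path of unary cells all [eta_bar] are identities, so [psi'] is [psi]. For the
    empty path over [f], [psi' o (eta o f) = (psi' o eta) o f = psi o f]. Composing with unary cells
    is therefore done as in [K]. *)
Lemma N_aT_npath psib f phis : ucomposable (nval psib) f phis ->
  nval (aT psib (npath f phis)) = uT (nval psib) f phis.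
Proof.
move=> H; have H' := npath_composable H; have [g [c _ _ _]] := H.
have c' := npath_chain c; have [psi' [F Hf ev _]] := N_factorP H' c'.
rewrite (N_aT H' c' F).
case: phis H H' c c' F Hf => [|phi phis] H H' c c' F Hf.
  have -> : map (@nval K E) (npath f []) = [uT (ueta E (vcod f)) f []] by rewrite /= uTE.
  have [g' [_ ed _ _]] := H; case: F; rewrite -ed /= => F1 ->.
  case: (uTA1 HK F1 (N_idv_composable E f)) => _ _ <-.
  by rewrite vT_idl.
case: F => F1 ->.
have -> : map (@eta_bar K E) (npath f (phi :: phis)) = map (@uidh K) (hs psi').
  case: F1 => ? [_ _ _ ->]; rewrite /npath !map_map; apply: map_ext => x /=.
  by rewrite (u_ht_idh HK).
rewrite -[vs (nval psib)]ev.
case: (uT_idr HK (phi := psi') (eq_refl _) (eq_refl _)) => _ ->.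
by rewrite /npath map_map map_id.
Qed.
End Ncomposition.

(** * The axioms and the horizontal units of [N(K)] *)

Section Navdc.
Variables (K : vd_data) (HK : is_vdc K) (E : unit_choice K).
Notation N := (N_data HK E).
Notation "s =>[ p ] t" := (chain (@vs _ N) (@vt _ N) s p t) (at level 70).
Implicit Types (phib psib chib : cell N) (phibs psibs : list (cell N)) (f g p q : vmor K).

(** Composing with cells that are their own [eta_bar] undoes the factorisation. Horizontal
    identities and the vertical identity on [vid A] are of this kind, which gives both right
    identity laws. *)
Lemma N_aT_idr psib phibs a g : acomposable psib phibs ->
  vid a =>[phibs] g -> map (@nval K E) phibs = map (@eta_bar K E) phibs ->
  aT psib phibs = psib.
Proof.
move=> H c e; apply: ncell_ext; first exact: (N_aT_ht H).
have [psi' [F _ _ _]] := N_factorP H c; have [ea _] := acomp_ends H c.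
rewrite (N_aT H c F) e; case: F => _ ->; rewrite vcod_id in ea.
by rewrite -[vs (nval psib)]/(vs psib) -ea.
Qed.

Lemma N_aT1 psib phib psi' : acomposable psib [phib] ->
  factors (nval psib) [eta_bar phib] psi' ->
  nval (aT psib [phib]) = uT psi' (vs phib) [nval phib].
Proof. by move=> H; apply: (N_aT H (g := vt phib)). Qed.

(** The factorisations [psis'] of the [psibs] serve twice: composed with the units they return the
    [psibs], composed with the underlying cells they give the [thetabs]. *)
Lemma N_apcomp psibs phibss thetabs f g p q :
  apcomp psibs phibss thetabs -> f =>[concat phibss] g -> p =>[psibs] q ->
  exists psis' : list (cell K),
    [/\ upcomp (vid (vcod f)) psis' (map (map (@eta_bar K E)) phibss)
          (map (@nval K E) psibs),
        upcomp f psis' (map (map (@nval K E)) phibss) (map (@nval K E) thetabs),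
        p ->[psis'] q,
        map (@ht _ K) psis' = map (@ht _ K) (map (@nval K E) psibs) &
        map (@eta_bar K E) thetabs = map (@eta_bar K E) psibs].
Proof.
move=> P; elim: P f p => [|psib phibs H psibs' phibss' thetabs' P IH] f p /=.
  by move=> _ <-; exists []; split=> //; constructor.
move=> c [ep cp]; case: (chain_split c) => m [c1 c2].
have [psis' [h1 h2 h3 h4 h5]] := IH _ _ c2 cp.
have [psi' [F Hf e1 e2]] := N_factorP H c1.
have ce := eta_bar_path H c1; have [a1 a2] := acomp_ends H c1.
have [b1 b2 _ _] := factors_bd HK ce F.
exists (psi' :: psis'); split=> /=.
- case: F; rewrite -[vs (nval psib)]/(vs psib) -a1 => F1 F2.
  apply: upcomp_consT (eq_sym F2) (eta_bar_chain c1) h1; exact: F1.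
- rewrite N_compE (N_aT H c1 F).
  by apply: (upcomp_consT (g := m)) => //; rewrite -chain_nval.
- by rewrite e1 e2.
- by rewrite b2 h4.
- rewrite h5; congr cons; apply: eta_bar_eq.
    by rewrite N_compE N_aT_ht.
  rewrite N_compE /= (N_aT H c1 F) (uT_vs HK Hf) vT_cod ?e1 //.
Qed.

Lemma factors_idh (e : cell K) A : vs e = vid A -> factors e [e] (uidh (ht e)).
Proof.
move=> ev; case: (uT_idh HK (eq_refl (ht e))).
by rewrite /factors ev vdom_id.
Qed.

Lemma N_idv_id A : nval (N_idv HK E (vid A)) = ueta E A.
Proof.
rewrite N_idv_val vcod_id; case: (ueta_unit E A) => e1 e2 _ _.
by case: (uT_idr HK (phi := ueta E A) (A := A) (Js := [])); rewrite ?e1 ?e2 ?vdom_id.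
Qed.

Lemma N_aT_idv psib f : acomposable psib [N_idv HK E f] ->
  nval (aT psib [N_idv HK E f]) = uT (nval psib) f [].
Proof.
move=> H; apply: (N_aT_npath (phis := [])).
case: (acomposable1P H) => e1 e2 e3.
have [_ v1 v2] := N_idv_bd HK E f; rewrite v1 v2 in e1 e2.
by exists f.
Qed.

(** Here [psib] factors through [eta_bar phib] as an identity cell; this covers both left identity
    laws. *)
Lemma N_aT_idl phib psib : acomposable psib [phib] ->
  nval psib = eta_bar phib -> nval (aT psib [phib]) = nval phib.
Proof.
move=> H e; have F : factors (nval psib) [eta_bar phib] (uidh (ht (nval psib))).
  by rewrite e; apply: factors_idh (eta_bar_vs phib).
rewrite (N_aT1 H F) e eta_bar_ht.
by case: (uT_idh HK (eq_refl (ht (nval phib)))).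
Qed.

(** If [chi'] factors [chib] and [psis'] factor the [psibs], then [chi' o psis'] factors
    [aT chib psibs] through the units of the whole path. Composing it with the underlying cells
    gives [chi'] composed with the [thetabs], and [chi'] also factors [chib] through the units of
    the [thetabs], which are those of the [psibs]. *)
Lemma N_assoc chib psibs phibss thetabs : apcomp psibs phibss thetabs ->
  acomposable chib thetabs -> acomposable chib psibs ->
  acomposable (aT chib psibs) (concat phibss) ->
  aT chib thetabs = aT (aT chib psibs) (concat phibss).
Proof.
move=> P H1 H2 H3; apply: ncell_ext; first by rewrite !N_aT_ht.
have [_ [f [g [c e1 e2 _]]]] := H3; have [_ [p [q [cp e3 e4 _]]]] := H2.
have [psis' [P1 P2 c' e5 e6]] := N_apcomp P c cp.
have [chi' [F Hp _ _]] := N_factorP H2 cp.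
have efp : vcod f = vdom p.
  by rewrite e1 /= (N_aT H2 cp F) (uT_vs HK Hp) vT_dom //; case: Hp => ? [].
have Hs : ucomposable chi' p psis'.
  by rewrite chain_nval in cp; apply: ucomposable_path Hp cp c' _ _ _.
have c1 := c; rewrite chain_nval concat_map in c1.
case: (uTA HK P2 Hs efp c1) => a1 a2 a3.
have ev : vcod (vid (vcod f)) = vdom p by rewrite vcod_id.
have c2 := eta_bar_chain c; rewrite concat_map in c2.
case: (uTA HK P1 Hs ev c2); rewrite vT_idr // => b1 b2 b3.
have F2 : factors (nval (aT chib psibs)) (map (@eta_bar K E) (concat phibss))
            (uT chi' p psis').
  rewrite /factors (N_aT H2 cp F) b3 concat_map.
  suff -> : vdom (vs (uT (uT chi' p psis') (vid (vcod f))
              (concat (map (map (@eta_bar K E)) phibss)))) = vcod f by split.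
  by rewrite -b3 (uT_vs HK Hp) vT_dom //; case: Hp => ? [].
rewrite (N_aT H3 c F2) concat_map -a3.
have [r [cr _ _ _]] := a1; rewrite -chain_nval in cr.
by apply: (N_aT H1 cr); rewrite e6.
Qed.

(** [uT_insert] is applied to the path of underlying cells and to the path of units. Both times the
    same [w] results, so [w] is the factorisation that computes the shorter composite. *)
Lemma N_idv_del psib phibs1 f phibs2 :
  acomposable psib (phibs1 ++ N_idv HK E f :: phibs2) ->
  acomposable psib (phibs1 ++ phibs2) ->
  aT psib (phibs1 ++ N_idv HK E f :: phibs2) = aT psib (phibs1 ++ phibs2).
Proof.
move=> H1 H2; apply: ncell_ext; first by rewrite !N_aT_ht.
have [_ [p [q [c _ _ _]]]] := H1.
case: (chain_split c) => m [c1 [em c2]].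
have [_ v1 v2] := N_idv_bd HK E f; rewrite v1 in em; rewrite v2 in c2; subst m.
have [psi' [F Hf _ _]] := N_factorP H1 c; rewrite (N_aT H1 c F).
have [u1 u2 u3 _] := ueta_unit E (vcod f).
have d1 := c1; rewrite chain_nval in d1; have d2 : f ->[map (@nval K E) phibs2] q.
  by rewrite -chain_nval.
have em : map (@nval K E) (phibs1 ++ N_idv HK E f :: phibs2) =
    map (@nval K E) phibs1 ++ uT (ueta E (vcod f)) f [] :: map (@nval K E) phibs2.
  by rewrite map_app /= uTE.
rewrite em in Hf *.
case: (uT_insert HK u1 u2 u3 (eq_refl _) d1 d2 Hf) => h1 h2.
have [ep eq] := acomp_ends H1 c.
case: F; rewrite map_app -[vs (nval psib)]/(vs psib) -ep => F1 F2.
(* The unit is rewritten as [eta o id] so that [uT_insert] also fits the path of units. *)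
have eu : uT (ueta E (vcod f)) (vid (vcod f)) [] = ueta E (vcod f).
  by rewrite -[RHS]N_idv_id N_idv_val vcod_id.
have l1 := eta_bar_chain c1; have l2 := eta_bar_chain c2.
rewrite [map _ (_ :: _)]/= -eu in F1 F2.
have ev : vcod (vid (vcod f)) = vcod f by rewrite vcod_id.
case: (uT_insert HK u1 u2 u3 ev l1 l2 F1) => k1 k2.
have ei phibs : map (fun phi : cell K => uidh (ht phi)) (map (@eta_bar K E) phibs) =
                map (fun phi : cell K => uidh (ht phi)) (map (@nval K E) phibs).
  by rewrite !map_map; apply: map_ext => x; rewrite eta_bar_ht.
rewrite vcod_id !ei in k1 k2.
rewrite h2 -map_app; symmetry; apply: (N_aT H2 (chain_cat c1 c2)).
rewrite /factors -[vs (nval psib)]/(vs psib) -ep map_app; split=> //.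
by rewrite F2.
Qed.

Lemma N_avdc : is_avdc N.
Proof.
have spec psib phibs (H : acomposable psib phibs) : exists f g psi',
    [/\ f =>[phibs] g, ucomposable psi' f (map (@nval K E) phibs),
        vs psi' = vs psib, vt psi' = vt psib &
        nval (@acomp N psib phibs H) = uT psi' f (map (@nval K E) phibs)].
  have [_ [f [g [c _ _ _]]]] := H; have [psi' [F Hf e1 e2]] := N_factorP H c.
  by exists f, g, psi'; split=> //; rewrite aTE (N_aT H c F).
split.
- by move=> phib; apply: (u_hs_chain HK).
- case=> [phi|C psi e] /=; first by rewrite (u_ht_dom HK) (u_ht_cod HK).
  by have [<- <-] := unit_target_ob HK e.
- move=> psib phibs H; have [f [g [psi' [c Hf e1 e2 e3]]]] := spec _ _ H.
  by rewrite /= e3 (uT_hs HK Hf) flat_map_concat_map map_map -flat_map_concat_map.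
- by move=> psib phibs H; rewrite aTE N_aT_ht.
- move=> psib phibs H f g c e; have [f' [g' [psi' [c' Hf e1 e2 e3]]]] := spec _ _ H.
  have [nz _] := H; case: (chain_funl nz c c') => ? ?; subst f' g'.
  by rewrite /= e3 (uT_vs HK Hf) e1 vTE.
- move=> psib phibs H f g c e; have [f' [g' [psi' [c' Hf e1 e2 e3]]]] := spec _ _ H.
  have [nz _] := H; case: (chain_funl nz c c') => ? ?; subst f' g'.
  by rewrite chain_nval in c; rewrite /= e3 (uT_vt HK Hf c) e2 vTE.
- exact: (u_hs_idh HK).
- by move=> J /=; rewrite (u_ht_idh HK).
- exact: (u_vs_idh HK).
- exact: (u_vt_idh HK).
- by move=> f; case: (N_idv_bd HK E f).
- by [].
- by move=> f; case: (N_idv_bd HK E f).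
- by move=> f; case: (N_idv_bd HK E f).
- move=> h f e H; apply: ncell_ext.
    by rewrite aTE N_aT_ht.
  rewrite aTE (N_aT_idv H) [aidv h]/= [aidv _]/= !N_idv_val vcod_comp vTE.
  have He := N_idv_composable E h.
  by case: (uTA0 HK He e).
- by move=> chib psibs phibss thetabs P H1 H2 H3; rewrite !aTE; rewrite aTE in H3;
    apply: N_assoc.
- move=> C phib H; rewrite aTE.
  have [e1 e2 e3] := acomposable1P H.
  case: phib e1 e2 e3 H => [phi|D psi e] e1 e2 e3 H.
    by move: e3 => /=; case: (N_idv_bd HK E (vid C)) => /= ->.
  apply: ncell_ext; first by rewrite N_aT_ht.
  apply: N_aT_idl => //; rewrite N_idv_id /=; congr ueta.
  have [-> _] := unit_target_ob HK e; rewrite e1.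
  by case: (N_idv_bd HK E (vid C)) => _ -> _; rewrite vdom_id.
- move=> J phib H; rewrite aTE; have [e1 e2 e3] := acomposable1P H.
  case: phib e1 e2 e3 H => [phi|D psi e] e1 e2; rewrite /= (u_hs_idh HK) //.
  case=> e3 H; apply: ncell_ext; first by rewrite N_aT_ht //= (u_ht_idh HK) e3.
  by apply: N_aT_idl => //=; rewrite e3.
- move=> A phib H; rewrite aTE.
  apply: (N_aT_idr (a := A) (g := vid A) H) => /=.
    by case: (N_idv_bd HK E (vid A)) => _ /= -> ->.
  by have /= -> := N_idv_id A; rewrite vcod_id.
- move=> phib Js H; rewrite aTE; have [nz [f [g [c e1 e2 e3]]]] := H.
  apply: (N_aT_idr (a := vcod f) (g := g) H); last first.
    by rewrite !map_map; apply: map_ext => J /=; rewrite (u_ht_idh HK).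
  case: (Js) nz c => [//|J Js'] _ /= [<- c]; split=> //.
  by rewrite (u_vs_idh HK) vcod_id.
by move=> psib phibs1 f phibs2 H1 H2; rewrite !aTE; apply: N_idv_del.
Qed.

Lemma N_lift chib chi' : ht chi' = ht (nval chib) ->
  exists chib', nval chib' = chi' /\ ht chib' = ht chib.
Proof.
case: chib => [chi|C chi d] /= e; first by exists (ubar E chi'); rewrite /= e.
by exists (nbar (eq_trans e d)).
Qed.

(** The path in the universal property consists of unary cells, so [N_aT_npath] reduces the
    factorisation to the one in [K]; [N_lift] bars the result as unary or nullary according to
    [chib]. *)
Lemma N_unit A eta : u_unit A eta -> @a_unit N A (ht eta) (ubar E eta).
Proof.
case=> e1 e2 e3 u; split=> // J' J'' chib h1 h2 h3.
have [chi' [[g1 g2 g3 g4 [H g5]] un]] := u _ _ _ h1 h2 h3.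
have ep f : map (@aidh N) J' ++ ubar E eta :: map (@aidh N) J'' =
    npath HK E f (map (@uidh K) J' ++ eta :: map (@uidh K) J'').
  have -> : npath HK E f (map (@uidh K) J' ++ eta :: map (@uidh K) J'') =
      map (ubar E) (map (@uidh K) J' ++ eta :: map (@uidh K) J'') by case: (J').
  by rewrite map_app /= !map_map.
pose a : vmor K := vid (vdom (vs (nval chib))).
have [chib' [k1 k2]] := N_lift g2.
exists chib'; split.
  split=> //=; rewrite ?k1 //.
  rewrite (ep a).
  have H' : ucomposable (nval chib') a (map (@uidh K) J' ++ eta :: map (@uidh K) J'').
    by rewrite k1.
  exists (npath_composable H'); rewrite N_compE; apply: ncell_ext.
    by rewrite N_aT_ht //; apply: npath_composable.
  by rewrite N_aT_npath // g5 uTE k1.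
move=> chib2 [l1 l2 l3 l4 [H2 l5]].
(* For nullary cells the equality of targets only says [None = None]; that the units in [K] agree
   comes from the equal vertical sources. *)
have n2 : ht (nval chib2) = ht (nval chib).
  case: (chib2) (chib) l2 l3 => [phi|C phi d] [psi|D psi d'] //=; first by case.
  rewrite d d' => _ ev; have [-> _] := unit_target_ob HK d.
  by have [-> _] := unit_target_ob HK d'; rewrite ev.
have [_ [f [g [c _ _ _]]]] := H2.
apply: ncell_ext; first by rewrite k2 l2.
rewrite k1; apply: un; split=> //.
rewrite -/a.
have H3 : ucomposable (nval chib2) a (map (@uidh K) J' ++ eta :: map (@uidh K) J'').
  have [g' [c' q1 q2 q3]] := H; exists g'; split=> //.
  - by rewrite -[vs (nval chib2)]/(vs chib2) l3 q1 g3.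
  - by rewrite -[vt (nval chib2)]/(vt chib2) l4 q2 g4.
  - by rewrite -q3 g1; exact: l1.
exists H3; rewrite uTE -N_aT_npath // -ep.
by rewrite {1}l5 aTE.
Qed.

Lemma N_has_units : a_has_units N.
Proof.
by move=> A; exists (ht (ueta E A)), (ubar E (ueta E A)); apply: N_unit; apply: ueta_unit.
Qed.
End Navdc.

(** * The action of [N] on normal functors *)

Section Nmap.
Variables (K L : vdcu) (E : unit_choice K) (D : unit_choice L) (F : nfunctor K L).
Notation NK := (N_data (vu_ax K) E).
Notation NL := (N_data (vu_ax L) D).
Let HK := vu_ax K.
Let HL := vu_ax L.
Let HF := nf_ax F.
Implicit Types (phib psib : cell NK) (phibs : list (cell NK)) (f g : vmor K) (C : ob K).

Definition is_ucmp C (i : cell L) :=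
  [/\ ucomposable i (vid (mo F C)) [mc F (ueta E C)],
      hs i = [mh F (ht (ueta E C))], vs i = vid (mo F C), vt i = vid (mo F C) &
      uT i (vid (mo F C)) [mc F (ueta E C)] = ueta D (mo F C)].

Lemma ucmp_exists C : exists i, is_ucmp C i.
Proof.
have u := nf_normal F (ueta_unit E C); have [d1 d2 d3 _] := ueta_unit D (mo F C).
have c1 : chain (@hdom L) (@hcod L) (vdom (vs (ueta D (mo F C)))) [] (mo F C).
  by rewrite /= d2 vdom_id.
have c2 : chain (@hdom L) (@hcod L) (mo F C) [] (vdom (vt (ueta D (mo F C)))).
  by rewrite /= d3 vdom_id.
case: (u) => _ _ _ k; have [i [[e1 e2 e3 e4 [H e5]] _]] := k [] [] _ d1 c1 c2.
rewrite /= (uf_ht HF) in e1; rewrite d2 in e3; rewrite d3 in e4.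
have {}e5 := eq_trans e5 (uTE H).
rewrite /= d2 vdom_id in H; rewrite [RHS]/= d2 vdom_id in e5.
by exists i.
Qed.

(** The comparison [F I_C => I_(F C)].  *)
Definition ucmp C : cell L :=
  proj1_sig (constructive_indefinite_description _ (ucmp_exists C)).

Lemma ucmpP C : is_ucmp C (ucmp C).
Proof. by rewrite /ucmp; case: constructive_indefinite_description. Qed.

Lemma ucmp_uniq C (i : cell L) : ucomposable i (vid (mo F C)) [mc F (ueta E C)] ->
  uT i (vid (mo F C)) [mc F (ueta E C)] = ueta D (mo F C) -> i = ucmp C.
Proof.
move=> H e; have [H' _ _ _ e'] := ucmpP C.
apply: (factors_uniq HL (es := [mc F (ueta E C)]) (b := mo F C) _ _ H H').
- by constructor=> //; right; exists (mo F C); apply: (nf_normal F (ueta_unit E C)).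
- by case: (nf_normal F (ueta_unit E C)) => _ /= -> ->.
- by rewrite e e'.
Qed.

Lemma ucmp_ht C : ht (ucmp C) = ht (ueta D (mo F C)).
Proof. by have [H _ _ _ <-] := ucmpP C; rewrite (uT_ht HL H). Qed.

(** Identities take the role of comparisons at unary cells, so that by [N_mc_val] every cell is sent
    to [cmp phib] composed with its image, without distinction of cases. *)
Definition cmp phib : cell L :=
  match phib with ubar _ phi => uidh (mh F (ht phi)) | @nbar _ _ C _ _ => ucmp C end.

Lemma cmp_bd phib : [/\ hs (cmp phib) = [mh F (ht (nval phib))],
  vs (cmp phib) = vid (mo F (vcod (vs phib))) & vt (cmp phib) = vid (mo F (vcod (vt phib)))].
Proof.
case: phib => [phi|C psi e] /=.
  rewrite (u_hs_idh HL) (u_vs_idh HL) (u_vt_idh HL) (m_hdom HF) (m_hcod HF).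
  by rewrite (u_ht_dom HK) (u_ht_cod HK).
have [e1 e2] := unit_target_ob HK e; rewrite -e1 -e2 e.
by case: (ucmpP C).
Qed.

(** Stated for any [phi] with the target and vertical codomains of [phib], because it is applied to
    [eta_bar phib] and to factorisations of [phib] as well. *)
Lemma cmp_composable phib (phi : cell K) : ht phi = ht (nval phib) ->
  vcod (vs phi) = vcod (vs phib) -> vcod (vt phi) = vcod (vt phib) ->
  ucomposable (cmp phib) (vs (mc F phi)) [mc F phi].
Proof.
move=> e1 e2 e3; have [k1 k2 k3] := cmp_bd phib; apply: ucomposable1 => //.
- by rewrite k2 vdom_id (m_vs HF) (m_vcod HF) e2.
- by rewrite k3 vdom_id (m_vt HF) (m_vcod HF) e3.
- by rewrite k1 (uf_ht HF) e1.
Qed.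

Lemma N_mc_ht C (psi : cell K) (e : ht psi = ht (ueta E C)) :
  ht (uT (ucmp C) (vs (mc F psi)) [mc F psi]) = ht (ueta D (mo F C)).
Proof.
rewrite (uT_ht HL) ?ucmp_ht //.
exact: (@cmp_composable (nbar e) psi).
Qed.

Definition N_mc phib : cell NL :=
  match phib with
  | ubar _ phi => ubar D (mc F phi)
  | @nbar _ _ _ _ e => nbar (N_mc_ht e)
  end.

Definition N_map : gmap NK NL := @Gmap _ NK NL (mo F) (mv F) (mh F) N_mc.

Lemma N_mc_val phib :
  nval (N_mc phib) = uT (cmp phib) (vs (mc F (nval phib))) [mc F (nval phib)].
Proof.
case: phib => [phi|C psi e] //=.
by case: (uT_idh HL (uf_ht HF phi)).
Qed.

Lemma eta_bar_cod phib : vcod (vs (eta_bar phib)) = vcod (vs phib) /\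
  vcod (vt (eta_bar phib)) = vcod (vt phib).
Proof. by rewrite (eta_bar_vs (HK := HK)) (eta_bar_vt (HK := HK)) !vcod_id. Qed.

(** The defining equation of [ucmp], in a form parallel to [N_mc_val]: one path of comparisons
    relates both the underlying cells and the units to those of the image. *)
Lemma N_mc_eta phib :
  eta_bar (N_mc phib) = uT (cmp phib) (vs (mc F (eta_bar phib))) [mc F (eta_bar phib)].
Proof.
case: phib => [phi|C psi e] /=.
  rewrite (uf_ht HF) (uf_idh HF).
  by case: (uT_idh HL (u_ht_idh HL (mh F (ht phi)))).
have [_ _ _ _ <-] := ucmpP C; congr uT.
by case: (nf_normal F (ueta_unit E C)).
Qed.

Lemma N_mc_bd phib : [/\ hs (N_mc phib) = map (mh F) (hs phib),
  ht (N_mc phib) = option_map (mh F) (ht phib),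
  vs (N_mc phib) = mv F (vs phib) & vt (N_mc phib) = mv F (vt phib)].
Proof.
have H := cmp_composable (eq_refl (ht (nval phib))) (eq_refl _) (eq_refl _).
have [_ k2 k3] := cmp_bd phib.
rewrite /= N_mc_val (uT1_hs HL H) (uT_vs HL H) (uT1_vt HL H) k2 k3 /=.
rewrite (m_hs HF) (m_vs HF) (m_vt HF) !vT_idl ?(m_vcod HF) //; split=> //.
by case: (phib) => [phi|C psi e] //=; rewrite (uf_ht HF).
Qed.

Lemma N_mc_chain f phibs g : chain (@vs _ NK) (@vt _ NK) f phibs g ->
  chain (@vs _ NL) (@vt _ NL) (mv F f) (map N_mc phibs) (mv F g).
Proof. by apply: chain_map => x; case: (N_mc_bd x). Qed.

Lemma cmp_path f phibs g : chain (@vs _ NK) (@vt _ NK) f phibs g ->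
  mv F f ->[map (mc F) (map (@nval K E) phibs)] mv F g /\
  upcomp (mv F f) (map cmp phibs) (map (fun x => [mc F (nval x)]) phibs)
    (map (@nval L D) (map N_mc phibs)).
Proof.
elim: phibs f => [|x l IH] f /=; first by move=> ->; split=> //; constructor.
case=> <- /IH [c P]; rewrite (m_vs HF) (m_vt HF); split=> //.
have H := cmp_composable (phib := x) (eq_refl _) (eq_refl _) (eq_refl _).
rewrite -(m_vs HF); apply: upcomp_consT H _ _ P; first by rewrite N_mc_val.
by rewrite /= (m_vt HF).
Qed.

Lemma cmp_eta_path f phibs g : chain (@vs _ NK) (@vt _ NK) f phibs g ->
  vid (mo F (vcod f)) ->[map (mc F) (map (@eta_bar K E) phibs)] vid (mo F (vcod g)) /\
  upcomp (vid (mo F (vcod f))) (map cmp phibs) (map (fun x => [mc F (eta_bar x)]) phibs)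
    (map (@eta_bar L D) (map N_mc phibs)).
Proof.
elim: phibs f => [|x l IH] f /=; first by move=> ->; split=> //; constructor.
case=> ex /IH [c P]; rewrite (m_vs HF) (m_vt HF).
have v1 := eta_bar_vs (HK := HK) x; have v2 := eta_bar_vt (HK := HK) x.
rewrite v1 v2 !(m_vid HF) /= ex; split=> //.
have [a1 a2] := eta_bar_cod x.
have H := cmp_composable (phib := x) (eta_bar_ht (HK := HK) x) a1 a2.
have ev : vid (mo F (vcod f)) = vs (mc F (eta_bar x)).
  by rewrite (m_vs HF) v1 (m_vid HF) /= ex.
rewrite ev; apply: upcomp_consT H _ _ P; first by rewrite N_mc_eta.
by rewrite /= (m_vt HF) v2 (m_vid HF).
Qed.

Lemma concat_single_map (X Y : Type) (h : X -> Y) (l : list X) :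
  concat (map (fun x => [h x]) l) = map h l.
Proof. by elim: l => [//|x l IH] /=; rewrite IH. Qed.

Lemma idunit_mc (e : cell K) : idunit e -> idunit (mc F e).
Proof.
case=> [[J ->]|[A u]]; first by left; exists (mh F J); rewrite (uf_idh HF).
by right; exists (mo F A); apply: (nf_normal F u).
Qed.

Lemma cmp_eq phib psib : ht phib = ht psib -> vcod (vs phib) = vcod (vs psib) ->
  cmp phib = cmp psib.
Proof.
case: phib => [phi|C phi e]; case: psib => [psi|C' psi d] //=; first by case=> ->.
by have [<- _] := unit_target_ob HK e; have [<- _] := unit_target_ob HK d => _ ->.
Qed.

(** Let [psi'] and [psi2] be the factorisations of [psib] and of its image. The heart is the
    equation [W], by which [psi2] after the comparisons of [phibs] is the comparison of [psib] after
    [mc F psi']. Composing [W] with the images of the underlying cells yields the claim. *)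
Lemma N_mc_comp psib phibs : acomposable psib phibs ->
  acomposable (N_mc psib) (map N_mc phibs) ->
  N_mc (aT psib phibs) = aT (N_mc psib) (map N_mc phibs).
Proof.
move=> H H'; have [_ [f [g [c ef eg _]]]] := H.
have [b1 b2 b3 b4] := N_mc_bd psib.
have [_ q2 _ _] := N_mc_bd (aT psib phibs).
apply: ncell_ext; first by rewrite N_aT_ht // q2 N_aT_ht.
have c' := N_mc_chain c.
have [psi' [P Hp p1 p2]] := N_factorP H c.
have [psi2 [Q Hq q3 q4]] := N_factorP H' c'.
rewrite (N_aT H' c' Q) N_mc_val (N_aT H c P).
have [cn Pn] := cmp_path c; have [ce Pe] := cmp_eta_path c.
have [r1 r2 r3 r4] := factors_bd HK (eta_bar_path H c) P.
have Hpsi : ucomposable (cmp psib) (vs (mc F psi')) [mc F psi'].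
  by apply: cmp_composable; rewrite ?p1 ?p2.
have Hval := cmp_composable (phib := psib) (eq_refl _) (eq_refl _) (eq_refl _).
case: P => P1 P2; case: Q => Q1 Q2.
rewrite -[vs (nval psib)]/(vs psib) -ef in P1 P2.
have evs : vdom (vs (nval (N_mc psib))) = mo F (vcod f).
  by rewrite -[vs (nval (N_mc psib))]/(vs (N_mc psib)) b3 (m_vdom HF) -ef.
rewrite evs in Q1 Q2.
have Fpsi := uf_composable HF P1; rewrite (m_vid HF) in Fpsi.
have FP2 := f_equal (mc F) P2; rewrite (uf_uT HF P1) (m_vid HF) in FP2.
have cc : vid (mo F (vcod f)) ->[map cmp phibs] vid (mo F (vcod g)).
  apply: (chain_map (k := fun f => vid (mo F (vcod f))) _ _ c) => x.
    by case: (cmp_bd x).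
  by case: (cmp_bd x).
have HW1 : ucomposable psi2 (vid (mo F (vcod f))) (map cmp phibs).
  have ceta := eta_bar_chain c'; rewrite (m_vcod HF) (m_vcod HF) in ceta.
  apply: ucomposable_path Q1 ceta cc _ _ _ => //.
  rewrite !map_map; apply: map_ext => x; rewrite N_mc_eta (uT_ht HL) //.
  by have [a1 a2] := eta_bar_cod x; apply: cmp_composable => //; apply: (eta_bar_ht (HK := HK)).
have eid : vcod (vid (mo F (vcod f))) = vdom (vid (mo F (vcod f))) by rewrite vcod_id vdom_id.
have ce' := ce; rewrite map_map -(concat_single_map (fun x => mc F (eta_bar x))) in ce'.
case: (uTA HL Pe HW1 eid ce'); rewrite concat_single_map -(map_map (@eta_bar K E)).
rewrite vT_idl ?vcod_id // => _ W1a W1b.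
case: (uTA1_vs HL Hpsi Fpsi) => W2a W2b W2c.
(* The images under [F] of the units can be cancelled; after composing with them both sides become
   the cell underlying [N_mc psib]. *)
have W : uT psi2 (vid (mo F (vcod f))) (map cmp phibs) =
         uT (cmp psib) (vs (mc F psi')) [mc F psi'].
  apply: (factors_uniq HL _ ce W1a W2b).
    apply/Forall_map; apply: Forall_impl (eta_bar_idunit (HK := HK) phibs).
    exact: idunit_mc.
  by rewrite -W1b -Q2 N_mc_val -W2c -FP2.
have ef' : vcod (mv F f) = vdom (vid (mo F (vcod f))) by rewrite vdom_id (m_vcod HF).
have cn' := cn; rewrite map_map -(concat_single_map (fun x => mc F (nval x))) in cn'.
case: (uTA HL Pn HW1 ef' cn'); rewrite concat_single_map -(map_map (@nval K E)).
rewrite vT_idl ?(m_vcod HF) // => _ _ ->; rewrite W.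
rewrite (uf_uT HF Hp).
case: (uTA1_vs HL Hpsi (uf_composable HF Hp)) => _ _ <-; congr uT.
apply: cmp_eq; rewrite ?N_aT_ht //.
rewrite -[vs (aT psib phibs)]/(vs (nval (aT psib phibs))).
case: (N_factorP H c) => psi3 [P3 Hp3 p3 _].
by rewrite (N_aT H c P3) (uT_vs HK Hp3) p3 vT_cod.
Qed.
End Nmap.

Section Nfunctor.
Variables (K L : vdcu) (E : unit_choice K) (D : unit_choice L) (F : nfunctor K L).
Let HK := vu_ax K.
Let HL := vu_ax L.
Let HF := nf_ax F.

Lemma N_map_ax : @is_afunctor (N_data HK E) (N_data HL D) (N_map E D F).
Proof.
split.
- split.
  + exact: (m_vdom HF).
  + exact: (m_vcod HF).
  + exact: (m_hdom HF).
  + exact: (m_hcod HF).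
  + exact: (m_vid HF).
  + exact: (m_vcomp HF).
  + by move=> phi; case: (N_mc_bd D F phi).
  + by move=> phi; case: (N_mc_bd D F phi).
  + by move=> phi; case: (N_mc_bd D F phi).
- by move=> phi; case: (N_mc_bd D F phi).
- by move=> psi phis H H'; rewrite !aTE; apply: N_mc_comp.
- by move=> J; rewrite /= (uf_idh HF).
(* The comparison after [F (eta o f)] equals the comparison after [F eta], then precomposed with
   [F f], and this is [eta o F f]. *)
move=> f; apply: ncell_ext => //.
rewrite -[aidv f]/(N_idv HK E f) -[aidv (mv _ f)]/(N_idv HL D (mv F f)).
rewrite N_idv_val -[mc _ _]/(N_mc D F (N_idv HK E f)) N_mc_val N_idv_val.
have [H _ _ _ e] := ucmpP E D F (vcod f).
have Hf := N_idv_composable E f.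
rewrite (uf_uT HF Hf).
have ev : vid (mo F (vcod f)) = vs (mc F (ueta E (vcod f))).
  by case: (nf_normal F (ueta_unit E (vcod f))) => _ /= ->.
rewrite ev in H e.
case: (uTA1_vs HL H (uf_composable HF Hf)) => _ _.
by rewrite e (m_vcod HF).
Qed.
End Nfunctor.

(** * The action of [N] on transformations *)

Lemma N_aT_ubar (K : vd_data) (HK : is_vdc K) (E : unit_choice K) (psi phi : cell K) :
  ucomposable psi (vs phi) [phi] ->
  @aT (N_data HK E) (ubar E psi) [ubar E phi] = ubar E (uT psi (vs phi) [phi]).
Proof.
move=> H; apply: (ncell_ext (HK := HK)).
  rewrite N_aT_ht /= ?(uT_ht HK) //.
  exact: (npath_composable (HK := HK) (psib := ubar E psi) (phis := [phi]) H).
exact: (N_aT_npath (HK := HK) (psib := ubar E psi) (phis := [phi]) H).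
Qed.

Section Ntransf.
Variables (K L : vdcu) (E : unit_choice K) (D : unit_choice L).
Variables (F G : nfunctor K L) (x : utransf F G).
Let HK := vu_ax K.
Let HL := vu_ax L.
Notation NK := (N_data HK E).
Notation NL := (N_data HL D).

Definition N_tmap : tmap NK NL :=
  @Tmap _ NK NL (xo x) (fun J => ubar D (xh x J)).

(** [psi'] is the factorisation through [eta_(F C)] of the nullary identity cell on
    [x_C], so this is what naturality of [x] at nullary cells requires.  *)
Lemma ucmp_nat C (psi' : cell L) :
  factors (uT (ueta D (mo G C)) (xo x C) []) [ueta D (mo F C)] psi' ->
  ucomposable psi' (vid (mo F C)) [ucmp E D F C] /\
  uT psi' (vid (mo F C)) [ucmp E D F C] =
  uT (ucmp E D G C) (xo x C) [xh x (ht (ueta E C))].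
Proof.
have HF := nf_ax F; have HG := nf_ax G; have Hx := ut_ax x.
have [f1 f2 f3 f4 f5] := ucmpP E D F C; have [g1 g2 g3 g4 g5] := ucmpP E D G C.
have [e1 e2 e3 _] := ueta_unit E C.
have [k1 k2] := unit_ht_ends HK (ueta_unit E C).
have [u1 u2 u3 _] := nf_normal F (ueta_unit E C).
have [v1 v2 v3 _] := nf_normal G (ueta_unit E C).
have [w1 w2 w3 _] := ueta_unit D (mo F C).
have Hd : ucomposable (ueta D (mo G C)) (xo x C) [].
  have := N_idv_composable D (xo x C); by rewrite (x_vcod Hx).
have ed : vcod (xo x C) = vdom (vs (ueta D (mo G C))) by case: Hd => ? [].
rewrite /factors (uT_vs HL Hd) vT_dom //.
rewrite (x_vdom Hx) => -[P1 P2].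
have vF : vid (mo F C) ->[[ucmp E D F C]] vid (mo F C) by rewrite /= f3 f4.
have H1 : ucomposable psi' (vid (mo F C)) [ucmp E D F C].
  have vN : vid (mo F C) ->[[ueta D (mo F C)]] vid (mo F C) by rewrite /= w2 w3.
  by apply: ucomposable_path P1 vN vF _ _ _ => //; rewrite /= ucmp_ht.
split=> //.
case: (uTA1_vs HL (chi := psi') (psi := ucmp E D F C) _ f1); rewrite f3 // => _ h1 h2.
have l := uxl_composable HK HG Hx (ueta E C); have r := uxr_composable HK HF Hx (ueta E C).
have lr := ut_uT HK HF HG Hx (ueta E C).
rewrite e1 e2 vdom_id /= in l lr.
rewrite u2 in r lr.
have HB : ucomposable (ucmp E D G C) (xo x C) [xh x (ht (ueta E C))].
  apply: ucomposable1.
  - by rewrite (x_vs Hx) k1.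
  - by rewrite g3 vdom_id (x_vcod Hx).
  - by rewrite g4 vdom_id (x_vt Hx) (x_vcod Hx) k2.
  - by rewrite g2 (ut_ht Hx).
have ex : vid (mo G C) = vs (mc G (ueta E C)) by rewrite v2.
have := uTA1 HL (chi := ucmp E D G C) (p := xo x C) HB r.
rewrite vT_idr ?(x_vdom Hx) // => -[b1 b2 b3].
(* After composition with [F eta_C] both sides equal [eta_(G C) o x_C]: on the left because the
   comparison of [F] turns [F eta_C] into [eta_(F C)], on the right by naturality of [x] at
   [eta_C]. *)
apply: (factors_uniq HL (es := [mc F (ueta E C)]) (b := mo F C) _ _ h1 b2).
- by constructor=> //; right; exists (mo F C); apply: nf_normal (ueta_unit E C).
- by rewrite /= u2 u3.
rewrite -h2 -b3 -lr.
case: (uTA1 HL g1 l); rewrite vT_idl ?(x_vcod Hx) // => _ _ ->.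
by rewrite g5 P2 f5 w2.
Qed.

Lemma N_tmap_ax : is_atransf (N_map E D F) (N_map E D G) N_tmap.
Proof.
have HF := nf_ax F; have HG := nf_ax G; have Hx := ut_ax x.
split.
- split.
  + exact: (x_vdom Hx).
  + exact: (x_vcod Hx).
  + exact: (x_nat Hx).
  + exact: (x_hs Hx).
  + exact: (x_vs Hx).
  + exact: (x_vt Hx).
- by move=> J /=; rewrite (ut_ht Hx).
move=> phi H H'; rewrite !aTE.
(* When the source is empty, [xpath] is the vertical identity on the component of [x], which is what
   [npath] assigns to the empty path over it. *)
have ep : xpath N_tmap (vdom (vs phi)) (hs phi) =
    npath HL D (xo x (vdom (vs phi))) (map (xh x) (hs phi)).
  by rewrite /xpath; case: (hs phi) => [//|J Js]; rewrite /npath /= map_map.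
rewrite ep {H ep}.
have l := uxl_composable HK HG Hx (nval phi); have r := uxr_composable HK HF Hx (nval phi).
have lr := ut_uT HK HF HG Hx (nval phi).
have HcG := cmp_composable D G (phib := phi) (eq_refl _) (eq_refl _) (eq_refl _).
have HcF := cmp_composable D F (phib := phi) (eq_refl _) (eq_refl _) (eq_refl _).
case: (uTA1_vs HL HcG l) => a1 a2 a3.
have Hl : ucomposable (nval (N_mc D G phi)) (xo x (vdom (vs phi))) (map (xh x) (hs phi)).
  by rewrite N_mc_val.
have Hp := npath_composable (HK := HL) (psib := N_mc D G phi) Hl.
apply: (ncell_ext (HK := HL)).
  rewrite !N_aT_ht //.
  have [_ -> _ _] := N_mc_bd D G phi; rewrite /xtgt.
  by case: (ht phi) => [J|] //=; rewrite (ut_ht Hx).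
rewrite (N_aT_npath (psib := N_mc D G phi) Hl) N_mc_val -a3 lr.
have [k1 k2 k3] := cmp_bd D G phi.
have HxG : ucomposable (cmp D G phi) (vs (xh x (ht (nval phi)))) [xh x (ht (nval phi))].
  apply: ucomposable1 => //.
  - by rewrite k2 vdom_id (x_vs Hx) (x_vcod Hx) (u_ht_dom HK).
  - by rewrite k3 vdom_id (x_vt Hx) (x_vcod Hx) (u_ht_cod HK).
  - by rewrite k1 (ut_ht Hx).
rewrite lr in a1.
case: (uTA1_vs HL HxG r) => b1 b2 b3.
rewrite b3.
(* By naturality of [x] in [L] the left side is now [cmp D G phi] after the component of [x],
   precomposed with [F phi]. For unary [phi] the comparison is an identity; for nullary [phi] it is
   moved past [x] by [ucmp_nat]. *)
case: phi {Hp} l r lr HcG HcF a1 a2 a3 Hl H' k1 k2 k3 HxG b1 b2 b3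
  => [phi|C psi e] l r lr HcG HcF a1 a2 a3 Hl H' k1 k2 k3 HxG b1 b2 b3.
  rewrite [xtgt _ _]/= [mc _ _]/= N_aT_ubar //=.
  by case: (uT_idh HL (ut_ht Hx (ht phi))) => _ ->.
have [ec _] := unit_target_ob HK e.
have xt : xtgt N_tmap (nbar e : cell NK) = N_idv HL D (xo x C).
  by rewrite /xtgt /= -ec.
rewrite xt in H' *.
have [psi' [P _ _ _]] := N_factorP (phibs := [_]) H' (conj (eq_refl _) (eq_refl _)).
rewrite (N_aT1 H' P) [mc _ _]/= -/(N_mc D F (nbar e)) N_mc_val.
rewrite N_idv_val (x_vcod Hx) in P.
case: (ucmp_nat P) => c1 c2.
have [f1 f2 f3 f4 f5] := ucmpP E D F C.
rewrite -f3 in c1 c2.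
case: (uTA1_vs HL c1 HcF) => d1 d2 d3.
have -> : vs (N_mc D F (nbar e)) = vs (nval (N_mc D F (nbar e))) by [].
rewrite N_mc_val d3 c2 /= e; congr uT; congr uT.
by rewrite (x_vs Hx); have [-> _] := unit_ht_ends HK (ueta_unit E C).
Qed.
End Ntransf.

(** * Strict 2-functoriality of [N] *)

Section Nfunctorial.
Variables (K L M : vdcu) (E : unit_choice K) (D : unit_choice L) (C : unit_choice M).

Lemma ucmp_id A : ucmp E E (nfid K) A = uidh (ht (ueta E A)).
Proof.
have [_ e _ _] := ueta_unit E A; symmetry; apply: ucmp_uniq => /=.
  by case: (uT_idh (vu_ax K) (eq_refl (ht (ueta E A)))); rewrite e.
by case: (uT_idh (vu_ax K) (eq_refl (ht (ueta E A)))); rewrite e.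
Qed.

Lemma N_mc_id (phi : cell (N_data (vu_ax K) E)) : N_mc E (nfid K) phi = phi.
Proof.
apply: ncell_ext; first by have [_ -> _ _] := N_mc_bd E (nfid K) phi; case: (ht phi).
rewrite N_mc_val /=.
have -> : cmp E (nfid K) phi = uidh (ht (nval phi)).
  by case: phi => [//|A psi e] /=; rewrite ucmp_id e.
by case: (uT_idh (vu_ax K) (eq_refl (ht (nval phi)))).
Qed.

Variables (G : nfunctor L M) (F : nfunctor K L).
Let HL := vu_ax L.
Let HM := vu_ax M.
Let HF := nf_ax F.
Let HG := nf_ax G.

(** The right-hand side sends [G (F eta)] first to [G eta] and then to [eta], which characterises
    the comparison of the composite by [ucmp_uniq]. *)
Lemma ucmp_comp A :
  ucomposable (ucmp D C G (mo F A)) (vs (mc G (ucmp E D F A))) [mc G (ucmp E D F A)] /\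
  ucmp E C (nfcomp G F) A =
  uT (ucmp D C G (mo F A)) (vs (mc G (ucmp E D F A))) [mc G (ucmp E D F A)].
Proof.
have [f1 f2 f3 f4 f5] := ucmpP E D F A; have [g1 g2 g3 g4 g5] := ucmpP D C G (mo F A).
have H : ucomposable (ucmp D C G (mo F A)) (vs (mc G (ucmp E D F A))) [mc G (ucmp E D F A)].
  apply: ucomposable1 => //.
  - by rewrite g3 (m_vs HG) f3 (m_vid HG) vcod_id vdom_id.
  - by rewrite g4 (m_vt HG) f4 (m_vid HG) vcod_id vdom_id.
  - by rewrite g2 (uf_ht HG) ucmp_ht.
split=> //; symmetry.
have [_ w2 w3 _] := nf_normal G (ueta_unit D (mo F A)).
have f1' := uf_composable HG f1; rewrite (m_vid HG) in f1'.
case: (uTA1_vs HM H f1') => h1 h2 h3.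
apply: ucmp_uniq; first exact: h2.
transitivity (uT (uT (ucmp D C G (mo F A)) (vs (mc G (ucmp E D F A))) [mc G (ucmp E D F A)])
   (vid (mo G (mo F A))) (map (mc G) [mc F (ueta E A)])); first by [].
rewrite -h3 -[RHS]g5.
have := uf_uT HG f1; rewrite f5 (m_vid HG) => <-.
by rewrite w2.
Qed.

Lemma N_mc_functor (phi : cell (N_data (vu_ax K) E)) :
  N_mc C (nfcomp G F) phi = N_mc C G (N_mc D F phi).
Proof.
apply: ncell_ext.
  have [_ -> _ _] := N_mc_bd C (nfcomp G F) phi; have [_ -> _ _] := N_mc_bd C G (N_mc D F phi).
  by have [_ -> _ _] := N_mc_bd D F phi; case: (ht phi).
rewrite !N_mc_val.
have HcF := cmp_composable D F (phib := phi) (eq_refl _) (eq_refl _) (eq_refl _).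
have [b1 b2 b3] := cmp_bd D F phi.
have eC : ucomposable (cmp C G (N_mc D F phi)) (vs (mc G (cmp D F phi))) [mc G (cmp D F phi)] /\
  cmp C (nfcomp G F) phi =
  uT (cmp C G (N_mc D F phi)) (vs (mc G (cmp D F phi))) [mc G (cmp D F phi)].
  case: (phi) => [phi'|A psi e] /=; last exact: ucmp_comp.
  rewrite (uf_idh HG) (uf_ht HF).
  by case: (uT_idh HM (u_ht_idh HM (mh G (mh F (ht phi'))))).
case: eC => H ->.
rewrite (uf_uT HG HcF).
case: (uTA1_vs HM H (uf_composable HG HcF)) => _ _ ->.
by rewrite -(m_vs HG).
Qed.
End Nfunctorial.

Section N2functor.
Variable E : forall K : vdcu, unit_choice K.

Definition N_obj (K : vdcu) : avdcu :=
  Avdcu (N_avdc (vu_ax K) (E K)) (@N_has_units K (vu_ax K) (E K)).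

Definition N_functor (K L : vdcu) (F : nfunctor K L) : afunctor (N_obj K) (N_obj L) :=
  @Afunctor (N_obj K) (N_obj L) _ (N_map_ax (E K) (E L) F).

Definition N_transf (K L : vdcu) (F G : nfunctor K L) (x : utransf F G) :
    atransf (N_functor F) (N_functor G) :=
  @Atransf (N_obj K) (N_obj L) (N_functor F) (N_functor G) _ (N_tmap_ax (E K) (E L) x).

Lemma N_functor_id (K : vdcu) : N_functor (nfid K) = aid (N_obj K).
Proof.
apply: afunctor_ext; apply: gmap_ext => //=.
by apply: functional_extensionality => phi; apply: N_mc_id.
Qed.

Lemma N_functor_comp (K L M : vdcu) (G : nfunctor L M) (F : nfunctor K L) :
  N_functor (nfcomp G F) = afcomp (N_functor G) (N_functor F).
Proof.
apply: afunctor_ext; apply: gmap_ext => //=.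
by apply: functional_extensionality => phi; apply: N_mc_functor.
Qed.

Definition N_2functor : strict2functor VirtDblCat_u AugVirtDblCat_u.
Proof.
refine (@Strict2functor VirtDblCat_u AugVirtDblCat_u N_obj N_functor N_transf
  N_functor_id N_functor_comp _ _ _).
- by move=> K L F; apply: atransf_ext; apply: tmap_ext.
- move=> K L F G H b a; apply: atransf_ext; apply: tmap_ext => [A|J].
    by rewrite (atcomp_o (K := N_obj K) (L := N_obj L)) /= vTE.
  rewrite (atcomp_h (K := N_obj K) (L := N_obj L)) /= uTE.
  by rewrite N_aT_ubar //; apply: utcomp_hc.
move=> K L M G G' F F' b a; apply: atransf_tot; [exact: N_functor_comp|exact: N_functor_comp|].
apply: tmap_ext => [A|J].
  by rewrite (athcomp_o (K := N_obj K) (L := N_obj L) (M := N_obj M)) /= vTE.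
rewrite (athcomp_h (K := N_obj K) (L := N_obj L) (M := N_obj M)) /= uTE.
by rewrite N_aT_ubar //; apply: uthcomp_hc.
Defined.
End N2functor.

(** * The isomorphism between [U(N(K))] and [K] *)

Section UN.
Variables (K : vdcu) (E : unit_choice K).
Let HK := vu_ax K.
Notation NK := (N_data HK E).
Variable (HN : is_avdc NK).
Notation UNK := (U_data HN).

Lemma uval_ubar (p : cell UNK) : uval p = ubar E (nval (uval p)).
Proof. by have := uval_ht p; case: (uval p). Qed.

Lemma ht_uval (p : cell UNK) : ht (nval (uval p)) = utgt p.
Proof. by have := uval_ht p; rewrite {1}uval_ubar => -[]. Qed.

Definition UN_cell (p : cell UNK) : cell K := nval (uval p).

Definition UN_map : gmap UNK K :=
  @Gmap _ UNK K (fun A => A) (fun f => f) (fun J => J) UN_cell.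

Definition UN_inv_cell (phi : cell K) : cell UNK :=
  exist (fun p => ht (fst p) = Some (snd p)) (ubar E phi : cell NK, ht phi)
    (eq_refl (Some (ht phi))).

Definition UN_inv : gmap K UNK :=
  @Gmap _ K UNK (fun A => A) (fun f => f) (fun J => J) UN_inv_cell.

Lemma UN_mapK (p : cell UNK) : UN_inv_cell (nval (uval p)) = p.
Proof. by apply: ucell_ext; rewrite [RHS]uval_ubar. Qed.

(** Both conventions read the empty path over [f] as the vertical identity cell, so composition in
    [U(N(K))] falls under [N_aT_npath]. *)
Lemma upath_npath f (phis : list (cell UNK)) :
  upath f phis = npath HK E f (map UN_cell phis).
Proof.
have em l : map (@uval NK) l = map (ubar E) (map UN_cell l).
  by rewrite map_map; apply: map_ext; apply: uval_ubar.
by case: phis => [//|p l]; apply: em.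
Qed.

Lemma UN_map_ax : is_ufunctor UN_map.
Proof.
split; first split=> //=.
- by move=> g f e e'; rewrite (proof_irrelevance _ e e').
- by move=> phi; rewrite map_id.
- exact: ht_uval.
- move=> psi f phis H H'; rewrite (uTE H').
  have -> : mc UN_map (ucomp H) = nval (uval (uT psi f phis)) by rewrite -(uTE H).
  by rewrite (U_uT H) upath_npath; apply: (N_aT_npath H').
- by [].
Qed.

Lemma UN_inv_ax : is_ufunctor UN_inv.
Proof.
split; first split=> //=.
- by move=> g f e e'; rewrite (proof_irrelevance _ e e').
- by move=> phi; rewrite map_id.
- by [].
- move=> psi f phis H H'; rewrite !uTE; apply: ucell_ext.
  rewrite [RHS](U_uT H') upath_npath map_map map_id.
  have H2 : ucomposable (nval (ubar E psi)) f phis by [].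
  apply: (ncell_ext (HK := HK)).
    rewrite N_aT_ht; first exact: (npath_composable (HK := HK)).
    by rewrite /= (uT_ht HK H).
  by rewrite (N_aT_npath (HK := HK)).
by move=> J; apply: ucell_ext.
Qed.

Lemma UN_inv_normal : is_normal UN_inv.
Proof. by move=> A eta u; apply: U_unit; apply: N_unit. Qed.

(** The universal property is carried along the mutually inverse functors: a cell of [K] is barred,
    factored in [U(N(K))], and its factorisation is unbarred. *)
Lemma UN_map_normal : is_normal UN_map.
Proof.
move=> A eta [e1 e2 e3 u]; split=> // J' J'' chi h1 h2 h3.
have [chi' [[g1 g2 g3 g4 [H g5]] un]] := u J' J'' (UN_inv_cell chi) h1 h2 h3.
have eP : map (mc UN_map) (map (@uidh UNK) J' ++ eta :: map (@uidh UNK) J'') =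
    map (@uidh K) J' ++ nval (uval eta) :: map (@uidh K) J''.
  by rewrite map_app /= !map_map.
have eQ : map (mc UN_inv) (map (@uidh K) J' ++ nval (uval eta) :: map (@uidh K) J'') =
    map (@uidh UNK) J' ++ eta :: map (@uidh UNK) J''.
  rewrite map_app /= UN_mapK !map_map.
  by congr (_ ++ _ :: _); apply: map_ext => J; apply: ucell_ext.
exists (nval (uval chi')); split.
  have H' := uf_composable UN_map_ax H; rewrite eP in H'.
  split=> //=.
  - by rewrite ht_uval -[utgt eta]/(ht eta) -g1.
  - by rewrite ht_uval; exact: g2.
  exists H'; rewrite uTE -eP.
  rewrite -[nval (uval chi')]/(mc UN_map chi') 
    -[vid _]/(mv UN_map (vid (vdom (vs (UN_inv_cell chi))))).
  by rewrite -(uf_uT UN_map_ax H) -(uTE H) -g5.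
move=> chi2 [k1 k2 k3 k4 [H2 k5]].
rewrite (un (UN_inv_cell chi2)) //; split=> //=.
- by rewrite -ht_uval.
have H3 : ucomposable (mc UN_inv chi2) (vid (vdom (vs chi)))
    (map (mc UN_inv) (map (@uidh K) J' ++ nval (uval eta) :: map (@uidh K) J'')).
  exact: (uf_composable UN_inv_ax H2).
have e : UN_inv_cell chi = uT (mc UN_inv chi2) (vid (vdom (vs chi)))
    (map (mc UN_inv) (map (@uidh K) J' ++ nval (uval eta) :: map (@uidh K) J'')).
  rewrite {1}k5 uTE; exact: (uf_uT UN_inv_ax H2).
rewrite eQ in H3 e; exists H3; exact: (eq_trans e (eq_sym (uTE H3))).
Qed.

Definition UN_functor := Nfunctor UN_map_ax UN_map_normal.
Definition UN_inv_functor := Nfunctor UN_inv_ax UN_inv_normal.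
End UN.

Lemma UN_equivalence (E : forall K : vdcu, unit_choice K) :
  inhabited (two_nat_iso (comp_2functor U (N_2functor E)) (id_2functor VirtDblCat_u)).
Proof.
constructor.
have nat1 (K L : vdcu) (F : nfunctor K L) :
    nfcomp F (UN_functor (N_avdc (vu_ax K) (E K))) =
    nfcomp (UN_functor (N_avdc (vu_ax L) (E L))) (U_functor (N_functor E F)).
  apply: nfunctor_ext; apply: gmap_ext => //=.
  apply: functional_extensionality => p /=; rewrite /UN_cell.
  have e := uval_ubar (HN := N_avdc (vu_ax K) (E K)) p.
  symmetry; exact: (f_equal (fun c => nval (N_mc (E L) F c)) e).
refine (@TwoNatIso _ _ (comp_2functor U (N_2functor E)) (id_2functor VirtDblCat_u)
  (fun K => UN_functor (N_avdc (vu_ax K) (E K)))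
  (fun K => UN_inv_functor (N_avdc (vu_ax K) (E K))) _ _ nat1 _).
- move=> K; apply: nfunctor_ext; apply: gmap_ext => //=.
  by apply: functional_extensionality => p; apply: UN_mapK.
- by move=> K; apply: nfunctor_ext; apply: gmap_ext.
move=> K L F G a; apply: utransf_tot; [exact: nat1|exact: nat1|].
apply: tmap_ext => [A|J].
  rewrite (uthcomp_o (K := U_obj (N_obj E K)) (L := K) (M := L)).
  rewrite (uthcomp_o (K := U_obj (N_obj E K)) (L := U_obj (N_obj E L)) (M := L)).
  have Ha := ut_ax a.
  rewrite /= (m_vid (nf_ax G)) vT_idl; first exact: (x_vcod Ha).
  rewrite vT_idr //; exact: (x_vdom Ha).
rewrite (uthcomp_h (K := U_obj (N_obj E K)) (L := K) (M := L)).
rewrite (uthcomp_h (K := U_obj (N_obj E K)) (L := U_obj (N_obj E L)) (M := L)).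
have Ha := ut_ax a.
rewrite /= (uf_idh (nf_ax G)).
case: (uT_idh (vu_ax L) (ut_ht Ha J)) => _ ->.
by rewrite (uT_idh_r (vu_ax L)) // (x_hs Ha).
Qed.

(** * The isomorphism between [N(U(K))] and [K] *)

Section NU.
Variables (K : avdcu) (E : unit_choice (U_obj K)).
Let HK := au_ax K.
Let HU : is_vdc (U_obj K) := vu_ax (U_obj K).
Notation N := (N_data HU E).
Implicit Types (phib psib : cell N) (phibs : list (cell N)) (f g : vmor K) (C : ob K).

Definition counit_inv C : cell K :=
  proj1_sig (constructive_indefinite_description _ (U_unit_inverse (ueta_unit E C))).

Lemma counit_invP C :
  unit_inverse C (utgt (ueta E C)) (uval (ueta E C)) (counit_inv C).
Proof. by rewrite /counit_inv; case: constructive_indefinite_description. Qed.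

(** Postcomposition with [NU_post phib] turns the unary cell underlying [phib] into the
    cell of [K] that [phib] represents.  *)
Definition NU_post phib : cell K :=
  match phib with
  | ubar _ phi => aidh (utgt phi)
  | @nbar _ _ C _ _ => counit_inv C
  end.

(** Unary cells are sent to their underlying cells by computation; [NU_cellE] supplies the uniform
    description by [NU_post]. *)
Definition NU_cell phib : cell K :=
  match phib with
  | ubar _ phi => uval phi
  | @nbar _ _ C psi _ => aT (counit_inv C) [uval psi]
  end.

Lemma NU_post_bd phib : [/\ hs (NU_post phib) = [utgt (nval phib)],
  ht (NU_post phib) = ht phib, vs (NU_post phib) = vid (vcod (vs phib)) &
  vt (NU_post phib) = vid (vcod (vt phib))].
Proof.
case: phib => [phi|C psi e] /=.
  rewrite (a_hs_idh HK) (a_ht_idh HK) (a_vs_idh HK) (a_vt_idh HK).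
  by have := a_ht_chain HK (uval phi); rewrite uval_ht => -[-> ->].
have [e1 e2] := unit_target_ob HU e; rewrite /= in e1 e2; rewrite -e1 -e2.
by case: (counit_invP C) => _ [-> -> -> ->] _ _; rewrite -[utgt psi]/(ht psi) e.
Qed.

Lemma NU_post_composable phib (phi : cell (U_obj K)) : ht phi = ht (nval phib) ->
  vcod (vs phi) = vcod (vs phib) -> vcod (vt phi) = vcod (vt phib) ->
  acomposable (NU_post phib) [uval phi].
Proof.
move=> e1 e2 e3; have [k1 _ k3 k4] := NU_post_bd phib; apply: acomposable1.
- by rewrite k3 vdom_id.
- by rewrite k4 vdom_id.
- by rewrite k1 uval_ht /=; congr cons.
Qed.

Lemma NU_cellE phib : acomposable (NU_post phib) [uval (nval phib)] /\
  NU_cell phib = aT (NU_post phib) [uval (nval phib)].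
Proof.
split; first exact: NU_post_composable.
by case: phib => [phi|//] /=; rewrite aT_idh // uval_ht.
Qed.

Lemma NU_cell_bd phib : [/\ hs (NU_cell phib) = hs phib, ht (NU_cell phib) = ht phib,
  vs (NU_cell phib) = vs phib & vt (NU_cell phib) = vt phib].
Proof.
have [H ->] := NU_cellE phib; have [_ k2 k3 k4] := NU_post_bd phib.
by rewrite aT1_hs // aT_ht // aT1_vs // aT1_vt // k2 k3 k4 !vT_idl.
Qed.

Lemma NU_cell_eta phib : acomposable (uval (eta_bar phib)) [NU_cell phib] /\
  aT (uval (eta_bar phib)) [NU_cell phib] = uval (nval phib).
Proof.
case: phib => [phi|C psi e].
  by have := aT_idl_tgt HK (uval phi); rewrite uval_ht.
have ui := counit_invP C; have [_ c2] := unit_inverse_comp ui.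
case: ui => _ _ _ i2; have [H _] := NU_cellE (nbar e).
have [h1 h2 h3] := aTA1 HK c2 H; split; first exact: h1.
rewrite /= h3 i2 aT_idh // uval_ht; congr Some; exact: e.
Qed.

Lemma NU_post_eq phib psib : ht phib = ht psib -> vcod (vs phib) = vcod (vs psib) ->
  NU_post phib = NU_post psib.
Proof.
case: phib => [phi|C phi e]; case: psib => [psi|C' psi d] //=; first by case=> ->.
by have [<- _] := unit_target_ob HU e; have [<- _] := unit_target_ob HU d => _ ->.
Qed.

Lemma NU_chain f phibs g : chain (@vs _ N) (@vt _ N) f phibs g ->
  chain (@vs _ K) (@vt _ K) f (map NU_cell phibs) g.
Proof. by apply: (chain_map (k := fun f => f)) => x; case: (NU_cell_bd x). Qed.

Lemma NU_apcomp phibs : apcomp (map (fun x => @uval K (@eta_bar (U_obj K) E x)) phibs)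
  (map (fun x => [NU_cell x]) phibs) (map (fun x => @uval K (@nval (U_obj K) E x)) phibs).
Proof.
elim: phibs => [|x l IH] /=; first by constructor.
have [H <-] := NU_cell_eta x; rewrite -(aTE H); exact: apcomp_cons.
Qed.

(** By [NU_cell_eta] the underlying cells of [phibs] are their units after the [NU_cell]s. Hence
    [psi'] composed with them is [psi] composed with the [NU_cell]s, and [NU_post] is applied to
    both. *)
Lemma NU_cell_comp psib phibs : acomposable psib phibs ->
  acomposable (NU_cell psib) (map NU_cell phibs) /\
  NU_cell (aT psib phibs) = aT (NU_cell psib) (map NU_cell phibs).
Proof.
move=> H; have [nz [f [g [c ef eg _]]]] := H.
have [psi' [P Hp ep _]] := N_factorP H c; have ev := N_aT H c P.
(* As [phibs] is non-empty, no vertical identity is inserted by [upath]. *)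
have up (h : cell N -> cell (U_obj K)) a : @upath K a (map h phibs) =
    map (fun x => @uval K (h x)) phibs.
  by case: (phibs) nz => [//|x l] _; rewrite /upath -[map h _]/(_ :: _) /= map_map.
have [P1 P2] := P.
have U1 := U_composable HK P1; rewrite up in U1.
have U2 := f_equal (@uval K) P2; rewrite (U_uT P1) up in U2.
have c' := NU_chain c; rewrite -(concat_single_map NU_cell) in c'.
have [a1 a2 a3] := aTA HK (NU_apcomp phibs) U1 c'.
rewrite concat_single_map -U2 in a2 a3.
have [b1 ->] := NU_cellE psib.
have [b2 b3 b4] := aTA1 HK b1 a2; split=> //.
have [_ ->] := NU_cellE (aT psib phibs).
rewrite ev (U_uT Hp) up a3 -b4; congr aT.
apply: NU_post_eq; first exact: N_aT_ht.
by rewrite -[vs (aT psib phibs)]/(vs (nval (aT psib phibs))) ev (uT_vs HU Hp) vT_cod ?ep.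
Qed.

(** [NU_cell_eta] recovers the underlying cell by postcomposing with [eta_bar], which depends only
    on boundary data preserved by [NU_cell]. *)
Lemma NU_cell_inj phib psib : NU_cell phib = NU_cell psib -> phib = psib.
Proof.
move=> e; have [_ h1 h2 _] := NU_cell_bd phib; have [_ h3 h4 _] := NU_cell_bd psib.
have eh : ht phib = ht psib by rewrite -h1 -h3 e.
apply: ncell_ext => //; apply: ucell_ext.
have [_ <-] := NU_cell_eta phib; have [_ <-] := NU_cell_eta psib.
rewrite e (eta_bar_eq (HK := HU) eh) //.
by rewrite -h2 -h4 e.
Qed.

Lemma NU_cell_surj (phi : cell K) : exists phib, NU_cell phib = phi.
Proof.
have := a_ht_chain HK phi; case h: (ht phi) => [J|] /= e.
  by exists (ubar E (exist (fun p => ht (fst p) = Some (snd p)) (phi, J) h : cell (U_obj K))).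
(* A nullary [phi] comes from the bar of [eta o phi], because [eps o eta] is an identity. *)
have ui := counit_invP (vcod (vs phi)); have [c1 c2] := unit_inverse_comp ui.
case: ui => -[d1 d2 d3 d4] _ i1 _.
have H : acomposable (uval (ueta E (vcod (vs phi)))) [phi].
  apply: acomposable1; rewrite ?d3 ?d4 ?vdom_id //.
  by rewrite d1 h.
have hp : ht (aT (uval (ueta E (vcod (vs phi)))) [phi]) = Some (utgt (ueta E (vcod (vs phi)))).
  by rewrite aT_ht.
pose psi : cell (U_obj K) := exist (fun p => ht (fst p) = Some (snd p))
  (aT (uval (ueta E (vcod (vs phi)))) [phi], utgt (ueta E (vcod (vs phi)))) hp.
exists (@nbar (U_obj K) E (vcod (vs phi)) psi (eq_refl _)) => /=.
rewrite /psi /uval /= -/(uval _).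
have [_ _ ->] := aTA1 HK c1 H; rewrite i1.
by have := aT_idl_tgt HK phi; rewrite h => -[].
Qed.

Definition NU_map : gmap N K :=
  @Gmap _ N K (fun A => A) (fun f => f) (fun J => J) NU_cell.

Lemma NU_map_ax : is_afunctor NU_map.
Proof.
split; first split=> //=.
- by move=> g f e e'; rewrite (proof_irrelevance _ e e').
- by move=> phi; rewrite map_id; case: (NU_cell_bd phi).
- by move=> phi; case: (NU_cell_bd phi).
- by move=> phi; case: (NU_cell_bd phi).
- by move=> phi; have [_ e _ _] := NU_cell_bd phi; rewrite [LHS]e; case: (ht phi).
- by move=> psi phis H H'; rewrite !aTE; case: (NU_cell_comp H).
- by [].
move=> f; have ui := counit_invP (vcod f); have [c1 c2] := unit_inverse_comp ui.
case: ui => -[d1 d2 d3 d4] _ i1 _.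
have Hf := N_idv_composable E f.
transitivity (aT (counit_inv (vcod f)) [uval (nval (N_idv HU E f))]); first by [].
rewrite N_idv_val (U_uT Hf) /=.
have H : acomposable (uval (ueta E (vcod f))) [@aidv K f] by exact: (U_composable HK Hf).
have [_ _ ->] := aTA1 HK c1 H; rewrite i1.
have [_ ->] := @aT_idv K HK (vid (vcod f)) f (eq_sym (vdom_id _)).
by rewrite vT_idl.
Qed.

Definition NU_inv_cell (phi : cell K) : cell N :=
  proj1_sig (constructive_indefinite_description _ (NU_cell_surj phi)).

Lemma NU_invK phi : NU_cell (NU_inv_cell phi) = phi.
Proof. by rewrite /NU_inv_cell; case: constructive_indefinite_description. Qed.

Lemma NU_cellK phib : NU_inv_cell (NU_cell phib) = phib.
Proof. by apply: NU_cell_inj; rewrite NU_invK. Qed.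

Definition NU_inv : gmap K N :=
  @Gmap _ K N (fun A => A) (fun f => f) (fun J => J) NU_inv_cell.

(** Each law is checked after applying the injective functor [NU_map]. *)
Lemma NU_inv_ax : is_afunctor NU_inv.
Proof.
have bd phi : [/\ hs (NU_inv_cell phi) = hs phi, ht (NU_inv_cell phi) = ht phi,
    vs (NU_inv_cell phi) = vs phi & vt (NU_inv_cell phi) = vt phi].
  have [a b c d] := NU_cell_bd (NU_inv_cell phi).
  by rewrite -a -b -c -d NU_invK.
split; first split=> //=.
- by move=> g f e e'; rewrite (proof_irrelevance _ e e').
- by move=> phi; rewrite map_id; case: (bd phi).
- by move=> phi; case: (bd phi).
- by move=> phi; case: (bd phi).
- by move=> phi; have [_ e _ _] := bd phi; rewrite [LHS]e; case: (ht phi).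
- move=> psi phis H H'; rewrite (aTE H) (aTE H'); apply: NU_cell_inj; rewrite NU_invK.
  have [_ ->] := NU_cell_comp H'; rewrite map_map /= NU_invK.
  congr aT; rewrite -[LHS]map_id; apply: map_ext => x; by rewrite NU_invK.
- move=> J; apply: NU_cell_inj; rewrite NU_invK; symmetry; exact: (af_idh NU_map_ax J).
- move=> f; apply: NU_cell_inj; rewrite NU_invK; symmetry; exact: (af_idv NU_map_ax f).
Qed.

Definition NU_functor := Afunctor NU_map_ax.
Definition NU_inv_functor := Afunctor NU_inv_ax.
End NU.

(** * Naturality of the isomorphism between [N(U(K))] and [K] *)

Section NUnatural.
Variables (K L : avdcu) (E : unit_choice (U_obj K)) (D : unit_choice (U_obj L)).
Variable (F : afunctor K L).
Let HK := au_ax K.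
Let HL := au_ax L.
Let HF := af_ax F.

(** Both cells are left inverse to [F eta_C], which also has [F eps_C] as a right inverse: inserting
    [F eta_C o F eps_C] after [F I_C] turns the left side into [F eps_C]. *)
Lemma counit_inv_nat (C : ob K) :
  let u := uval (ucmp E D (U_functor F) C : cell (U_obj L)) in
  acomposable (counit_inv D (mo F C)) [u] /\
  aT (counit_inv D (mo F C)) [u] = mc F (counit_inv E C).
Proof.
move=> u; have ui := counit_invP E C; have vi := counit_invP D (mo F C).
have [c1 c2] := unit_inverse_comp ui; have [d1 d2] := unit_inverse_comp vi.
case: ui => -[e1 e2 e3 e4] [h1 h2 h3 h4] i1 i2.
case: vi => -[e5 e6 e7 e8] [h5 h6 h7 h8] i3 i4.
have [g1 g2 g3 g4 g5] := ucmpP E D (U_functor F) C.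
have g6 := ucmp_ht E D (U_functor F) C.
have Hu : acomposable (counit_inv D (mo F C)) [u].
  apply: acomposable1.
  - by rewrite h7 vdom_id -[vs u]/(vs (ucmp E D (U_functor F) C)) g3 vcod_id.
  - by rewrite h8 vdom_id -[vt u]/(vt (ucmp E D (U_functor F) C)) g4 vcod_id.
  - by rewrite h5 uval_ht; congr [_]; symmetry; exact: g6.
split=> //.
have f1 := af_composable HF c1; have f2 := af_composable HF c2.
have j1 := af_aT HF c1; have j2 := af_aT HF c2.
rewrite i1 (af_idv HF) (m_vid HF) in j1; rewrite i2 (af_idh HF) in j2.
have Uu : acomposable u [mc F (uval (ueta E C))] by exact: (U_composable HL g1).
have uu : aT u [mc F (uval (ueta E C))] = uval (ueta D (mo F C)).
  by rewrite -(f_equal (@uval L) g5) (U_uT g1).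
have hsu : hs u = [mh F (utgt (ueta E C))] by exact: g2.
have [k1 k2 k3] := aTA1 HL Hu Uu; rewrite uu i3 in k3.
have [l1 l2 l3] := aTA1 HL k2 f2.
have := l3.
rewrite -[aT (mc F _) _]/(aT (mc F (uval (ueta E C))) (map (mc F) [counit_inv E C])) -j2.
rewrite aT_idh_r; first by rewrite (aT1_hs HL Hu).
move=> ->; rewrite -k3.
have hn : ht (mc F (counit_inv E C)) = None by rewrite (af_ht HF) h2.
have := aT_idl_tgt HL (mc F (counit_inv E C)); rewrite hn => -[_].
by rewrite (m_vs HF) h3 (m_vid HF) vcod_id.
Qed.

Lemma NU_nat :
  afcomp F (NU_functor E) = afcomp (NU_functor D)
    (@Afunctor (N_data _ _) (N_data _ _) _
      (N_map_ax (K := U_obj K) (L := U_obj L) E D (U_functor F))).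
Proof.
apply: afunctor_ext; apply: gmap_ext => //=.
apply: functional_extensionality => -[phi|C psi e] //=.
have ui := counit_invP E C; have [c1 c2] := unit_inverse_comp ui.
have [H _] := NU_cellE (@nbar (U_obj K) E C psi e).
rewrite -[NU_post _]/(counit_inv E C) -[nval _]/psi in H.
have Hc := @cmp_composable (U_obj K) (U_obj L) E D (U_functor F) (nbar e) psi
  (eq_refl _) (eq_refl _) (eq_refl _).
rewrite (U_uT Hc) (af_aT HF H).
have Hu : acomposable (uval (ucmp E D (U_functor F) C : cell (U_obj L))) [mc F (uval psi)].
  exact: (U_composable HL Hc).
have [k1 k2] := counit_inv_nat C.
by have [_ _ ->] := aTA1 HL k1 Hu; rewrite k2.
Qed.
End NUnatural.

(** The 2-dimensional naturality reduces to identity laws, as the isomorphism has identity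
    components on vertical morphisms and preserves horizontal identities. *)
Lemma NU_equivalence (E : forall K : vdcu, unit_choice K) :
  inhabited (two_nat_iso (comp_2functor (N_2functor E) U) (id_2functor AugVirtDblCat_u)).
Proof.
constructor.
have nat1 (K L : avdcu) (F : afunctor K L) :
    afcomp F (NU_functor (E (U_obj K))) =
    afcomp (NU_functor (E (U_obj L))) (N_functor E (U_functor F)).
  exact: NU_nat.
refine (@TwoNatIso _ _ (comp_2functor (N_2functor E) U) (id_2functor AugVirtDblCat_u)
  (fun K : avdcu => NU_functor (E (U_obj K)))
  (fun K : avdcu => NU_inv_functor (E (U_obj K))) _ _ nat1 _).
- move=> K; apply: afunctor_ext; apply: gmap_ext => //=.
  by apply: functional_extensionality => p; apply: NU_cellK.
- move=> K; apply: afunctor_ext; apply: gmap_ext => //=.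
  by apply: functional_extensionality => p; apply: NU_invK.
move=> K L F G a; apply: atransf_tot; [exact: nat1|exact: nat1|].
have Ha := at_ax a.
apply: tmap_ext => [A|J].
  rewrite (athcomp_o (K := N_obj E (U_obj K)) (L := K) (M := L)).
  rewrite (athcomp_o (K := N_obj E (U_obj K)) (L := N_obj E (U_obj L)) (M := L)).
  rewrite /= (m_vid (af_ax G)) vT_idl; first exact: (x_vcod Ha).
  rewrite vT_idr //; exact: (x_vdom Ha).
rewrite (athcomp_h (K := N_obj E (U_obj K)) (L := K) (M := L)).
rewrite (athcomp_h (K := N_obj E (U_obj K)) (L := N_obj E (U_obj L)) (M := L)).
rewrite /= (af_idh (af_ax G)) aT_idh; first exact: (at_ht Ha).
rewrite aT_idh_r //; exact: (x_hs Ha).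
Qed.

Theorem theorem3p26 :
  (forall (K : vdcu) (E : unit_choice K),
     (forall (psib : cell (N_graph E)) (phibs : list (cell (N_graph E)))
        (H : acomposable psib phibs),
        (exists! psi' : cell K, N_factor psib phibs psi') /\
        N_is_comp psib phibs (@acomp (N_data (vu_ax K) E) psib phibs H)) /\
     is_avdc (N_data (vu_ax K) E) /\
     a_has_units (N_data (vu_ax K) E)) /\
  (forall E : (forall K : vdcu, unit_choice K),
     exists N : strict2functor VirtDblCat_u AugVirtDblCat_u,
       (forall K : vdcu, au_data (f0 N K) = N_data (vu_ax K) (E K)) /\
       strict_2equivalence U N).
Proof.
split=> [K E|E].
  split; last by split; [exact: N_avdc|exact: N_has_units].
  move=> psib phibs H; split; last exact: (N_comp_spec (HK := vu_ax K) H).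
  exact: (N_factor_exists (HK := vu_ax K) H).
exists (N_2functor E); split=> //.
split; [exact: NU_equivalence|exact: UN_equivalence].
Qed.
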